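(* Consider the modulo-sum relay channel described in the context, and let $R_0=\max_{p(x_1)} I(X_1;S)$ be the capacity of the relay–destination channel $p(s\mid x_1)$. Then its capacity is $$C=\max_{p(u\mid y_1):\ I(U;Y_1)\le R_0}\ \bigl(\log_2 m-H(Z\mid U)\bigr),$$ where $(Z,Y_1,U)$ has joint law $p(z)p(y_1\mid z)p(u\mid y_1)$, and the maximization may be restricted to $U$ with $|\mathcal U|\le|\mathcal Y_1|+2$.
   Context: Modulo-sum relay channel: fix an integer $m\ge2$. Source input $X_i\in\mathbb Z_m$; noise $Z_i\in\mathbb Z_m$ i.i.d. with an arbitrary distribution $p(z)$, independent of the message; the destination receives $Y_i=X_i+Z_i \pmod m$. The relay observes $Y_{1i}$ in a finite alphabet $\mathcal Y_1$, generated memorylessly from $Z_i$ via a fixed conditional law $p(y_1\mid z)$ (so $p(y_1\mid x,y,z)=p(y_1\mid z)$). The relay sends $X_{1i}$ over a separate discrete memoryless channel with finite alphabets and transition law $p(s\mid x_1)$, independent of everything else, whose output $S_i$ is seen by the destination. An $(n,2^{nR})$ code consists of a message $W$ uniform on $\{1,\dots,2^{nR}\}$, an encoder $X^n=X^n(W)$, relay functions $X_{1i}=f_i(Y_1^{i-1})$, and a decoder $\hat W=g(Y^n,S^n)$; a rate is achievable if codes exist with $\Pr(\hat W\ne W)\to0$, and the capacity is the supremum of achievable rates. Entropies are in bits. *)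

(* Defs.v *)
From Stdlib Require Import Reals.
From mathcomp Require Import all_boot ssralg zmodp.
Set Implicit Arguments.
Unset Strict Implicit.
Unset Printing Implicit Defensive.

Local Open Scope R_scope.

Definition rsum (T : finType) (F : T -> R) : R := \big[Rplus/0]_(t : T) F t.
Definition rprod (n : nat) (F : 'I_n -> R) : R := \big[Rmult/1]_(i < n) F i.

Definition log2 (x : R) : R := ln x / ln 2.
(* convention 0 log 0 = 0 *)
Definition plogp (x : R) : R := if Rlt_dec 0 x then x * log2 x else 0.

Definition is_dist (T : finType) (p : T -> R) : Prop :=
  (forall t, 0 <= p t) /\ rsum p = 1.
Definition is_channel (A B : finType) (W : A -> B -> R) : Prop :=
  forall a, is_dist (W a).

Definition entropy (T : finType) (p : T -> R) : R := - rsum (fun t => plogp (p t)).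
Definition marg1 (A B : finType) (P : A * B -> R) (a : A) : R := rsum (fun b => P (a, b)).
Definition marg2 (A B : finType) (P : A * B -> R) (b : B) : R := rsum (fun a => P (a, b)).
Definition mutual_info (A B : finType) (P : A * B -> R) : R :=
  entropy (marg1 P) + entropy (marg2 P) - entropy P.
Definition cond_entropy (A B : finType) (P : A * B -> R) : R :=
  entropy P - entropy (marg2 P).

Definition relay_rate (X1 S : finType) (ps : X1 -> S -> R) (p : X1 -> R) : R :=
  mutual_info (fun xs : X1 * S => p xs.1 * ps xs.1 xs.2).

Definition joint_ZU (m : nat) (Y1 U : finType) (pz : 'Z_m -> R)
  (py1 : 'Z_m -> Y1 -> R) (q : Y1 -> U -> R) (zu : 'Z_m * U) : R :=
  rsum (fun y1 : Y1 => pz zu.1 * py1 zu.1 y1 * q y1 zu.2).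
Definition joint_UY1 (m : nat) (Y1 U : finType) (pz : 'Z_m -> R)
  (py1 : 'Z_m -> Y1 -> R) (q : Y1 -> U -> R) (uy : U * Y1) : R :=
  rsum (fun z : 'Z_m => pz z * py1 z uy.2 * q uy.2 uy.1).
Definition aux_info (m : nat) (Y1 U : finType) (pz : 'Z_m -> R)
  (py1 : 'Z_m -> Y1 -> R) (q : Y1 -> U -> R) : R :=
  mutual_info (joint_UY1 pz py1 q).
Definition aux_value (m : nat) (Y1 U : finType) (pz : 'Z_m -> R)
  (py1 : 'Z_m -> Y1 -> R) (q : Y1 -> U -> R) : R :=
  log2 (INR m) - cond_entropy (joint_ZU pz py1 q).

Definition prefix (n : nat) (T : Type) (y : {ffun 'I_n -> T}) (i : 'I_n)
  : {ffun 'I_i -> T} :=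
  [ffun j : 'I_i => y (widen_ord (ltnW (ltn_ord i)) j)].

(* An (n, M) code: encoder, causal relay functions x1_i = f_i(y1^{i-1}),
   decoder from (Y^n, S^n). *)
Record code (m : nat) (Y1 X1 S : finType) (n M : nat) := Code {
  enc : 'I_M -> {ffun 'I_n -> 'Z_m};
  rel : forall i : 'I_n, {ffun 'I_i -> Y1} -> X1;
  dec : {ffun 'I_n -> 'Z_m} -> {ffun 'I_n -> S} -> 'I_M }.

Definition err_prob (m : nat) (Y1 X1 S : finType) (pz : 'Z_m -> R)
  (py1 : 'Z_m -> Y1 -> R) (ps : X1 -> S -> R) (n M : nat)
  (c : code m Y1 X1 S n M) : R :=
  / INR M * rsum (fun w : 'I_M =>
   rsum (fun z : {ffun 'I_n -> 'Z_m} =>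
   rsum (fun y1 : {ffun 'I_n -> Y1} =>
   rsum (fun s : {ffun 'I_n -> S} =>
     rprod (fun i => pz (z i) * py1 (z i) (y1 i) * ps (rel c (prefix y1 i)) (s i))
     * (if dec c [ffun i => GRing.add (enc c w i) (z i)] s == w then 0 else 1))))).

Definition achievable (m : nat) (Y1 X1 S : finType) (pz : 'Z_m -> R)
  (py1 : 'Z_m -> Y1 -> R) (ps : X1 -> S -> R) (Rt : R) : Prop :=
  exists (M : nat -> nat) (c : forall n, code m Y1 X1 S n (M n)),
    (forall n, Rpower 2 (INR n * Rt) <= INR (M n)) /\
    Un_cv (fun n => err_prob pz py1 ps (c n)) 0.

(* Main.v *)
(* Converse.  Gibbs' inequality gives [log M (1 - Pe) <= 1 + n log m - H(Z^n | S^n)].  Splitting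
   off one coordinate at a time, with auxiliary variable (relay output, past Y1), yields a
   test channel with [n I(U; Y1) <= I(Y1^n; S^n) <= n R0] and [n H(Z | U) <= H(Z^n | S^n)].
   Both [I(U; Y1) - H(Y1)] and [H(Z | U)] are sums over u of 1-homogeneous functions of the
   column q(. , u); hence time sharing is exact, Caratheodory's argument bounds the alphabet,
   and compactness provides an optimal channel.
   Achievability.  In each block the relay quantizes Y1^n to a codeword U^n and sends its index
   during the next block; knowing it, the destination keeps about 2^(n H(Z | U)) candidate
   noise sequences, so a uniformly random source code of rate below [log m - H(Z | U)] works. *)
From HB Require Import structures.
From Stdlib Require Import Reals Lra Psatz Classical ClassicalEpsilon FunctionalExtensionality.
From mathcomp Require Import all_boot ssralg zmodp.
Require Import Defs.
Set Implicit Arguments.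
Unset Strict Implicit.
Unset Printing Implicit Defensive.
Local Open Scope R_scope.

(** Everything is phrased for an arbitrary weight [w z y] and its n-fold product, so that the
    relay's whole map from Y1^n to S^n is itself a test channel, and the same functionals [info] and
    [equiv] serve the block and the single letter. The constraint I(U; Y1) <= R0 is not strict,
    whereas sending the quantization index needs room below R0. Mixing with a constant channel frees
    that room at an arbitrarily small loss in H(Z | U), except when I(U; Y1) = R0 = 0; then U tells
    nothing about Z and the relay may send a constant. The delay of one block costs a factor k / (k
    + 1) in rate, where the number k of blocks is fixed first and the block length grows afterwards.
    Random coding and covering are one-shot statements, applied to a whole block as one symbol.
    Errors are brought below each fixed threshold for all large lengths, and a single sequence of
    codes is extracted at the end. *)

HB.instance Definition _ := Monoid.isComLaw.Build R 0 Rplus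
  (fun x y z => esym (Rplus_assoc x y z)) Rplus_comm Rplus_0_l.
HB.instance Definition _ := Monoid.isComLaw.Build R 1 Rmult
  (fun x y z => esym (Rmult_assoc x y z)) Rmult_comm Rmult_1_l.
HB.instance Definition _ := Monoid.isMulLaw.Build R 0 Rmult Rmult_0_l Rmult_0_r.
HB.instance Definition _ := Monoid.isAddLaw.Build R Rmult Rplus
  Rmult_plus_distr_r Rmult_plus_distr_l.

Local Notation "\sum_ ( i | P ) F" := (\big[Rplus/0]_(i | P%B) F) : R_scope.
Local Notation "\sum_ ( i : t ) F" := (\big[Rplus/0]_(i : t) F) : R_scope.
Local Notation "\sum_ ( i < n ) F" := (\big[Rplus/0]_(i < n) F) : R_scope.
Local Notation "\sum_ i F" := (\big[Rplus/0]_i F) : R_scope.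
Local Notation "\prod_ ( i : t ) F" := (\big[Rmult/1]_(i : t) F) : R_scope.
Local Notation "\prod_ ( i | P ) F" := (\big[Rmult/1]_(i | P%B) F) : R_scope.
Local Notation "\prod_ ( i < n ) F" := (\big[Rmult/1]_(i < n) F) : R_scope.
Local Notation "\prod_ i F" := (\big[Rmult/1]_i F) : R_scope.

(** * Finite sums and products, logarithms and Gibbs' inequality *)

Definition indic (b : bool) : R := if b then 1 else 0.

Lemma sum_ge0 (I : finType) (P : pred I) (F : I -> R) :
  (forall i, P i -> 0 <= F i) -> 0 <= \sum_(i | P i) F i.
Proof. by move=> h; elim/big_ind: _ => //; [lra | move=> x y ? ?; lra]. Qed.

Lemma sum_le (I : finType) (P : pred I) (F G : I -> R) :
  (forall i, P i -> F i <= G i) -> \sum_(i | P i) F i <= \sum_(i | P i) G i.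
Proof. by move=> h; elim/big_ind2: _ => //; [lra | move=> *; lra]. Qed.

Lemma sumN (I : finType) (P : pred I) (F : I -> R) :
  \sum_(i | P i) - F i = - \sum_(i | P i) F i.
Proof. by rewrite (big_morph Ropp (id1 := 0) (op1 := Rplus)) //; [move=> *; lra | lra]. Qed.

Lemma sumB (I : finType) (P : pred I) (F G : I -> R) :
  \sum_(i | P i) (F i - G i) = \sum_(i | P i) F i - \sum_(i | P i) G i.
Proof. by rewrite /Rminus big_split /= sumN. Qed.

Lemma sum_const (I : finType) (c : R) : \sum_(i : I) c = INR #|I| * c.
Proof.
rewrite big_const; elim: #|I| => [|k IH]; first by rewrite /=; lra.
by rewrite iterS IH S_INR; lra.
Qed.

Lemma sum_term_le (I : finType) (F : I -> R) i :
  (forall j, 0 <= F j) -> F i <= \sum_j F j.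
Proof.
move=> h; rewrite (bigD1 i) //=.
by have := @sum_ge0 I (fun j => j != i) F (fun j _ => h j); lra.
Qed.

Lemma sum_sub_le (I : finType) (P Q : pred I) (F : I -> R) :
  (forall i, 0 <= F i) -> (forall i, P i -> Q i) ->
  \sum_(i | P i) F i <= \sum_(i | Q i) F i.
Proof.
move=> F0 PQ; rewrite (big_mkcond P) (big_mkcond Q) /=; apply: sum_le => i _.
case: ifP => [/PQ -> |_]; first by lra.
by case: ifP => // _; lra.
Qed.

Lemma sum_eq0 (I : finType) (F : I -> R) :
  (forall i, 0 <= F i) -> \sum_i F i = 0 -> forall i, F i = 0.
Proof. by move=> h e i; have := sum_term_le i h; rewrite e; have := h i; lra. Qed.

Lemma prod_ge0 (I : finType) (F : I -> R) : (forall i, 0 <= F i) -> 0 <= \prod_i F i.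
Proof. by move=> h; elim/big_ind: _ => //; [lra | exact: Rmult_le_pos]. Qed.

Lemma prod_gt0 (I : finType) (F : I -> R) : (forall i, 0 < F i) -> 0 < \prod_i F i.
Proof. by move=> h; elim/big_ind: _ => //; [lra | exact: Rmult_lt_0_compat]. Qed.

Lemma prod_gt0_inv (I : finType) (F : I -> R) :
  (forall i, 0 <= F i) -> 0 < \prod_i F i -> forall i, 0 < F i.
Proof.
move=> h p i; case: (h i) => // e; exfalso; move: p.
by rewrite (bigD1 i) //= -e; lra.
Qed.

Lemma prod_const (I : finType) (c : R) : \prod_(i : I) c = c ^ #|I|.
Proof. by rewrite big_const; elim: #|I| => //= k ->. Qed.

Lemma prod_inv (I : finType) (F : I -> R) :
  \prod_i / F i = / \prod_i F i.
Proof. by rewrite (big_morph Rinv (id1 := 1) (op1 := Rmult)) //; [exact: Rinv_mult | exact: Rinv_1]. Qed.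

Lemma ln_prod (I : finType) (F : I -> R) :
  (forall i, 0 < F i) -> ln (\prod_i F i) = \sum_i ln (F i).
Proof.
move=> h.
suff [] : 0 < \prod_i F i /\ ln (\prod_i F i) = \sum_i ln (F i) by [].
elim/big_ind2: _ => //; first by rewrite ln_1; lra.
move=> x1 x2 y1 y2 [? <-] [? <-]; split; [exact: Rmult_lt_0_compat | exact: ln_mult].
Qed.

Lemma ln2_gt0 : 0 < ln 2. Proof. by rewrite -ln_1; apply: ln_increasing; lra. Qed.

Lemma log2_prod (I : finType) (F : I -> R) :
  (forall i, 0 < F i) -> log2 (\prod_i F i) = \sum_i log2 (F i).
Proof. by move=> h; rewrite /log2 /Rdiv ln_prod // big_distrl. Qed.

Lemma log2M x y : 0 < x -> 0 < y -> log2 (x * y) = log2 x + log2 y.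
Proof. by move=> ? ?; rewrite /log2 ln_mult // /Rdiv; ring. Qed.

Lemma log2V x : 0 < x -> log2 (/ x) = - log2 x.
Proof. by move=> ?; rewrite /log2 ln_Rinv // /Rdiv; ring. Qed.

Lemma log2_div x y : 0 < x -> 0 < y -> log2 (x / y) = log2 x - log2 y.
Proof.
by move=> hx hy; rewrite /Rdiv log2M ?log2V //; exact: Rinv_0_lt_compat.
Qed.

Lemma log2_le x y : 0 < x -> x <= y -> log2 x <= log2 y.
Proof.
move=> hx [h|->]; last by lra.
by apply: Rmult_le_compat_r;
  [left; exact: Rinv_0_lt_compat ln2_gt0 | left; exact: ln_increasing].
Qed.

Lemma log2_1 : log2 1 = 0. Proof. by rewrite /log2 ln_1 /Rdiv Rmult_0_l. Qed.

Lemma log2_2 : log2 2 = 1.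
Proof. by rewrite /log2; field; have := ln2_gt0; lra. Qed.

Lemma ln_le_sub1 x : 0 < x -> ln x <= x - 1.
Proof.
move=> h; case: (Req_dec x 1) => [->|hx]; first by rewrite ln_1; lra.
have h1 : ln x <> 0.
  by move=> e; apply: hx; rewrite -(exp_ln _ h) e exp_0.
have := exp_ineq1 (ln x) h1; rewrite exp_ln //; lra.
Qed.

Lemma plogpE x : 0 <= x -> plogp x = x * log2 x.
Proof.
rewrite /plogp; case: Rlt_dec => //= hn hp; have e : x = 0 by lra.
by rewrite e Rmult_0_l.
Qed.

Lemma plogp0 : plogp 0 = 0. Proof. by rewrite plogpE; lra. Qed.

Lemma plogpM x y : 0 <= x -> 0 <= y -> plogp (x * y) = x * plogp y + y * plogp x.
Proof.
move=> [hx|<-]; last by rewrite Rmult_0_l plogp0; lra.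
move=> [hy|<-]; last by rewrite Rmult_0_r plogp0; lra.
rewrite !plogpE; try lra; last by apply: Rmult_le_pos; lra.
by rewrite log2M //; ring.
Qed.

Lemma entropyE (T : finType) (p : T -> R) :
  (forall t, 0 <= p t) -> entropy p = - \sum_t p t * log2 (p t).
Proof. by move=> h; rewrite /entropy /rsum; congr (- _); apply: eq_bigr => t _; exact: plogpE. Qed.

(** The termwise bound ln x <= x - 1 at x = Q / P. The reference weight [Q] is only required to have
    total mass at most 1, which is the form in which Markov recombinations and decoder guesses arise
    below. *)
Lemma gibbs (T : finType) (P Q : T -> R) :
  is_dist P -> (forall t, 0 <= Q t) -> \sum_t Q t <= 1 ->
  (forall t, 0 < P t -> 0 < Q t) ->
  entropy P <= - \sum_t P t * log2 (Q t).
Proof.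
move=> [P0 P1] Q0 Q1 PQ; rewrite entropyE //.
suff h : \sum_t (P t * log2 (Q t) - P t * log2 (P t)) <= 0.
  by move: h; rewrite sumB; lra.
have h t : P t * log2 (Q t) - P t * log2 (P t) <= / ln 2 * (Q t - P t).
  case: (P0 t) => [h|<-]; last first.
    rewrite !Rmult_0_l; have := Q0 t; have := Rinv_0_lt_compat _ ln2_gt0; nra.
  have hq := PQ _ h.
  have -> : P t * log2 (Q t) - P t * log2 (P t) = / ln 2 * (P t * ln (Q t / P t)).
    rewrite /log2 /Rdiv ln_mult //; last exact: Rinv_0_lt_compat.
    by rewrite ln_Rinv //; ring.
  apply: Rmult_le_compat_l; first by left; exact: Rinv_0_lt_compat ln2_gt0.
  have hd : 0 < Q t / P t by apply: Rdiv_lt_0_compat.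
  have := ln_le_sub1 hd => hl.
  have -> : Q t - P t = P t * (Q t / P t - 1) by field; lra.
  by apply: Rmult_le_compat_l; lra.
apply: Rle_trans (sum_le (fun t _ => h t)) _.
rewrite -big_distrr /= sumB.
have : \sum_t P t = 1 by [].
have := Rinv_0_lt_compat _ ln2_gt0; nra.
Qed.

Lemma bigA_distr_ffun (I J : finType) (F : I -> J -> R) :
  \prod_i \sum_j F i j = \sum_(f : {ffun I -> J}) \prod_i F i (f i).
Proof. exact: bigA_distr_bigA. Qed.

Lemma indic_ge0 b : 0 <= indic b. Proof. by case: b => /=; lra. Qed.
Lemma indic_le1 b : indic b <= 1. Proof. by case: b => /=; lra. Qed.

Lemma prod_indic (I : finType) (b : I -> bool) :
  \prod_i indic (b i) = indic [forall i, b i].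
Proof.
case: (boolP [forall i, b i]) => [/forallP h|/forallPn [i hi]].
  by rewrite big1 // => i _; rewrite h.
by rewrite (bigD1 i) //= (negbTE hi) /= Rmult_0_l.
Qed.

Lemma sum_indic_eq (I : finType) (F : I -> R) i0 : \sum_i F i * indic (i == i0) = F i0.
Proof.
rewrite (bigD1 i0) //= eqxx Rmult_1_r big1 ?Rplus_0_r // => i /negbTE ->.
by rewrite /= Rmult_0_r.
Qed.

(** Coordinates outside the range of [h] each sum to 1. Inserting the indicator that [f] restricts
    to [t] makes the summand a product over single coordinates, and injectivity lets a coordinate
    carry at most one constraint. This is how one block is cut out of a long transmission. *)
Lemma sum_marginal (I J A : finType) (h : J -> I) (W : I -> A -> R)
    (g : {ffun J -> A} -> R) :
  injective h -> (forall i, \sum_a W i a = 1) ->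
  \sum_(f : {ffun I -> A}) (\prod_i W i (f i)) * g [ffun j => f (h j)] =
  \sum_(t : {ffun J -> A}) (\prod_j W (h j) (t j)) * g t.
Proof.
move=> hi W1.
have -> : \sum_(f : {ffun I -> A}) (\prod_i W i (f i)) * g [ffun j => f (h j)] =
    \sum_(f : {ffun I -> A}) \sum_(t : {ffun J -> A})
      (\prod_i W i (f i)) * indic [forall j, f (h j) == t j] * g t.
  apply: eq_bigr => f _.
  rewrite -[in LHS](sum_indic_eq g [ffun j => f (h j)]) big_distrr /=.
  apply: eq_bigr => t _; rewrite Rmult_assoc (Rmult_comm (indic _)).
  congr (_ * (_ * indic _)); apply/eqP/forallP => [-> j|e]; first by rewrite ffunE.
  by apply/ffunP => j; rewrite ffunE; rewrite (eqP (e j)).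
rewrite exchange_big /=; apply: eq_bigr => t _; rewrite -big_distrl /=; congr (_ * _).
pose F i a := W i a * \prod_(j | h j == i) indic (a == t j).
have e1 (f : {ffun I -> A}) : (\prod_i W i (f i)) * indic [forall j, f (h j) == t j] =
    \prod_i F i (f i).
  rewrite big_split /=; congr (_ * _); rewrite -prod_indic.
  rewrite (partition_big h predT) //=; apply: eq_bigr => i _.
  by apply: eq_bigr => j /eqP ->.
rewrite (eq_bigr _ (fun f _ => e1 f)) -bigA_distr_ffun.
have e2 i : \sum_a F i a = \prod_(j | h j == i) W (h j) (t j).
  case: (pickP (fun j => h j == i)) => [j /eqP <-|hn].
    have e0 : (fun j0 => h j0 == h j) =1 pred1 j by move=> j0; rewrite (inj_eq hi).
    rewrite (eq_bigl _ _ e0) big_pred1_eq.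
    rewrite -[RHS](sum_indic_eq (W (h j))); apply: eq_bigr => a _.
    by rewrite /F (eq_bigl _ _ e0) big_pred1_eq.
  rewrite (big_pred0 _ _ _ _ hn) -(W1 i); apply: eq_bigr => a _.
  by rewrite /F (big_pred0 _ _ _ _ hn) Rmult_1_r.
by rewrite (eq_bigr _ (fun i _ => e2 i)) [RHS](partition_big h predT).
Qed.

Lemma dist_sum (T : finType) (p : T -> R) : is_dist p -> \sum_t p t = 1.
Proof. by case. Qed.

Lemma dist_ge0 (T : finType) (p : T -> R) t : is_dist p -> 0 <= p t.
Proof. by case. Qed.

(** * Information quantities as sums over auxiliary symbols *)

Section Columns.
Variables (Z Y : finType) (w : Z -> Y -> R).

(** [w z y] stands for p(z) p(y | z). At that weight [info] unfolds to [aux_info], and [equiv], the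
    equivocation H(Z | U), to the conditional entropy inside [aux_value]. *)
Definition joint_out (U : finType) (q : Y -> U -> R) (zu : Z * U) : R :=
  rsum (fun y => w zu.1 y * q y zu.2).
Definition joint_aux (U : finType) (q : Y -> U -> R) (uy : U * Y) : R :=
  rsum (fun z => w z uy.2 * q uy.2 uy.1).
Definition info (U : finType) (q : Y -> U -> R) : R := mutual_info (joint_aux q).
Definition equiv (U : finType) (q : Y -> U -> R) : R := cond_entropy (joint_out q).

Definition obs_law (y : Y) : R := \sum_z w z y.
Definition col_mass (c : Y -> R) : R := \sum_y obs_law y * c y.
(** For the column c = q(. , u), [col_mass c] is P(U = u), [col_info c] is - P(u) H(Y | U = u), and
    [col_equiv c] is P(u) H(Z | U = u). *)
Definition col_info (c : Y -> R) : R :=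
  - plogp (col_mass c) + \sum_y plogp (obs_law y * c y).
Definition col_equiv (c : Y -> R) : R :=
  plogp (col_mass c) - \sum_z plogp (\sum_y w z y * c y).

Lemma infoE (U : finType) (q : Y -> U -> R) : is_channel q ->
  info q = entropy obs_law + \sum_u col_info (q^~ u).
Proof.
move=> qc; rewrite /info /mutual_info.
have -> : marg2 (joint_aux q) = obs_law.
  apply: functional_extensionality => y; rewrite /marg2 /joint_aux /rsum /= exchange_big /=.
  apply: eq_bigr => z _; rewrite -big_distrr /=.
  by rewrite (dist_sum (qc y)) Rmult_1_r.
have e1 : entropy (marg1 (joint_aux q)) = - \sum_u plogp (col_mass (q^~ u)).
  congr (- _); apply: eq_bigr => u _; congr plogp; apply: eq_bigr => y _.
  by rewrite /joint_aux /rsum /= -big_distrl.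
have e2 : entropy (joint_aux q) = - \sum_u \sum_y plogp (obs_law y * q y u).
  rewrite pair_big /=; congr (- _); apply: eq_bigr => -[u y] _ /=; congr plogp.
  by rewrite /joint_aux /rsum /= -big_distrl.
by rewrite e1 e2 /col_info big_split /= sumN; ring.
Qed.

Lemma equivE (U : finType) (q : Y -> U -> R) : equiv q = \sum_u col_equiv (q^~ u).
Proof.
rewrite /equiv /cond_entropy sumB.
have -> : entropy (marg2 (joint_out q)) = - \sum_u plogp (col_mass (q^~ u)).
  congr (- _); apply: eq_bigr => u _; congr plogp.
  rewrite /marg2 /joint_out /rsum /= exchange_big /=; apply: eq_bigr => y _.
  by rewrite -big_distrl.
have -> : entropy (joint_out q) = - \sum_u \sum_z plogp (\sum_y w z y * q y u).
  by rewrite exchange_big pair_big /=; congr (- _); apply: eq_bigr => -[z u] _.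
ring.
Qed.

Hypothesis w0 : forall z y, 0 <= w z y.
Hypothesis w1 : \sum_y obs_law y = 1.

Lemma obs_law_ge0 y : 0 <= obs_law y.
Proof. exact: sum_ge0. Qed.

Lemma sum_plogp_scale (I : finType) (l : R) (a : I -> R) :
  0 <= l -> (forall i, 0 <= a i) ->
  \sum_i plogp (l * a i) = l * \sum_i plogp (a i) + plogp l * \sum_i a i.
Proof.
move=> l0 a0; rewrite !big_distrr -big_split /=; apply: eq_bigr => i _.
by rewrite plogpM //; ring.
Qed.

Lemma col_mass_scale l c : col_mass (fun y => l * c y) = l * col_mass c.
Proof. by rewrite /col_mass big_distrr /=; apply: eq_bigr => y _; ring. Qed.

Lemma col_mass_ge0 c : (forall y, 0 <= c y) -> 0 <= col_mass c.
Proof. by move=> c0; apply: sum_ge0 => y _; apply: Rmult_le_pos => //; exact: obs_law_ge0. Qed.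

(** Rescaling adds l log l times the total mass to both parts, with opposite signs, so the nonlinear
    term cancels. *)
Lemma col_info_scale l c : 0 <= l -> (forall y, 0 <= c y) ->
  col_info (fun y => l * c y) = l * col_info c.
Proof.
move=> l0 c0; rewrite /col_info col_mass_scale plogpM //; last exact: col_mass_ge0.
have -> : \sum_y plogp (obs_law y * (l * c y)) = \sum_y plogp (l * (obs_law y * c y)).
  by apply: eq_bigr => y _; congr plogp; ring.
rewrite sum_plogp_scale //; last by move=> y; apply: Rmult_le_pos => //; exact: obs_law_ge0.
by rewrite -/(col_mass c); ring.
Qed.

Lemma col_equiv_scale l c : 0 <= l -> (forall y, 0 <= c y) ->
  col_equiv (fun y => l * c y) = l * col_equiv c.
Proof.
move=> l0 c0; rewrite /col_equiv col_mass_scale plogpM //; last exact: col_mass_ge0.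
have -> : \sum_z plogp (\sum_y w z y * (l * c y)) = \sum_z plogp (l * \sum_y w z y * c y).
  apply: eq_bigr => z _; congr plogp; rewrite big_distrr /=.
  by apply: eq_bigr => y _; ring.
rewrite sum_plogp_scale //; last by move=> z; apply: sum_ge0 => y _; exact: Rmult_le_pos.
have -> : \sum_z \sum_y w z y * c y = col_mass c.
  by rewrite exchange_big; apply: eq_bigr => y _; rewrite -big_distrl.
ring.
Qed.

Lemma col_info0 : col_info (fun=> 0) = 0.
Proof.
have -> : (fun _ : Y => 0) = (fun y => 0 * 0) by apply: functional_extensionality => y; ring.
by rewrite col_info_scale ?Rmult_0_l // => *; lra.
Qed.

Lemma col_equiv0 : col_equiv (fun=> 0) = 0.
Proof.
have -> : (fun _ : Y => 0) = (fun y => 0 * 0) by apply: functional_extensionality => y; ring.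
by rewrite col_equiv_scale ?Rmult_0_l // => *; lra.
Qed.

Lemma plogp1 : plogp 1 = 0.
Proof. by rewrite plogpE ?log2_1; lra. Qed.

Lemma col_mass1 : col_mass (fun=> 1) = 1.
Proof. by rewrite -[RHS]w1; apply: eq_bigr => y _; ring. Qed.

Lemma col_info1 : col_info (fun=> 1) = - entropy obs_law.
Proof.
rewrite /col_info col_mass1 plogp1 /entropy /rsum Ropp_involutive Ropp_0 Rplus_0_l.
by apply: eq_bigr => y _; rewrite Rmult_1_r.
Qed.

Lemma sum_relabel (U U' : finType) (h : U -> U') (F : U' -> R) :
  injective h -> (forall u', u' \notin codom h -> F u' = 0) ->
  \sum_u' F u' = \sum_u F (h u).
Proof.
move=> hi F0; rewrite [RHS](partition_big h predT) //=; apply: eq_bigr => u' _.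
case: (boolP (u' \in codom h)) => [/codomP [u ->]|hn].
  rewrite (eq_bigl (pred1 u)); first by rewrite big_pred1_eq.
  by move=> v; rewrite /= (inj_eq hi).
rewrite F0 // big1 // => u /eqP e; case/negP: hn; rewrite -e; exact: codom_f.
Qed.

(** A symbol outside the range of [h] has the zero column, which contributes nothing. Alphabets can
    therefore be padded, and dead symbols removed, without changing either functional. *)
Lemma info_equiv_relabel (U U' : finType) (h : U -> U') (q : Y -> U -> R) (q' : Y -> U' -> R) :
  injective h -> (forall y u, q' y (h u) = q y u) ->
  (forall y u', u' \notin codom h -> q' y u' = 0) ->
  (forall y, \sum_u' q' y u' = \sum_u q y u) /\
  (is_channel q -> is_channel q' -> info q' = info q) /\ equiv q' = equiv q.
Proof.
move=> hi e e0.
have ec u : q'^~ (h u) = q^~ u by apply: functional_extensionality => y.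
have e0c u' : u' \notin codom h -> q'^~ u' = (fun=> 0).
  by move=> hn; apply: functional_extensionality => y; exact: e0.
split=> [y|].
  by rewrite (sum_relabel hi) => [|u' /e0 //]; apply: eq_bigr.
split.
  move=> qc qc'; rewrite !infoE // (sum_relabel hi) => [|u' /e0c ->]; last exact: col_info0.
  by congr (_ + _); apply: eq_bigr => u _; rewrite ec.
rewrite !equivE (sum_relabel hi) => [|u' /e0c ->]; last exact: col_equiv0.
by apply: eq_bigr => u _; rewrite ec.
Qed.

Lemma channel_embed (U U' : finType) (h : U -> U') (q : Y -> U -> R) :
  injective h -> is_channel q ->
  exists q' : Y -> U' -> R, is_channel q' /\ info q' = info q /\ equiv q' = equiv q.
Proof.
move=> hi qc.
pose q' y u' := if [pick u | h u == u'] is Some u then q y u else 0.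
have e1 y u : q' y (h u) = q y u.
  by rewrite /q'; case: pickP => [v /eqP /hi -> //|/(_ u)]; rewrite eqxx.
have e2 y u' : u' \notin codom h -> q' y u' = 0.
  by rewrite /q'; case: pickP => // v /eqP <-; rewrite codom_f.
have [s [ei ee]] := info_equiv_relabel hi e1 e2.
have qc' : is_channel q'.
  move=> y; split; last by rewrite /rsum s; have [] := qc y.
  by move=> u'; rewrite /q'; case: pickP => [v _|_]; [have [] := qc y | lra].
by exists q'; split=> //; split=> //; exact: ei.
Qed.

(** The disjoint union reveals in the output which of the two channels was used. Its columns are
    those of [q1] and [q2] scaled by l and 1 - l, so homogeneity yields an exact convex
    combination. *)
Lemma channel_mix (U1 U2 : finType) (q1 : Y -> U1 -> R) (q2 : Y -> U2 -> R) (l : R) :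
  0 <= l <= 1 -> is_channel q1 -> is_channel q2 ->
  exists q : Y -> U1 + U2 -> R, is_channel q /\
    info q = l * info q1 + (1 - l) * info q2 /\
    equiv q = l * equiv q1 + (1 - l) * equiv q2.
Proof.
move=> [l0 l1] c1 c2.
pose q y (u : U1 + U2) := match u with inl a => l * q1 y a | inr b => (1 - l) * q2 y b end.
have n1 y a : 0 <= q1 y a by have [] := c1 y.
have n2 y a : 0 <= q2 y a by have [] := c2 y.
have l2 : 0 <= 1 - l by lra.
have qc : is_channel q.
  move=> y; split; first by case=> a; exact: Rmult_le_pos.
  rewrite /rsum big_sumType /= -!big_distrr /=.
  by have [_] := c1 y; have [_] := c2 y; rewrite /rsum => -> ->; ring.
exists q; split=> //; split.
  rewrite !infoE // big_sumType /=.
  rewrite (eq_bigr (fun a => l * col_info (q1^~ a))) => [|a _]; last exact: col_info_scale.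
  rewrite [X in _ + (_ + X)](eq_bigr (fun a => (1 - l) * col_info (q2^~ a))) => [|a _]; last exact: col_info_scale.
  by rewrite -!big_distrr /=; ring.
rewrite !equivE big_sumType /=.
rewrite (eq_bigr (fun a => l * col_equiv (q1^~ a))) => [|a _]; last exact: col_equiv_scale.
rewrite [X in _ + X](eq_bigr (fun a => (1 - l) * col_equiv (q2^~ a))) => [|a _]; last exact: col_equiv_scale.
by rewrite -!big_distrr.
Qed.

Definition const_channel : Y -> unit -> R := fun _ _ => 1.

Lemma sum_unit (F : unit -> R) : \sum_u F u = F tt.
Proof. by rewrite (big_pred1 tt) // => -[]. Qed.

Lemma const_channelP : is_channel const_channel.
Proof. by move=> y; split=> [u|]; rewrite /const_channel; [lra | rewrite /rsum sum_unit]. Qed.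

Lemma info_const : info const_channel = 0.
Proof. by rewrite infoE ?sum_unit ?col_info1; [ring | exact: const_channelP]. Qed.

Lemma equiv_const : equiv const_channel = entropy (fun z => \sum_y w z y).
Proof.
rewrite equivE sum_unit /col_equiv col_mass1 plogp1 /entropy /rsum Rminus_0_l.
by congr (- _); apply: eq_bigr => z _; congr plogp; apply: eq_bigr => y _; exact: Rmult_1_r.
Qed.

End Columns.

(** Gaussian elimination on coordinate [d]. The support set [A] is part of the statement so that the
    pivot index can be removed from it before the induction hypothesis is applied. *)
Lemma linear_dependence (I : finType) (d : nat) : forall (A : {set I}) (v : I -> nat -> R),
  (d < #|A|)%N ->
  exists c : I -> R, (exists i, c i <> 0) /\ (forall i, i \notin A -> c i = 0) /\
    forall j, (j < d)%N -> \sum_i c i * v i j = 0.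
Proof.
elim: d => [|d IH] A v dA.
  have /card_gt0P [i iA] := dA.
  exists (fun j => indic (j == i)); split; first by exists i; rewrite eqxx /=; lra.
  by split=> // j; case: eqP => // ->; rewrite iA.
case: (classic (exists i, i \in A /\ v i d <> 0)) => [[i0 [iA vi]]|hn]; last first.
  have [c [c1 [c2 c3]]] := IH A v (ltnW dA).
  exists c; split=> //; split=> // j; rewrite ltnS leq_eqVlt => /orP [/eqP -> |]; last exact: c3.
  apply: big1 => i _; case: (boolP (i \in A)) => [iA|/c2 ->]; last by ring.
  by case: (Req_dec (v i d) 0) => [->|h]; [ring | case: hn; exists i].
(* Subtracting a multiple of the pivot vector [v i0] clears coordinate [d] of every vector. *)
pose v' i j := v i j - v i d / v i0 d * v i0 j.
have dA' : (d < #|A :\ i0|)%N by move: dA; rewrite (cardsD1 i0) iA.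
have [c' [[i1 c1] [c2 c3]]] := IH (A :\ i0) v' dA'.
have c'0 : c' i0 = 0 by apply: c2; rewrite !inE eqxx.
pose s := \sum_i c' i * (v i d / v i0 d).
(* The coefficient at the pivot is corrected so that combining [v] with [c] equals combining [v']
   with [c']. *)
pose c i := c' i - s * indic (i == i0).
have key j : \sum_i c i * v i j = \sum_i c' i * v' i j.
  rewrite (eq_bigr (fun i => c' i * v i j - s * v i j * indic (i == i0))); last by move=> i _; rewrite /c; ring.
  rewrite sumB (sum_indic_eq (fun i => s * v i j)).
  rewrite [RHS](eq_bigr (fun i => c' i * v i j - c' i * (v i d / v i0 d) * v i0 j)); last by move=> i _; rewrite /v'; ring.
  by rewrite sumB -big_distrl.
exists c; split.
  exists i1; rewrite /c; case: eqP => [e|_] /=; last by rewrite Rmult_0_r Rminus_0_r.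
  by case: c1; rewrite e.
split.
  move=> i iA'; rewrite /c; case: eqP => [e|_] /=; first by rewrite e iA in iA'.
  by rewrite c2 ?inE ?(negbTE iA') ?andbF //; ring.
move=> j; rewrite key ltnS leq_eqVlt => /orP [/eqP -> |]; last exact: c3.
by apply: big1 => i _; rewrite /v'; field.
Qed.

(** * Cardinality bound and existence of an optimal test channel *)

Lemma exists_argmin (I : finType) (F : I -> R) (i0 : I) :
  exists i, forall j, F i <= F j.
Proof.
suff [i h] : exists i, forall j, j \in enum I -> F i <= F j.
  by exists i => j; apply: h; rewrite mem_enum.
elim: (enum I) => [|x s [i h]]; first by exists i0.
case: (Rle_dec (F x) (F i)) => hx.
  exists x => j; rewrite inE => /orP [/eqP ->|/h]; lra.
exists i => j; rewrite inE => /orP [/eqP ->|/h //]; lra.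
Qed.

Section Cardinality.
Variables (Z Y : finType) (w : Z -> Y -> R).
Hypothesis w0 : forall z y, 0 <= w z y.

(** Each symbol u gives a vector of [#|Y|] channel entries and two column functionals, which is the
    origin of [#|Y| + 2]. A dependence [c] among these vectors lets column u be multiplied by 1 + t
    c(u) without changing row sums, [info] or [equiv], and t is increased until a column
    vanishes. *)
Lemma channel_drop_symbol (k : nat) (q : Y -> 'I_k.+1 -> R) :
  is_channel q -> (#|Y| + 2 < k.+1)%N ->
  exists q' : Y -> 'I_k -> R,
    is_channel q' /\ info w q' = info w q /\ equiv w q' = equiv w q.
Proof.
move=> qc hk.
pose v (u : 'I_k.+1) j :=
  nth 0 ([seq q y u | y <- enum Y] ++ [:: col_info w (q^~ u); col_equiv w (q^~ u)]) j.
have [|c [[u1 c1] [_ c3]]] := @linear_dependence _ (#|Y| + 2) [set: 'I_k.+1] v.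
  by rewrite cardsT card_ord.
have sz u : size [seq q y u | y <- enum Y] = #|Y| by rewrite size_map -cardE.
have cy y : \sum_u c u * q y u = 0.
  have iy : (index y (enum Y) < #|Y|)%N by rewrite cardE index_mem mem_enum.
  rewrite -[RHS](c3 (index y (enum Y))); last by rewrite ltn_addr.
  apply: eq_bigr => u _; rewrite /v nth_cat sz iy (nth_map y) -?cardE //.
  by rewrite nth_index ?mem_enum.
have ci : \sum_u c u * col_info w (q^~ u) = 0.
  rewrite -[RHS](c3 #|Y|); last by rewrite addn2 ltnW.
  by apply: eq_bigr => u _; rewrite /v nth_cat sz ltnn subnn.
have ce : \sum_u c u * col_equiv w (q^~ u) = 0.
  rewrite -[RHS](c3 #|Y|.+1); last by rewrite addn2.
  by apply: eq_bigr => u _; rewrite /v nth_cat sz ltnNge leqnSn subSnn.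
(* Negating the dependence if necessary provides a negative entry, hence a finite largest t. *)
wlog cneg : c c1 {c3} cy ci ce / c u1 < 0 => [IH|].
  case: (Rlt_le_dec (c u1) 0) => hc; first exact: (IH c c1).
  have neg F : \sum_u c u * F u = 0 -> \sum_u - c u * F u = 0.
    move=> e; rewrite -[RHS]Ropp_0 -[in RHS]e -sumN; apply: eq_bigr => u _; ring.
  by apply: (IH (fun u => - c u)); [lra | move=> y; exact: neg | exact: neg | exact: neg | lra].
have [u0 hu0] := exists_argmin c u1.
have c0 : c u0 < 0 by have := hu0 u1; lra.
(* Here t = - 1 / c(u0) with [c u0] the most negative entry: all factors stay nonnegative and the
   one at [u0] is zero. *)
pose a u := 1 + c u / (- c u0).
have a0 u : 0 <= a u.
  have -> : a u = (c u - c u0) / - c u0 by rewrite /a; field; lra.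
  apply: Rmult_le_pos; first by have := hu0 u; lra.
  by left; apply: Rinv_0_lt_compat; lra.
have au0 : a u0 = 0 by rewrite /a; field; lra.
have suma (F : 'I_k.+1 -> R) : \sum_u c u * F u = 0 -> \sum_u a u * F u = \sum_u F u.
  move=> e; rewrite (eq_bigr (fun u => F u + / (- c u0) * (c u * F u))).
    rewrite big_split /= -big_distrr /= e Rmult_0_r; exact: Rplus_0_r.
  by move=> u _; rewrite /a /Rdiv; ring.
have q0 y u : 0 <= q y u by exact: dist_ge0 (qc y).
pose q1 y u := a u * q y u.
have q1c : is_channel q1.
  move=> y; split=> [u|]; first exact: Rmult_le_pos.
  by rewrite /rsum suma // (dist_sum (qc y)).
have i1 : info w q1 = info w q.
  rewrite !infoE //; congr (_ + _); rewrite -(suma _ ci).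
  by apply: eq_bigr => u _; exact: col_info_scale.
have e1 : equiv w q1 = equiv w q.
  rewrite !equivE -(suma _ ce).
  by apply: eq_bigr => u _; exact: col_equiv_scale.
pose q2 y u := q1 y (lift u0 u).
have off y u : u \notin codom (lift u0) -> q1 y u = 0.
  case: (unliftP u0 u) => [u'|] ->; first by rewrite codom_f.
  by rewrite /q1 au0 Rmult_0_l.
have [s [ei ee]] := @info_equiv_relabel Z Y w w0 _ _ (lift u0) q2 q1 (@lift_inj _ u0) (fun _ _ => erefl) off.
have q2c : is_channel q2.
  move=> y; split=> [u|]; first exact: dist_ge0 (q1c y).
  by rewrite /rsum -s (dist_sum (q1c y)).
by exists q2; rewrite -i1 -e1 ei.
Qed.

Lemma channel_cardinality_bound (U : finType) (q : Y -> U -> R) : is_channel q ->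
  exists q' : Y -> 'I_(#|Y| + 2) -> R,
    is_channel q' /\ info w q' = info w q /\ equiv w q' = equiv w q.
Proof.
move=> qc; have [q1 [c1 [<- <-]]] := channel_embed w0 (@enum_rank_inj U) qc.
elim: #|U| q1 c1 => [|k IH] q1 c1.
  have := @channel_embed Z Y w w0 _ 'I_(#|Y| + 2) (fun u : 'I_0 => widen_ord (leq0n _) u) q1.
  by apply=> // -[].
case: (leqP k.+1 (#|Y| + 2)) => hk.
  apply: (@channel_embed Z Y w w0 _ _ (widen_ord hk)) => // a b e.
  by apply/val_inj; exact: (congr1 val e).
have [q2 [c2 [<- <-]]] := channel_drop_symbol c1 hk.
exact: IH.
Qed.
End Cardinality.

(** * Limits, sequential compactness and continuity of x log x *)

Lemma Un_cv_ext (u v : nat -> R) l : (forall n, u n = v n) -> Un_cv u l -> Un_cv v l.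
Proof. by move=> e; have -> : u = v by apply: functional_extensionality. Qed.

Lemma Un_cv_const c : Un_cv (fun=> c) c.
Proof. by move=> e he; exists 0%N => n _; rewrite /Rdist Rminus_diag Rabs_R0. Qed.

Lemma Un_cv_sum (I : finType) (F : I -> nat -> R) (l : I -> R) :
  (forall i, Un_cv (F i) (l i)) -> Un_cv (fun n => \sum_i F i n) (\sum_i l i).
Proof.
move=> h; elim: (index_enum I) => [|x s IH].
  rewrite big_nil; apply: Un_cv_ext (Un_cv_const 0) => n; by rewrite big_nil.
rewrite big_cons; apply: Un_cv_ext (CV_plus _ _ _ _ (h x) IH) => n.
by rewrite big_cons.
Qed.

Lemma Un_cv_subseq (u : nat -> R) l (phi : nat -> nat) :
  (forall n, (n <= phi n)%coq_nat) -> Un_cv u l -> Un_cv (fun n => u (phi n)) l.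
Proof.
move=> hp cu e he; have [N hN] := cu e he; exists N => n hn; apply: hN.
exact: PeanoNat.Nat.le_trans hn (hp n).
Qed.

(** Subsequences are extracted one coordinate at a time. The condition n <= phi n is stable under
    composition and transports limits, which is all that a subsequence is used for. *)
Lemma bolzano_weierstrass_finite (I : finType) (u : I -> nat -> R) :
  (forall i n, 0 <= u i n <= 1) ->
  exists (phi : nat -> nat) (l : I -> R), (forall n, (n <= phi n)%coq_nat) /\
    forall i, Un_cv (fun n => u i (phi n)) (l i).
Proof.
move=> h.
suff [phi [l [hp hl]]] : exists (phi : nat -> nat) (l : I -> R), (forall n, (n <= phi n)%coq_nat) /\
    forall i, i \in enum I -> Un_cv (fun n => u i (phi n)) (l i).
  by exists phi, l; split=> // i; apply: hl; rewrite mem_enum.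
elim: (enum I) => [|x s [phi [l [hp hl]]]]; first by exists id, (fun=> 0).
have [] := @Bolzano_Weierstrass (fun n => u x (phi n)) (fun c => 0 <= c <= 1).
- exact: compact_P3.
- by move=> n.
move=> a ha.
have ex n : exists p, (n <= p)%coq_nat /\ Rabs (u x (phi p) - a) < / INR n.+1.
  have hn : 0 < / INR n.+1 by apply: Rinv_0_lt_compat; apply: lt_0_INR; lia.
  have [|p [hp1 hp2]] := ha (disc a (mkposreal _ hn)) n; last by exists p.
  by exists (mkposreal _ hn).
pose psi n := sval (constructive_indefinite_description _ (ex n)).
have psi1 n : (n <= psi n)%coq_nat by rewrite /psi; case: constructive_indefinite_description => p [].
have psi2 n : Rabs (u x (phi (psi n)) - a) < / INR n.+1.
  by rewrite /psi; case: constructive_indefinite_description => p [].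
exists (fun n => phi (psi n)), (fun i => if i == x then a else l i); split.
  by move=> n; apply: PeanoNat.Nat.le_trans (psi1 n) (hp _).
move=> i; rewrite inE; case: eqP => [-> _|_ /= hi]; last first.
  exact: (Un_cv_subseq (u := fun n => u i (phi n))) (hl _ hi).
move=> e he; have [N [hN1 hN2]] := archimed_cor1 e he; exists N => n hn.
apply: Rlt_trans (psi2 n) _; apply: Rle_lt_trans hN1.
by apply: Rinv_le_contravar; [exact: lt_0_INR | apply: le_INR; lia].
Qed.

Lemma Un_cv_plogp (u : nat -> R) l :
  (forall n, 0 <= u n) -> 0 <= l -> Un_cv u l -> Un_cv (fun n => plogp (u n)) (plogp l).
Proof.
move=> u0 l0 cu; rewrite plogpE //.
apply: (Un_cv_ext (u := fun n => u n * log2 (u n))) => [n|]; first by rewrite plogpE.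
case: l0 => [l0|l0].
  apply: CV_mult => //; rewrite /log2.
  apply: (CV_mult (fun n => ln (u n)) (fun=> / ln 2)); last exact: Un_cv_const.
  apply: (continuity_seq ln) cu.
  by apply: derivable_continuous_pt; exists (/ l); exact: derivable_pt_lim_ln.
rewrite -l0 Rmult_0_l in cu *; move=> e he.
have L := ln2_gt0.
(* Near 0, writing x as the square of its root and bounding sqrt x times - ln (sqrt x) by 1 gives |x
   log2 x| <= 2 sqrt x / ln 2. This is below [e] as soon as sqrt x < d. *)
pose d := e * ln 2 / 2.
have d0 : 0 < d by rewrite /d; nra.
have [N hN] := cu (Rmin 1 (d * d)) (Rmin_glb_lt _ _ _ Rlt_0_1 (Rmult_lt_0_compat _ _ d0 d0)).
exists N => n /hN; rewrite /Rdist !Rminus_0_r Rabs_pos_eq // => hn.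
have hn1 := Rlt_le_trans _ _ _ hn (Rmin_l _ _).
have hn2 := Rlt_le_trans _ _ _ hn (Rmin_r _ _).
case: (u0 n) => [up|<-]; last by rewrite Rmult_0_l Rabs_R0.
set x := u n in up hn1 hn2 *.
have s0 : 0 < sqrt x by exact: sqrt_lt_R0.
have sx : sqrt x * sqrt x = x by apply: sqrt_sqrt; lra.
have sd : sqrt x < d by nra.
have lx : ln x = 2 * ln (sqrt x) by rewrite -[in LHS]sx ln_mult //; ring.
have l1 : ln (sqrt x) <= sqrt x - 1 by exact: ln_le_sub1.
have l2 : - ln (sqrt x) <= / sqrt x - 1.
  by rewrite -ln_Rinv //; apply: ln_le_sub1; exact: Rinv_0_lt_compat.
have s1 : sqrt x < 1 by nra.
have -> : x * log2 x = - (2 * (sqrt x * (sqrt x * - ln (sqrt x))) / ln 2).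
  by rewrite /log2 lx -[X in X * _]sx; field; lra.
have h1 : sqrt x * - ln (sqrt x) <= 1.
  apply: Rle_trans (Rmult_le_compat_l _ _ _ (Rlt_le _ _ s0) l2) _.
  by rewrite Rmult_minus_distr_l Rinv_r; lra.
have h0 : 0 <= sqrt x * - ln (sqrt x) by nra.
rewrite Rabs_Ropp Rabs_pos_eq; last first.
  by apply: Rmult_le_pos; [nra | left; exact: Rinv_0_lt_compat].
apply: (Rmult_lt_reg_r (ln 2)) => //.
rewrite /Rdiv Rmult_assoc Rinv_l; last lra.
rewrite /d in sd; nra.
Qed.

Section Attained.
Variables (Z Y : finType) (w : Z -> Y -> R).
Hypothesis w0 : forall z y, 0 <= w z y.

Lemma Un_cv_col_mass (c : nat -> Y -> R) (l : Y -> R) :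
  (forall y, Un_cv (c^~ y) (l y)) -> Un_cv (fun n => col_mass w (c n)) (col_mass w l).
Proof.
by move=> h; apply: Un_cv_sum => y; apply: CV_mult => //; exact: Un_cv_const.
Qed.

Lemma Un_cv_ge0 (u : nat -> R) l : (forall n, 0 <= u n) -> Un_cv u l -> 0 <= l.
Proof.
move=> u0 cu; case: (Rle_lt_dec 0 l) => // hl.
have [|N /(_ N)] := cu (- l); first lra.
by move/(_ (PeanoNat.Nat.le_refl _)); rewrite /Rdist; have := u0 N; move=> ?; rewrite Rabs_pos_eq; lra.
Qed.

Lemma Un_cv_le (u : nat -> R) l a : (forall n, u n <= a) -> Un_cv u l -> l <= a.
Proof.
move=> ua cu.
suff : 0 <= a - l by lra.
apply: (@Un_cv_ge0 (fun n => a - u n)) => [n|]; first by have := ua n; lra.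
exact: CV_minus (Un_cv_const a) cu.
Qed.

Lemma info_equiv_limit (U : finType) (q : nat -> Y -> U -> R) (l : Y -> U -> R) :
  (forall n, is_channel (q n)) -> (forall y u, Un_cv (fun n => q n y u) (l y u)) ->
  is_channel l /\ Un_cv (fun n => info w (q n)) (info w l) /\
  Un_cv (fun n => equiv w (q n)) (equiv w l).
Proof.
move=> qc cv.
have q0 n y u : 0 <= q n y u by exact: dist_ge0 (qc n y).
have l0 y u : 0 <= l y u by apply: Un_cv_ge0 (cv y u).
have P0 := obs_law_ge0 w0.
have lc : is_channel l.
  move=> y; split=> //.
  apply: (UL_sequence (fun n => \sum_u q n y u)); first exact: Un_cv_sum.
  by apply: Un_cv_ext (Un_cv_const 1) => n; rewrite (dist_sum (qc n y)).
have cm u : Un_cv (fun n => plogp (col_mass w ((q n)^~ u))) (plogp (col_mass w (l^~ u))).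
  apply: Un_cv_plogp; [by move=> n; exact: col_mass_ge0 | exact: col_mass_ge0 |].
  exact: Un_cv_col_mass.
split=> //; split.
  rewrite infoE //.
  apply: (Un_cv_ext (u := fun n => entropy (obs_law w) + \sum_u col_info w ((q n)^~ u))) => [n|].
    by rewrite infoE.
  apply: (CV_plus (fun=> _)); first exact: Un_cv_const.
  apply: Un_cv_sum => u; apply: (CV_plus (fun n => - _)); first exact: CV_opp.
  apply: Un_cv_sum => y; apply: Un_cv_plogp.
  - by move=> n; exact: Rmult_le_pos.
  - exact: Rmult_le_pos.
  - by apply: (CV_mult (fun=> _)) => //; exact: Un_cv_const.
rewrite equivE.
apply: (Un_cv_ext (u := fun n => \sum_u col_equiv w ((q n)^~ u))) => [n|].
  by rewrite equivE.
apply: Un_cv_sum => u; apply: CV_minus => //.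
apply: Un_cv_sum => z; apply: Un_cv_plogp.
- by move=> n; apply: sum_ge0 => y _; exact: Rmult_le_pos.
- by apply: sum_ge0 => y _; exact: Rmult_le_pos.
- by apply: Un_cv_sum => y; apply: (CV_mult (fun=> _)) => //; exact: Un_cv_const.
Qed.

Lemma equiv_ge0 (U : finType) (q : Y -> U -> R) : is_channel q -> 0 <= equiv w q.
Proof.
move=> qc; rewrite equivE; apply: sum_ge0 => u _.
have q0 y : 0 <= q y u by exact: dist_ge0 (qc y).
pose a z := \sum_y w z y * q y u.
have a0 z : 0 <= a z by apply: sum_ge0 => y _; exact: Rmult_le_pos.
have e : col_mass w (q^~ u) = \sum_z a z.
  by rewrite /a exchange_big; apply: eq_bigr => y _; rewrite -big_distrl.
rewrite /col_equiv -/(a _) e plogpE; last exact: sum_ge0.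
rewrite big_distrl /= -sumB; apply: sum_ge0 => z _; rewrite -/(a z) plogpE //.
case: (a0 z) => [az|<-]; last by rewrite !Rmult_0_l; lra.
have := log2_le az (sum_term_le z a0); nra.
Qed.

Lemma equiv_min_attained (U : finType) (r : R) :
  (exists q : Y -> U -> R, is_channel q /\ info w q <= r) ->
  exists q : Y -> U -> R, is_channel q /\ info w q <= r /\
    forall q' : Y -> U -> R, is_channel q' -> info w q' <= r -> equiv w q <= equiv w q'.
Proof.
move=> [q0 [c0 i0]].
pose E v := exists q : Y -> U -> R, is_channel q /\ info w q <= r /\ v = - equiv w q.
have bE : bound E.
  by exists 0 => v [q [qc [_ ->]]]; have := equiv_ge0 qc; lra.
have nE : exists v, E v by exists (- equiv w q0), q0.
have [C [ubC lubC]] := completeness E bE nE.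
(* Near-maximizers of [- equiv] with slack 1 / (n + 1); the sign is reversed because [completeness]
   supplies suprema. *)
have ex n : exists q : Y -> U -> R, (is_channel q /\ info w q <= r) /\ C - / INR n.+1 < - equiv w q.
  apply: NNPP => hn.
  have hp : 0 < / INR n.+1 by apply: Rinv_0_lt_compat; apply: lt_0_INR; lia.
  have : C <= C - / INR n.+1; last by lra.
  apply: lubC => v [q [qc [qi ->]]]; apply: Rnot_lt_le => hv; apply: hn.
  by exists q.
pose q n := sval (constructive_indefinite_description _ (ex n)).
have qP n : (is_channel (q n) /\ info w (q n) <= r) /\ C - / INR n.+1 < - equiv w (q n).
  by rewrite /q; case: constructive_indefinite_description.
have qc n : is_channel (q n) by case: (qP n) => [[]].
have [|phi [l [hphi hl]]] := @bolzano_weierstrass_finite (Y * U)%type (fun yu n => q n yu.1 yu.2).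
  move=> [y u] n /=; split; first exact: dist_ge0 (qc n y).
  by rewrite -(dist_sum (qc n y)); apply: sum_term_le => v; exact: dist_ge0 (qc n y).
pose lq y u := l (y, u).
have [lc [li le]] := @info_equiv_limit U (fun n => q (phi n)) lq (fun n => qc _) (fun y u => hl (y, u)).
exists lq; split=> //; split.
  by apply: Un_cv_le li => n; case: (qP (phi n)) => [[]].
move=> q' c' i'.
have h1 : - equiv w q' <= C by apply: ubC; exists q'.
suff : 0 <= - C + - equiv w lq by lra.
have cz : Un_cv (fun n => / INR (phi n).+1) 0.
  move=> e he; have [N [hN1 hN2]] := archimed_cor1 e he; exists N => n hn.
  rewrite /Rdist Rminus_0_r Rabs_pos_eq; last by left; apply: Rinv_0_lt_compat; apply: lt_0_INR; lia.
  apply: Rle_lt_trans hN1; apply: Rinv_le_contravar; first exact: lt_0_INR.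
  by apply: le_INR; have := hphi n; lia.
have := CV_plus _ _ _ _ (CV_plus _ _ _ _ (Un_cv_const (- C)) (CV_opp _ _ le)) cz.
rewrite Rplus_0_r; apply: Un_cv_ge0 => n.
by have [_] := qP (phi n); rewrite /opp_seq; lra.
Qed.
End Attained.

(** * Entropy inequalities and single-letterization *)

Section RandomVariables.
Variables (O : finType) (P : O -> R).
Hypothesis Pd : is_dist P.

Definition law (A : finType) (X : O -> A) (a : A) : R := \sum_(o | X o == a) P o.
Definition ent (A : finType) (X : O -> A) : R := entropy (law X).

Lemma law_ge0 (A : finType) (X : O -> A) a : 0 <= law X a.
Proof. by apply: sum_ge0 => o _; exact: dist_ge0 Pd. Qed.

Lemma law_expect (A : finType) (X : O -> A) (f : A -> R) :
  \sum_a law X a * f a = \sum_o P o * f (X o).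
Proof.
rewrite [RHS](partition_big X predT) //=; apply: eq_bigr => a _.
by rewrite /law big_distrl /=; apply: eq_bigr => o /eqP ->.
Qed.

Lemma law_dist (A : finType) (X : O -> A) : is_dist (law X).
Proof.
split=> [a|]; first exact: law_ge0.
rewrite /rsum -[RHS](dist_sum Pd) -[RHS](eq_bigr _ (fun o _ => Rmult_1_r (P o))).
rewrite -(law_expect X (fun=> 1)); by apply: eq_bigr => a _; rewrite Rmult_1_r.
Qed.

Lemma law_ge (A : finType) (X : O -> A) o : P o <= law X (X o).
Proof.
rewrite /law (bigD1 o) //=.
suff : 0 <= \sum_(i | (X i == X o) && (i != o)) P i by lra.
by apply: sum_ge0 => i _; exact: dist_ge0 Pd.
Qed.

Lemma entE (A : finType) (X : O -> A) : ent X = - \sum_o P o * log2 (law X (X o)).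
Proof. by rewrite /ent entropyE ?law_expect // => a; exact: law_ge0. Qed.

(** When X determines Y, the fibre of X through o lies inside that of Y, so the entropies compare
    pointwise on the sample space. Used in both directions it gives [ent_eq], by which joint
    entropies are regrouped below. *)
Lemma ent_det (A B : finType) (X : O -> A) (Y : O -> B) :
  (forall o o', X o = X o' -> Y o = Y o') -> ent Y <= ent X.
Proof.
move=> h; rewrite !entE; apply: Ropp_le_contravar; apply: sum_le => o _.
case: (dist_ge0 o Pd) => [po|<-]; last by lra.
apply: Rmult_le_compat_l; first lra.
apply: log2_le; first by have := law_ge X o; lra.
apply: sum_sub_le => [i|i /eqP e]; first exact: dist_ge0 Pd.
by apply/eqP; exact: h.
Qed.

Lemma ent_eq (A B : finType) (X : O -> A) (Y : O -> B) :
  (forall o o', X o = X o' -> Y o = Y o') -> (forall o o', Y o = Y o' -> X o = X o') ->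
  ent X = ent Y.
Proof. by move=> h1 h2; apply: Rle_antisym; exact: ent_det. Qed.

Lemma law_marg1 (A B : finType) (X : O -> A) (Y : O -> B) a :
  \sum_b law (fun o => (X o, Y o)) (a, b) = law X a.
Proof.
by rewrite /law [RHS](partition_big Y predT).
Qed.

Lemma law_marg2 (A B : finType) (X : O -> A) (Y : O -> B) b :
  \sum_a law (fun o => (X o, Y o)) (a, b) = law Y b.
Proof.
rewrite /law [RHS](partition_big X predT) //=; apply: eq_bigr => a _.
by apply: eq_bigl => o; rewrite xpair_eqE andbC.
Qed.

(** A sample point is glued by [h] from its visible part [X] and its hidden part [hi]; the law of
    [X] sums out the hidden part. *)
Lemma law_proj (A B : finType) (X : O -> A) (h : A -> B -> O) (hi : O -> B) :
  (forall o, h (X o) (hi o) = o) -> (forall a b, X (h a b) = a) ->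
  (forall a b, hi (h a b) = b) -> forall a, law X a = \sum_b P (h a b).
Proof.
move=> h1 h2 h3 a; rewrite /law (reindex_onto (h a) hi) /=.
  by apply: eq_bigl => b; rewrite h2 h3 !eqxx.
by move=> o /eqP <-; exact: h1.
Qed.

(** This is I(X; W | Y) >= 0: Gibbs' inequality against the Markov law P(x, y) P(y, w) / P(y). Where
    P(y) = 0 the convention / 0 = 0 keeps this weight nonnegative. *)
Lemma ent_submodular (A B C : finType) (X : O -> A) (Y : O -> B) (W : O -> C) :
  ent (fun o => (X o, Y o, W o)) + ent Y <=
  ent (fun o => (X o, Y o)) + ent (fun o => (Y o, W o)).
Proof.
pose XY o := (X o, Y o); pose YW o := (Y o, W o); pose T o := (X o, Y o, W o).
pose Q (t : A * B * C) := law XY (t.1.1, t.1.2) * law YW (t.1.2, t.2) / law Y t.1.2.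
have iv x : 0 <= x -> 0 <= / x by move=> [h|<-]; [left; exact: Rinv_0_lt_compat | rewrite Rinv_0; lra].
have pos o : 0 < P o -> 0 < law XY (XY o) /\ 0 < law YW (YW o) /\ 0 < law Y (Y o).
  by move=> po; have := law_ge XY o; have := law_ge YW o; have := law_ge Y o; lra.
have Q0 t : 0 <= Q t.
  by apply: Rmult_le_pos; [apply: Rmult_le_pos; exact: law_ge0 | apply: iv; exact: law_ge0].
have Q1 : \sum_t Q t <= 1.
  rewrite -(pair_bigA _ (fun ab c => Q (ab, c))) -(pair_bigA _ (fun a b => \sum_c Q (a, b, c))) /=.
  rewrite exchange_big -(dist_sum (law_dist Y)) /=; apply: sum_le => b _.
  rewrite (eq_bigr (fun a => law XY (a, b) * (law Y b * / law Y b))) => [|a _].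
    rewrite -big_distrl /= law_marg2.
    case: (law_ge0 Y b) => [h|<-]; last by lra.
    by rewrite Rinv_r; lra.
  rewrite /Q /= /Rdiv -big_distrl -big_distrr /= law_marg1; ring.
have PQ t : 0 < law T t -> 0 < Q t.
  move=> lt0; have [o [/eqP oT po]] : exists o, T o == t /\ 0 < P o.
    apply: NNPP => hn; have : law T t <= \sum_(o | T o == t) 0; last by rewrite big1 //; lra.
    by apply: sum_le => o ho; apply: Rnot_lt_le => po; apply: hn; exists o.
  have [h1 [h2 h3]] := pos _ po; rewrite -oT /Q /=.
  by apply: Rdiv_lt_0_compat => //; exact: Rmult_lt_0_compat.
have := gibbs (law_dist T) Q0 Q1 PQ; rewrite -/(ent T) law_expect => g.
rewrite !(entE Y) !(entE XY) !(entE YW).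
suff e : \sum_o P o * log2 (Q (T o)) =
  \sum_o P o * log2 (law XY (XY o)) + \sum_o P o * log2 (law YW (YW o)) - \sum_o P o * log2 (law Y (Y o)).
  by move: g; rewrite e /T; lra.
rewrite -big_split -sumB /=; apply: eq_bigr => o _.
case: (dist_ge0 o Pd) => [po|<-]; last by rewrite !Rmult_0_l; lra.
have [h1 [h2 h3]] := pos _ po.
change (Q (T o)) with (law XY (XY o) * law YW (YW o) / law Y (Y o)).
by rewrite log2_div ?log2M //; [ring | exact: Rmult_lt_0_compat].
Qed.

(** The equality case I(X; W | Y) = 0: a factorization f(x, y) g(y, w), with f and g unnormalized,
    forces P(x, y, w) P(y) = P(x, y) P(y, w). *)
Lemma ent_markov (A B C : finType) (X : O -> A) (Y : O -> B) (W : O -> C)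
    (f : A -> B -> R) (g : B -> C -> R) :
  (forall a b c, law (fun o => (X o, Y o, W o)) (a, b, c) = f a b * g b c) ->
  ent (fun o => (X o, Y o, W o)) + ent Y =
  ent (fun o => (X o, Y o)) + ent (fun o => (Y o, W o)).
Proof.
move=> h.
pose XY o := (X o, Y o); pose YW o := (Y o, W o); pose T o := (X o, Y o, W o).
have eXY a b : law XY (a, b) = f a b * \sum_c g b c.
  by rewrite -(law_marg1 XY W) big_distrr /=; apply: eq_bigr => c _; exact: h.
have eYW b c : law YW (b, c) = (\sum_a f a b) * g b c.
  have -> : law YW (b, c) = \sum_a law T (a, b, c).
    rewrite -(law_marg2 X YW); apply: eq_bigr => a _; apply: eq_bigl => o.
    by rewrite !xpair_eqE andbA.
  by rewrite big_distrl /=; apply: eq_bigr => a _; exact: h.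
have eY b : law Y b = (\sum_a f a b) * \sum_c g b c.
  by rewrite -(law_marg2 X Y) big_distrl /=; apply: eq_bigr => a _; exact: eXY.
rewrite (entE Y) (entE XY) (entE YW) (entE T) -!Ropp_plus_distr -!big_split /=.
congr (- _); apply: eq_bigr => o _.
case: (dist_ge0 o Pd) => [po|<-]; last by rewrite !Rmult_0_l.
have p1 : 0 < law XY (XY o) by have := law_ge XY o; lra.
have p2 : 0 < law YW (YW o) by have := law_ge YW o; lra.
have p3 : 0 < law T (T o) by have := law_ge T o; lra.
have p4 : 0 < law Y (Y o) by have := law_ge Y o; lra.
rewrite -!Rmult_plus_distr_l -!log2M //; congr (_ * log2 _).
by rewrite /T h eY eXY eYW; ring.
Qed.

Lemma ent_const (A : finType) (c : A) : ent (fun=> c) = 0.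
Proof.
rewrite entE big1 ?Ropp_0 // => o _; rewrite /law.
rewrite (eq_bigl predT) => [|i]; last by rewrite eqxx.
by rewrite (dist_sum Pd) log2_1 Rmult_0_r.
Qed.

(** Turns both functionals into entropies on any sample space that realizes the triple. Several
    weights and channels can thus be represented by different variables on one space and compared
    there. *)
Lemma info_equiv_ent (Z Y U : finType) (w : Z -> Y -> R) (q : Y -> U -> R)
    (X : O -> Z) (V : O -> Y) (W : O -> U) :
  (forall z y u, law (fun o => (X o, V o, W o)) (z, y, u) = w z y * q y u) ->
  info w q = ent W + ent V - ent (fun o => (W o, V o)) /\
  equiv w q = ent (fun o => (X o, W o)) - ent W.
Proof.
move=> h.
have e1 : joint_aux w q = law (fun o => (W o, V o)).
  apply: functional_extensionality => -[u y]; rewrite /joint_aux /rsum /=.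
  rewrite -(law_marg2 X (fun o => (W o, V o))).
  apply: eq_bigr => z _; rewrite -h; apply: eq_bigl => o.
  by rewrite !xpair_eqE -andbA [(V o == y) && _]andbC.
have e2 : joint_out w q = law (fun o => (X o, W o)).
  apply: functional_extensionality => -[z u]; rewrite /joint_out /rsum /=.
  rewrite -(law_marg1 (fun o => (X o, W o)) V).
  apply: eq_bigr => y _; rewrite -h; apply: eq_bigl => o.
  by rewrite !xpair_eqE -!andbA [(V o == y) && _]andbC.
split.
  rewrite /info /mutual_info e1.
  have -> : marg1 (law (fun o => (W o, V o))) = law W.
    by apply: functional_extensionality => u; exact: law_marg1.
  have -> // : marg2 (law (fun o => (W o, V o))) = law V.
  by apply: functional_extensionality => y; exact: law_marg2.
rewrite /equiv /cond_entropy e2.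
have -> // : marg2 (law (fun o => (X o, W o))) = law W.
by apply: functional_extensionality => y; exact: law_marg2.
Qed.

End RandomVariables.

Lemma mutual_info_ge0 (A B : finType) (P : A * B -> R) : is_dist P -> 0 <= mutual_info P.
Proof.
move=> Pd.
(* Submodularity with a trivial middle variable is subadditivity of entropy. *)
have := @ent_submodular _ P Pd _ _ _ fst (fun=> tt) snd.
rewrite (ent_const Pd) Rplus_0_r.
have <- : ent P id = ent P (fun o => (o.1, tt, o.2)).
  by apply: ent_eq => // [o o' -> //|[a b] [a' b'] [-> ->]].
rewrite (@ent_eq _ P Pd _ _ (fun o => (o.1, tt)) fst); last 2 first.
- by move=> o o' [].
- by move=> o o' ->.
rewrite (@ent_eq _ P Pd _ _ (fun o => (tt, o.2)) snd); last 2 first.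
- by move=> o o' [].
- by move=> o o' ->.
have -> : ent P id = entropy P.
  by rewrite /ent; congr entropy; apply: functional_extensionality => a; rewrite /law big_pred1_eq.
have -> : ent P fst = entropy (marg1 P).
  congr entropy; apply: functional_extensionality => a.
  by rewrite (@law_proj _ P _ _ fst (fun a b => (a, b)) snd) // => -[].
have -> : ent P snd = entropy (marg2 P); last by rewrite /mutual_info; lra.
congr entropy; apply: functional_extensionality => b.
by rewrite (@law_proj _ P _ _ snd (fun b a => (a, b)) fst) // => -[].
Qed.

Section Joint.
Variables (Z Y : finType) (w : Z -> Y -> R).
Hypothesis w0 : forall z y, 0 <= w z y.
Hypothesis w1 : \sum_y obs_law w y = 1.

Lemma joint_dist (U : finType) (q : Y -> U -> R) : is_channel q ->
  is_dist (fun o : Z * Y * U => w o.1.1 o.1.2 * q o.1.2 o.2).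
Proof.
move=> qc; split=> [[[z y] u]|].
  by apply: Rmult_le_pos => //; exact: dist_ge0 (qc y).
rewrite /rsum -(pair_bigA _ (fun zy u => w zy.1 zy.2 * q zy.2 u)).
rewrite -(pair_bigA _ (fun z y => \sum_u w z y * q y u)) /= exchange_big -[RHS]w1.
apply: eq_bigr => y _; apply: eq_bigr => z _.
by rewrite -big_distrr /= (dist_sum (qc y)) Rmult_1_r.
Qed.

Lemma law_joint (U : finType) (q : Y -> U -> R) z y u :
  law (fun o : Z * Y * U => w o.1.1 o.1.2 * q o.1.2 o.2)
     (fun o => (o.1.1, o.1.2, o.2)) (z, y, u) = w z y * q y u.
Proof.
by rewrite /law (big_pred1 (z, y, u)) // => -[[]].
Qed.

Lemma info_ge0 (U : finType) (q : Y -> U -> R) : is_channel q -> 0 <= info w q.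
Proof.
move=> qc; apply: mutual_info_ge0; split=> [[u y]|].
  by apply: sum_ge0 => z _; apply: Rmult_le_pos => //; exact: dist_ge0 (qc y).
rewrite /rsum -(pair_bigA _ (fun u y => \sum_z w z y * q y u)) /= exchange_big -[RHS]w1.
apply: eq_bigr => y _; rewrite exchange_big; apply: eq_bigr => z _.
by rewrite -big_distrr /= (dist_sum (qc y)) Rmult_1_r.
Qed.

(** Data processing along Z - Y - U: I(Z; U) <= I(Y; U) = 0. It settles the degenerate case in which
    no mixing can lower the information further. *)
Lemma info0_equiv (U : finType) (q : Y -> U -> R) : is_channel q -> info w q = 0 ->
  entropy (fun z => \sum_y w z y) <= equiv w q.
Proof.
move=> qc i0; have Pd := joint_dist qc; set P := (fun o : _ => _) in Pd.
have [ei ee] := info_equiv_ent (law_joint q); rewrite -/P in ei ee.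
rewrite i0 in ei; rewrite ee.
have -> : entropy (fun z => \sum_y w z y) = ent P (fun o => o.1.1).
  congr entropy; apply: functional_extensionality => z.
  rewrite (@law_proj _ P _ _ (fun o => o.1.1) (fun z (yu : Y * U) => (z, yu.1, yu.2)) (fun o => (o.1.2, o.2))) //=.
  - rewrite -(pair_bigA _ (fun y u => w z y * q y u)) /=; apply: eq_bigr => y _.
    by rewrite -big_distrr /= (dist_sum (qc y)) Rmult_1_r.
  - by move=> [[]].
  - by move=> a [].
have s := @ent_submodular _ P Pd _ _ _ (fun o => o.1.2) (fun o => o.1.1) snd.
have m := @ent_markov _ P Pd _ _ _ (fun o => o.1.1) (fun o => o.1.2) snd w q (law_joint q).
rewrite (@ent_eq _ P Pd _ _ (fun o => (o.1.2, o.1.1, o.2)) (fun o => (o.1.1, o.1.2, o.2))) in s; last 2 first.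
- by move=> o o' [-> -> ->].
- by move=> o o' [-> -> ->].
rewrite (@ent_eq _ P Pd _ _ (fun o => (o.1.2, o.1.1)) (fun o => (o.1.1, o.1.2))) in s; last 2 first.
- by move=> o o' [-> ->].
- by move=> o o' [-> ->].
rewrite (@ent_eq _ P Pd _ _ (fun o => (o.2, o.1.2)) (fun o => (o.1.2, o.2))) in ei; last 2 first.
- by move=> o o' [-> ->].
- by move=> o o' [-> ->].
lra.
Qed.

End Joint.

(** * Product weights and single-letterization *)

Definition iid_weight (Z Y : finType) (w : Z -> Y -> R) n
    (z : {ffun 'I_n -> Z}) (y : {ffun 'I_n -> Y}) : R :=
  \prod_i w (z i) (y i).

Lemma obs_law_iid (Z Y : finType) (w : Z -> Y -> R) n (y : {ffun 'I_n -> Y}) :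
  obs_law (@iid_weight Z Y w n) y = \prod_i obs_law w (y i).
Proof. by rewrite /obs_law bigA_distr_ffun. Qed.

Lemma sum_prod_iid (A : finType) (p : A -> R) (I : finType) :
  \sum_a p a = 1 -> \sum_(f : {ffun I -> A}) \prod_i p (f i) = 1.
Proof.
by move=> h; rewrite -(bigA_distr_ffun (fun=> p)) big1 // => i _; exact: h.
Qed.

Lemma sum_obs_law_iid (Z Y : finType) (w : Z -> Y -> R) n :
  \sum_y obs_law w y = 1 -> \sum_y obs_law (@iid_weight Z Y w n) y = 1.
Proof.
move=> h; rewrite (eq_bigr _ (fun y _ => obs_law_iid w y)); exact: sum_prod_iid.
Qed.

Section Fcons.
Variables (A : finType) (n : nat).
Definition fcons (a : A) (f : {ffun 'I_n -> A}) : {ffun 'I_n.+1 -> A} :=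
  [ffun i => if unlift ord0 i is Some j then f j else a].
Definition ftail (f : {ffun 'I_n.+1 -> A}) : {ffun 'I_n -> A} := [ffun i => f (lift ord0 i)].

Lemma fcons0 a f : fcons a f ord0 = a. Proof. by rewrite ffunE unlift_none. Qed.
Lemma fconsS a f i : fcons a f (lift ord0 i) = f i. Proof. by rewrite ffunE liftK. Qed.
Lemma ftail_cons a f : ftail (fcons a f) = f.
Proof. by apply/ffunP => i; rewrite ffunE fconsS. Qed.
Lemma fconsK (f : {ffun 'I_n.+1 -> A}) : fcons (f ord0) (ftail f) = f.
Proof. by apply/ffunP => i; case: (unliftP ord0 i) => [j|] ->; rewrite ?fconsS ?fcons0 // ffunE. Qed.
Lemma fcons_inj a f a' f' : fcons a f = fcons a' f' -> a = a' /\ f = f'.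
Proof.
move=> e; split; first by have := congr1 (fun g : {ffun 'I_n.+1 -> A} => g ord0) e; rewrite !fcons0.
by have := congr1 ftail e; rewrite !ftail_cons.
Qed.
End Fcons.

Lemma iid_weight_cons (Z Y : finType) (w : Z -> Y -> R) n z y z' y' :
  iid_weight w (fcons z z') (fcons y y') = w z y * @iid_weight Z Y w n z' y'.
Proof.
rewrite /iid_weight big_ord_recl !fcons0; congr (_ * _).
by apply: eq_bigr => i _; rewrite !fconsS.
Qed.

Section SingleLetter.
Variables (Z Y : finType) (w : Z -> Y -> R).
Hypothesis w0 : forall z y, 0 <= w z y.
Hypothesis w1 : \sum_y obs_law w y = 1.

Lemma iid_weight_ge0 n z y : 0 <= @iid_weight Z Y w n z y.
Proof. exact: prod_ge0. Qed.

Section Step.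
Variables (n : nat) (V : finType) (q : {ffun 'I_n.+1 -> Y} -> V -> R).
Hypothesis qc : is_channel q.

(** [head] averages over the other observations. [tail] passes the first observation on as part of
    its output: it draws y from its own law and then v from [q], so its auxiliary variable is (V,
    Y_1). *)
Let head y v := \sum_y' obs_law (@iid_weight Z Y w n) y' * q (fcons y y') v.
Let tail y' (vy : V * Y) := obs_law w vy.2 * q (fcons vy.2 y') vy.1.

Let O := ((Z * {ffun 'I_n -> Z}) * (Y * {ffun 'I_n -> Y}) * V)%type.
Let P (o : O) := w o.1.1.1 o.1.2.1 * iid_weight w o.1.1.2 o.1.2.2 * q (fcons o.1.2.1 o.1.2.2) o.2.

Let hz (o : O) := o.1.1.1.
Let tz (o : O) := o.1.1.2.
Let hy (o : O) := o.1.2.1.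
Let ty (o : O) := o.1.2.2.
Let v (o : O) := o.2.

Let Pd : is_dist P.
Proof.
split=> [o|].
  apply: Rmult_le_pos; last exact: dist_ge0 (qc _).
  by apply: Rmult_le_pos => //; exact: iid_weight_ge0.
pose F (zz : Z * {ffun 'I_n -> Z}) (yy : Y * {ffun 'I_n -> Y}) := w zz.1 yy.1 * iid_weight w zz.2 yy.2.
rewrite /rsum -(pair_bigA _ (fun zy v => F zy.1 zy.2 * q (fcons zy.2.1 zy.2.2) v)).
rewrite (eq_bigr (fun zy => F zy.1 zy.2)); last first.
  by move=> zy _; rewrite -big_distrr /= (dist_sum (qc _)) Rmult_1_r.
rewrite -(pair_bigA _ F) -(pair_bigA _ (fun z z' => \sum_yy F (z, z') yy)) /=.
rewrite (eq_bigr (fun z => \sum_y w z y)).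
  by rewrite exchange_big.
move=> z _; rewrite -[RHS]Rmult_1_r -(sum_obs_law_iid n w1).
rewrite [in RHS]exchange_big big_distrr /=; apply: eq_bigr => z' _.
by rewrite big_distrlr /= pair_bigA.
Qed.

(** Let Y' and Z' be the tails. The total information is I(Y_1; V) + I(Y'; V | Y_1), and
    independence of Y_1 and Y' turns the last term into I(Y'; V, Y_1). For the equivocation, H(Z' |
    Z_1, V) can only decrease when Y_1 joins the condition, after which Z_1 drops out because Z_1 -
    (V, Y_1) - Z' is a Markov chain. *)
Lemma single_letter_step :
  is_channel head /\ is_channel tail /\
  info w head + info (@iid_weight Z Y w n) tail <= info (@iid_weight Z Y w n.+1) q /\
  equiv w head + equiv (@iid_weight Z Y w n) tail <= equiv (@iid_weight Z Y w n.+1) q.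
Proof.
have ow0 := obs_law_ge0 w0.
have own y' := obs_law_ge0 (@iid_weight_ge0 n) y'.
have owS := sum_obs_law_iid n w1.
have q0 y u : 0 <= q y u by exact: dist_ge0 (qc y).
have hc : is_channel head.
  move=> y; split=> [u|]; first by apply: sum_ge0 => y' _; exact: Rmult_le_pos.
  rewrite /rsum exchange_big -[RHS]owS; apply: eq_bigr => y' _.
  by rewrite -big_distrr /= (dist_sum (qc _)) Rmult_1_r.
have tc : is_channel tail.
  move=> y'; split=> [u|]; first exact: Rmult_le_pos.
  rewrite /rsum -(pair_bigA _ (fun u y => tail y' (u, y))) exchange_big -[RHS]w1.
  apply: eq_bigr => y _.
  by rewrite -[RHS]Rmult_1_r -(dist_sum (qc (fcons y y'))) big_distrr.
split=> //; split=> //.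
have lw zz yy u : law P (fun o => (fcons (hz o) (tz o), fcons (hy o) (ty o), v o)) (zz, yy, u) =
    iid_weight w zz yy * q yy u.
  rewrite -(fconsK zz) -(fconsK yy) iid_weight_cons.
  rewrite /law (big_pred1 (zz ord0, ftail zz, (yy ord0, ftail yy), u)) //.
  move=> [[[a b] [c d]] e]; rewrite /hz /tz /hy /ty /v /= !xpair_eqE.
  congr (_ && _ && _); apply/eqP/andP.
  - by case/fcons_inj => -> ->.
  - by case=> /eqP -> /eqP ->.
  - by case/fcons_inj => -> ->.
  - by case=> /eqP -> /eqP ->.
have lh z y u : law P (fun o => (hz o, hy o, v o)) (z, y, u) = w z y * head y u.
  rewrite (@law_proj _ P _ _ (fun o => (hz o, hy o, v o))
     (fun a (b : {ffun 'I_n -> Y} * {ffun 'I_n -> Z}) => (a.1.1, b.2, (a.1.2, b.1), a.2)) (fun o => (ty o, tz o))).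
  - rewrite -(pair_bigA _ (fun y' z' => w z y * iid_weight w z' y' * q (fcons y y') u)) /=.
    rewrite big_distrr /=; apply: eq_bigr => y' _.
    by rewrite -big_distrl -big_distrr /= Rmult_assoc.
  - by move=> [[[a b] [c d]] e].
  - by move=> [[a b] c].
  - by move=> ? [].
have lt z' y' vy : law P (fun o => (tz o, ty o, (v o, hy o))) (z', y', vy) = iid_weight w z' y' * tail y' vy.
  rewrite (@law_proj _ P _ _ (fun o => (tz o, ty o, (v o, hy o)))
     (fun a (b : Z) => (b, a.1.1, (a.2.2, a.1.2), a.2.1)) hz).
  - by rewrite /P /= -!big_distrl /=; rewrite /tail /obs_law; ring.
  - by move=> [[[a b] [c d]] e].
  - by move=> [[a b] [c d]] e.
  - by move=> [[a b] [c d]] e.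
(* The Markov chain: once y is fixed, z enters only through [w z y]. *)
have lm z vy z' : law P (fun o => (hz o, (v o, hy o), tz o)) (z, vy, z') =
    w z vy.2 * \sum_y' iid_weight w z' y' * q (fcons vy.2 y') vy.1.
  rewrite (@law_proj _ P _ _ (fun o => (hz o, (v o, hy o), tz o))
     (fun a b => (a.1.1, a.2, (a.1.2.2, b), a.1.2.1)) ty).
  - by rewrite big_distrr /=; apply: eq_bigr => y' _; rewrite /P /=; ring.
  - by move=> [[[a b] [c d]] e].
  - by move=> [[a [b c]] d] e.
  - by move=> [[a [b c]] d] e.
(* Independence of the first observation and the tail, expressed as a Markov chain with trivial
   middle variable. *)
have li y t y' : law P (fun o => (hy o, tt, ty o)) (y, t, y') = obs_law w y * obs_law (@iid_weight Z Y w n) y'.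
  rewrite (@law_proj _ P _ _ (fun o => (hy o, tt, ty o))
     (fun a (b : Z * {ffun 'I_n -> Z} * V) => (b.1.1, b.1.2, (a.1.1, a.2), b.2)) (fun o => (hz o, tz o, v o))).
  - rewrite -(pair_bigA _ (fun zz u => w zz.1 y * iid_weight w zz.2 y' * q (fcons y y') u)) /=.
    rewrite /obs_law [RHS]big_distrlr /= [RHS]pair_bigA /=; apply: eq_bigr => zz _.
    by rewrite -big_distrr /= (dist_sum (qc _)) Rmult_1_r.
  - by move=> [[[a b] [c d]] e].
  - by move=> [[a []] d] [[]].
  - by move=> a [[]].
have [iw ew] := info_equiv_ent lw.
have [ih eh] := info_equiv_ent lh.
have [it et] := info_equiv_ent lt.
have mk := @ent_markov _ P Pd _ _ _ hz (fun o => (v o, hy o)) tz _ _ lm.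
have ind := @ent_markov _ P Pd _ _ _ hy (fun=> tt) ty _ (fun _ => _) li.
have sm := @ent_submodular _ P Pd _ _ _ tz (fun o => (hz o, v o)) hy.
have E := @ent_eq _ P Pd.
rewrite (ent_const Pd) in ind.
rewrite (E _ _ (fun o => (hy o, tt)) hy) in ind; [|by move=> o o' [] | by move=> o o' ->].
rewrite (E _ _ (fun o => (tt, ty o)) ty) in ind; [|by move=> o o' [] | by move=> o o' ->].
rewrite (E _ _ (fun o => (hy o, tt, ty o)) (fun o => fcons (hy o) (ty o))) in ind; last 2 first.
- by move=> o o' [-> ->].
- by move=> o o' /fcons_inj [-> ->].
rewrite (E _ _ (fun o => (v o, fcons (hy o) (ty o))) (fun o => (v o, hy o, ty o))) in iw; last 2 first.
- by move=> o o' [-> /fcons_inj [-> ->]].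
- by move=> o o' [-> -> ->].
rewrite (E _ _ (fun o => (fcons (hz o) (tz o), v o)) (fun o => (tz o, (hz o, v o)))) in ew; last 2 first.
- by move=> o o' [/fcons_inj [-> ->] ->].
- by move=> o o' [-> -> ->].
rewrite (E _ _ (fun o => (tz o, (v o, hy o))) (fun o => ((v o, hy o), tz o))) in et; last 2 first.
- by move=> o o' [-> -> ->].
- by move=> o o' [-> -> ->].
rewrite (E _ _ (fun o => (tz o, (hz o, v o), hy o)) (fun o => (hz o, (v o, hy o), tz o))) in sm; last 2 first.
- by move=> o o' [-> -> -> ->].
- by move=> o o' [-> -> -> ->].
rewrite (E _ _ (fun o => (hz o, v o, hy o)) (fun o => (hz o, (v o, hy o)))) in sm; last 2 first.
- by move=> o o' [-> -> ->].
- by move=> o o' [-> -> ->].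
split.
  have A (i0 ih0 it0 a b c d e f : R) : i0 = a + b - c -> ih0 = a + d - e -> it0 = e + f - c ->
    b + 0 = d + f -> ih0 + it0 <= i0 by lra.
  exact: A iw ih it ind.
have A (i0 ih0 it0 a b c d e f g : R) : i0 = a - b -> ih0 = c - b -> it0 = d - e ->
  f + e = g + d -> f + c <= a + g -> ih0 + it0 <= i0 by lra.
exact: A ew eh et mk sm.
Qed.
End Step.

Lemma single_letter n : forall (V : finType) (q : {ffun 'I_n -> Y} -> V -> R), is_channel q ->
  exists (U : finType) (q1 : Y -> U -> R), is_channel q1 /\
    INR n * info w q1 <= info (@iid_weight Z Y w n) q /\
    INR n * equiv w q1 <= equiv (@iid_weight Z Y w n) q.
Proof.
elim: n => [|n IH] V q qc.
  exists unit, (@const_channel Y); split; first exact: const_channelP.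
  rewrite /= !Rmult_0_l; split.
    by apply: info_ge0 => //; [exact: iid_weight_ge0 | exact: sum_obs_law_iid].
  by apply: equiv_ge0 => //; exact: iid_weight_ge0.
have [hc [tc [ii ee]]] := single_letter_step qc.
have [U [q1 [c1 [i1 e1]]]] := IH _ _ tc.
have n0 : 0 < INR n.+1 by apply: lt_0_INR; lia.
have l0 : 0 <= / INR n.+1 <= 1.
  split; first by left; exact: Rinv_0_lt_compat.
  rewrite -[X in _ <= X]Rinv_1; apply: Rinv_le_contravar; first lra.
  by rewrite S_INR; have := pos_INR n; lra.
(* The head gets weight 1 / (n + 1) and the channel for the other coordinates n / (n + 1), so that
   multiplication by n + 1 adds up the two bounds exactly. *)
have [q2 [c2 [i2 e2]]] := channel_mix w0 l0 hc c1.
exists (V + U)%type, q2; split=> //; rewrite i2 e2.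
have aux x y : INR n.+1 * (/ INR n.+1 * x + (1 - / INR n.+1) * y) = x + INR n * y.
  by rewrite S_INR; field; rewrite -S_INR; lra.
by rewrite !aux; split; lra.
Qed.
End SingleLetter.

(** * Converse *)

Lemma sum_marginal1 (I A : finType) (W : I -> A -> R) (i0 : I) (g : A -> R) :
  (forall i, \sum_a W i a = 1) ->
  \sum_(f : {ffun I -> A}) (\prod_i W i (f i)) * g (f i0) = \sum_a W i0 a * g a.
Proof.
move=> W1; pose F i a := W i a * (if i == i0 then g a else 1).
rewrite (eq_bigr (fun f : {ffun I -> A} => \prod_i F i (f i))) => [|f _].
  rewrite -bigA_distr_ffun (bigD1 i0) //= [X in _ * X]big1 => [|i /negbTE ne].
    by rewrite Rmult_1_r; apply: eq_bigr => a _; rewrite /F eqxx.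
  by rewrite /F ne -[RHS](W1 i); apply: eq_bigr => a _; rewrite Rmult_1_r.
rewrite [RHS]big_split /= (bigD1 i0 (F := fun i => if i == i0 then _ else _)) //= eqxx.
by rewrite [X in _ = _ * (_ * X)]big1 ?Rmult_1_r // => i /negbTE ->.
Qed.

Lemma prod_dist (I A : finType) (W : I -> A -> R) :
  (forall i, is_dist (W i)) -> is_dist (fun f : {ffun I -> A} => \prod_i W i (f i)).
Proof.
move=> Wd; split=> [f|]; first by apply: prod_ge0 => i; exact: dist_ge0 (Wd i).
by rewrite /rsum -bigA_distr_ffun big1 // => i _; exact: dist_sum.
Qed.

Lemma sum_prod_log2 (I A : finType) (P : {ffun I -> A} -> R) (Q : I -> A -> R) :
  (forall f, 0 <= P f) -> (forall f, 0 < P f -> forall i, 0 < Q i (f i)) ->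
  \sum_f P f * log2 (\prod_i Q i (f i)) = \sum_i \sum_f P f * log2 (Q i (f i)).
Proof.
move=> P0 PQ; rewrite exchange_big /=; apply: eq_bigr => f _; rewrite -big_distrr /=.
by case: (P0 f) => [/PQ h|<-]; [rewrite log2_prod | rewrite !Rmult_0_l].
Qed.

Lemma entropy_prod (I A : finType) (W : I -> A -> R) :
  (forall i, is_dist (W i)) ->
  entropy (fun f : {ffun I -> A} => \prod_i W i (f i)) = \sum_i entropy (W i).
Proof.
move=> Wd; have [P0 _] := prod_dist Wd.
rewrite entropyE // sum_prod_log2 //; last first.
  by move=> f; apply: prod_gt0_inv => i; exact: dist_ge0 (Wd i).
rewrite -sumN; apply: eq_bigr => i _.
rewrite (sum_marginal1 i (fun a => log2 (W i a)) (fun i => dist_sum (Wd i))).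
by rewrite entropyE // => a; exact: dist_ge0 (Wd i).
Qed.

Lemma entropy_channel (A B : finType) (p : A -> R) (W : A -> B -> R) :
  is_dist p -> is_channel W ->
  entropy (fun ab : A * B => p ab.1 * W ab.1 ab.2) = entropy p + \sum_a p a * entropy (W a).
Proof.
move=> pd Wc; rewrite /entropy /rsum -(pair_bigA _ (fun a b => plogp (p a * W a b))) /=.
rewrite -!sumN -big_split /=; apply: eq_bigr => a _.
rewrite (eq_bigr (fun b => p a * plogp (W a b) + plogp (p a) * W a b)) => [|b _].
  by rewrite big_split -!big_distrr /= (dist_sum (Wc a)); ring.
by rewrite plogpM; [ring | exact: dist_ge0 pd | exact: dist_ge0 (Wc a)].
Qed.

Lemma entropy_reindex (A B : finType) (h : B -> A) (p : A -> R) : bijective h ->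
  entropy (fun b => p (h b)) = entropy p.
Proof.
by move=> hb; congr (- _); rewrite /rsum [RHS](reindex h) //; exact: onW_bij.
Qed.

Lemma relay_rateE (X1 S : finType) (ps : X1 -> S -> R) (p : X1 -> R) :
  is_dist p -> is_channel ps ->
  relay_rate ps p = entropy (fun s => \sum_x p x * ps x s) - \sum_x p x * entropy (ps x).
Proof.
move=> pd psc; rewrite /relay_rate /mutual_info entropy_channel //.
have -> : marg1 (fun xs => p xs.1 * ps xs.1 xs.2) = p.
  apply: functional_extensionality => a; rewrite /marg1 /rsum /= -big_distrr /=.
  by rewrite (dist_sum (psc a)) Rmult_1_r.
rewrite /marg2 /rsum /=; ring.
Qed.

(** Symmetry of mutual information. It makes estimates proved for transmission over a channel
    available for quantization, with the observation law as input law. *)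
Lemma info_relay_rate (Z Y U : finType) (w : Z -> Y -> R) (q : Y -> U -> R) :
  info w q = relay_rate q (obs_law w).
Proof.
pose P (yu : Y * U) := obs_law w yu.1 * q yu.1 yu.2.
have e (u : U) (y : Y) : joint_aux w q (u, y) = P (y, u).
  by rewrite /joint_aux /rsum -big_distrl.
rewrite /info /relay_rate /mutual_info -/P.
have -> : marg1 (joint_aux w q) = marg2 P.
  by apply: functional_extensionality => u; apply: eq_bigr => y _; exact: e.
have -> : marg2 (joint_aux w q) = marg1 P.
  by apply: functional_extensionality => y; apply: eq_bigr => u _; exact: e.
have -> : entropy (joint_aux w q) = entropy P; last by ring.
rewrite -(@entropy_reindex _ _ (fun uy : U * Y => (uy.2, uy.1))); last first.
  by exists (fun yu => (yu.2, yu.1)) => -[].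
by congr entropy; apply: functional_extensionality => -[u y]; exact: e.
Qed.

Section RelayInfo.
Variables (Z Y X1 S : finType) (w : Z -> Y -> R) (ps : X1 -> S -> R) (R0 : R).
Hypothesis w0 : forall z y, 0 <= w z y.
Hypothesis w1 : \sum_y obs_law w y = 1.
Hypothesis psc : is_channel ps.
Hypothesis R0ub : forall p : X1 -> R, is_dist p -> relay_rate ps p <= R0.

(** Given y the outputs are independent, so H(S^n | Y) is a sum, while H(S^n) is at most the sum of
    the H(S_i). Each difference is the rate of [ps] at the input law of [x i], hence at most R0. *)
Lemma info_memoryless_le (n : nat) (x : 'I_n -> Y -> X1) :
  info w (fun y (s : {ffun 'I_n -> S}) => \prod_i ps (x i y) (s i)) <= INR n * R0.
Proof.
set q := fun _ => _.
have pd : is_dist (obs_law w) by split=> // y; exact: obs_law_ge0.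
have qc : is_channel q by move=> y; exact: (prod_dist (fun i => psc (x i y))).
pose T i a := \sum_y obs_law w y * ps (x i y) a.
pose PS s := \sum_y obs_law w y * q y s.
have Td i : is_dist (T i).
  split=> [a|].
    by apply: sum_ge0 => y _; apply: Rmult_le_pos; [exact: dist_ge0 pd | exact: dist_ge0 (psc _)].
  rewrite /rsum exchange_big -[RHS]w1; apply: eq_bigr => y _.
  by rewrite -big_distrr /= (dist_sum (psc _)) Rmult_1_r.
have PSd : is_dist PS.
  split=> [s|].
    by apply: sum_ge0 => y _; apply: Rmult_le_pos; [exact: dist_ge0 pd | exact: dist_ge0 (qc _)].
  rewrite /rsum exchange_big -[RHS]w1; apply: eq_bigr => y _.
  by rewrite -big_distrr /= (dist_sum (qc _)) Rmult_1_r.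
have marg i (g : S -> R) : \sum_s PS s * g (s i) = \sum_a T i a * g a.
  rewrite (eq_bigr (fun s => \sum_y obs_law w y * (q y s * g (s i)))); last first.
    by move=> s _; rewrite big_distrl; apply: eq_bigr => y _ /=; ring.
  rewrite [RHS](eq_bigr (fun a => \sum_y obs_law w y * (ps (x i y) a * g a))); last first.
    by move=> s _; rewrite big_distrl; apply: eq_bigr => y _ /=; ring.
  rewrite exchange_big [RHS]exchange_big /=; apply: eq_bigr => y _.
  rewrite -!big_distrr /=; congr (_ * _).
  by rewrite (sum_marginal1 i g (fun j => dist_sum (psc (x j y)))).
(* Subadditivity of entropy, as Gibbs' inequality against the product of the marginals [T i]. *)
have hS : entropy PS <= \sum_i entropy (T i).
  have Tpos s : 0 < PS s -> forall i, 0 < T i (s i).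
    move=> hs i; case: (dist_ge0 (s i) (Td i)) => // e; exfalso.
    have h0 y : obs_law w y * ps (x i y) (s i) = 0.
      apply: (sum_eq0 (F := fun y => obs_law w y * ps (x i y) (s i))) => // y'.
      by apply: Rmult_le_pos; [exact: dist_ge0 pd | exact: dist_ge0 (psc _)].
    move: hs; rewrite /PS big1; first by lra.
    by move=> y _; rewrite /q (bigD1 i) //= -Rmult_assoc h0 Rmult_0_l.
  have [Q0 Q1] := prod_dist Td.
  apply: Rle_trans (gibbs PSd Q0 _ _) _.
  - by rewrite -/(rsum _) Q1; lra.
  - by move=> s /Tpos; exact: prod_gt0.
  rewrite sum_prod_log2 //; last by case: PSd.
  rewrite -sumN; apply: sum_le => i _; rewrite (marg i (fun a => log2 (T i a))).
  by rewrite entropyE; [lra | case: (Td i)].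
have -> : info w q = entropy PS - \sum_y obs_law w y * \sum_i entropy (ps (x i y)).
  rewrite info_relay_rate relay_rateE //; congr (_ - _).
  by apply: eq_bigr => y _; rewrite -(entropy_prod (fun i => psc (x i y))).
have rr i : entropy (T i) - \sum_y obs_law w y * entropy (ps (x i y)) <= R0.
  pose p := law (obs_law w) (x i).
  have pd' : is_dist p by exact: law_dist.
  apply: Rle_trans (R0ub pd').
  have -> : T i = (fun s => \sum_x p x * ps x s).
    by apply: functional_extensionality => a; rewrite (law_expect _ _ (fun b => ps b a)).
  rewrite relay_rateE // (law_expect _ _ (fun b => entropy (ps b))); lra.
have -> : \sum_y obs_law w y * \sum_i entropy (ps (x i y)) =
    \sum_i \sum_y obs_law w y * entropy (ps (x i y)).
  by rewrite exchange_big; apply: eq_bigr => y _; rewrite big_distrr.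
have : \sum_i (entropy (T i) - \sum_y obs_law w y * entropy (ps (x i y))) <= \sum_(i < n) R0.
  by apply: sum_le => i _.
by rewrite sum_const card_ord sumB; lra.
Qed.
End RelayInfo.

Lemma joint_out_dist (Z Y U : finType) (w : Z -> Y -> R) (q : Y -> U -> R) :
  (forall z y, 0 <= w z y) -> \sum_y obs_law w y = 1 -> is_channel q ->
  is_dist (joint_out w q).
Proof.
move=> w0 w1 qc; split=> [zu|].
  by apply: sum_ge0 => y _; apply: Rmult_le_pos => //; exact: dist_ge0 (qc y).
rewrite /rsum -(pair_bigA _ (fun z u => joint_out w q (z, u))) /=.
rewrite -[RHS]w1 /obs_law [RHS]exchange_big /=; apply: eq_bigr => z _.
rewrite /joint_out /rsum /= exchange_big /=; apply: eq_bigr => y _.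
by rewrite -big_distrr /= (dist_sum (qc y)) Rmult_1_r.
Qed.

(* Gibbs' inequality for (W, Z, S) against the law P(s) |G|^-1 F(w | y, s), where F puts
   mass 1/2 on the decoded message and spreads 1/2 uniformly: Fano's inequality and the
   bound H(Y) <= log |G| in a single step. *)
Lemma one_shot_converse (M : nat) (G S : finType) (PZS : G * S -> R)
    (tr : 'I_M -> G -> G) (dc : G -> S -> 'I_M) :
  (0 < M)%N -> is_dist PZS -> (forall i, injective (tr i)) ->
  let Pe := / INR M * \sum_(i < M) \sum_(zs : G * S) PZS zs * (if dc (tr i zs.1) zs.2 == i then 0 else 1) in
  log2 (INR M) * (1 - Pe) <= 1 + log2 (INR #|G|) - cond_entropy PZS.
Proof.
move=> M0 Pd ti Pe.
have M0R : 0 < INR M by apply: lt_0_INR; apply/ltP.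
have sumG c : \sum_(y : G) c = INR #|G| * c by exact: sum_const.
have G0 : 0 < INR #|G|.
  suff [g _] : exists g : G, True by apply: lt_0_INR; apply/ltP; apply/card_gt0P; exists g.
  apply: NNPP => hn; have := dist_sum Pd; rewrite big1; first by lra.
  by case=> g s _; case: hn; exists g.
move: (INR #|G|) sumG G0 => g sumG G0.
pose u (_ : 'I_M) := / INR M.
have ud : is_dist u.
  split=> [t|]; first by left; exact: Rinv_0_lt_compat.
  by rewrite /rsum sum_const card_ord Rinv_r; lra.
have Wc : is_channel (fun _ : 'I_M => PZS) by move=> ?.
pose P (t : 'I_M * (G * S)) := u t.1 * PZS t.2.
have iM := Rinv_0_lt_compat _ M0R.
have iG := Rinv_0_lt_compat _ G0.
have PP : is_dist P.
  split=> [t|]; first by apply: Rmult_le_pos; [rewrite /u; lra | exact: dist_ge0 Pd].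
  rewrite /rsum -(pair_bigA _ (fun i zs => u i * PZS zs)) /= -[RHS](dist_sum ud).
  by apply: eq_bigr => i _; rewrite -big_distrr /= (dist_sum Pd) Rmult_1_r.
have HP : entropy P = log2 (INR M) + entropy PZS.
  rewrite /P (entropy_channel ud Wc) -big_distrl /= (dist_sum ud) Rmult_1_l; congr (_ + _).
  rewrite entropyE => [|t]; last by rewrite /u; lra.
  by rewrite /u sum_const card_ord log2V //; field; lra.
pose PS := marg2 PZS.
have PS0 s : 0 <= PS s by apply: sum_ge0 => z _; exact: dist_ge0 Pd.
(* The total mass is 1/2 + (M - 1) / (2 M) <= 1. A wrong guess costs exactly log M more than a right
   one, which is the Fano term. *)
pose F i y s := if dc y s == i then / 2 else / 2 * / INR M.
have F0 i y s : 0 < F i y s by rewrite /F; case: ifP => _; [lra | nra].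
pose Q (t : 'I_M * (G * S)) := PS t.2.2 * (/ g * F t.1 (tr t.1 t.2.1) t.2.2).
have Q0 t : 0 <= Q t.
  by apply: Rmult_le_pos => //; apply: Rmult_le_pos; [lra | left].
have SF y s : \sum_i F i y s <= 1.
  apply: Rle_trans (_ : \sum_i (/ 2 * indic (i == dc y s) + / 2 * / INR M) <= _).
    apply: sum_le => i _; rewrite /F eq_sym; case: ifP => _ /=; nra.
  by rewrite big_split /= (sum_indic_eq (fun=> / 2)) sum_const card_ord; right; field; lra.
have Q1 : \sum_t Q t <= 1.
  rewrite -(pair_bigA _ (fun i zs => Q (i, zs))) /=.
  have -> : \sum_i \sum_zs Q (i, zs) =
      \sum_s \sum_y \sum_i PS s * (/ g * F i y s).
    rewrite exchange_big /= -(pair_bigA _ (fun z s => \sum_i Q (i, (z, s)))) /= exchange_big /=.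
    apply: eq_bigr => s _; rewrite exchange_big [RHS]exchange_big /=; apply: eq_bigr => i _.
    (* An injective self-map of a finite set permutes it: for a fixed message, summing over noises
       is summing over outputs. *)
    by rewrite [RHS](reindex_inj (ti i)).
  have PSs : \sum_s PS s = 1.
    by rewrite -[RHS](dist_sum Pd) /PS /marg2 /rsum exchange_big pair_bigA; apply: eq_bigr => -[].
  apply: Rle_trans (_ : \sum_s PS s * 1 <= _); last by rewrite -big_distrl /= PSs; lra.
  apply: sum_le => s _.
  rewrite (eq_bigr (fun y => PS s * (/ g * \sum_i F i y s))) => [|y _]; last by rewrite -!big_distrr.
  rewrite -big_distrr /=; apply: Rmult_le_compat_l => //.
  apply: Rle_trans (_ : \sum_(y : G) / g * 1 <= _).
    by apply: sum_le => y _; apply: Rmult_le_compat_l; [left; exact: iG | exact: SF].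
  by rewrite sumG; right; field; lra.
have PSp z s : 0 < PZS (z, s) -> 0 < PS s.
  move=> h; apply: Rlt_le_trans h _; apply: (sum_term_le (F := fun z => PZS (z, s))) => z'.
  exact: dist_ge0 Pd.
have PQ t : 0 < P t -> 0 < Q t.
  case: t => [i [z s]]; rewrite /P /Q /u /= => h.
  apply: Rmult_lt_0_compat; last exact: Rmult_lt_0_compat.
  by apply: (PSp z); nra.
pose E (t : 'I_M * (G * S)) := if dc (tr t.1 t.2.1) t.2.2 == t.1 then 0 else 1.
pose LS (t : 'I_M * (G * S)) := log2 (PS t.2.2).
have logQ t : 0 < P t -> log2 (Q t) = LS t - log2 g - 1 - E t * log2 (INR M).
  case: t => [i [z s]] pt; rewrite /Q /LS /E /= log2M; last 2 first.
  - by move: pt; rewrite /P /u /= => pt; apply: (PSp z); nra.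
  - exact: Rmult_lt_0_compat.
  rewrite log2M // log2V // /F; case: ifP => _.
    by rewrite log2V; [rewrite log2_2; ring | lra].
  by rewrite log2M ?log2V ?log2_2; try lra.
have := gibbs PP Q0 Q1 PQ; rewrite HP.
have -> : \sum_t P t * log2 (Q t) =
   \sum_t P t * LS t - log2 g - 1 - Pe * log2 (INR M).
  have -> : \sum_t P t * log2 (Q t) =
      \sum_t (P t * LS t - P t * log2 g - P t * 1 - P t * E t * log2 (INR M)).
    apply: eq_bigr => t _; case: (dist_ge0 t PP) => [/logQ ->|<-]; ring.
  rewrite !sumB -!big_distrl /= (dist_sum PP).
  have -> : \sum_t P t * E t = Pe.
    rewrite /Pe pair_bigA big_distrr /=; apply: eq_bigr => -[i zs] _.
    exact: Rmult_assoc.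
  ring.
have -> : \sum_t P t * LS t = - entropy PS.
  rewrite -(pair_bigA _ (fun i zs => P (i, zs) * LS (i, zs))) /=.
  pose K := \sum_z \sum_s PZS (z, s) * log2 (PS s).
  rewrite (eq_bigr (fun i => u i * K)) => [|i _]; last first.
    rewrite /K pair_bigA big_distrr; apply: eq_bigr => -[z s] _; exact: Rmult_assoc.
  rewrite -big_distrl /= (dist_sum ud) Rmult_1_l entropyE // Ropp_involutive.
  rewrite /K exchange_big /=; apply: eq_bigr => s _.
  by rewrite -big_distrl.
rewrite /cond_entropy -/PS; lra.
Qed.

Lemma card_Zm m : (1 < m)%N -> #|'Z_m| = m.
Proof. by move=> h; rewrite card_ord Zp_cast. Qed.

Lemma log2_pow x n : 0 < x -> log2 (x ^ n) = INR n * log2 x.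
Proof.
move=> hx; elim: n => [|n IH]; first by rewrite /= log2_1; ring.
by rewrite -tech_pow_Rmult log2M ?IH ?S_INR //; [ring | exact: pow_lt].
Qed.

Lemma INR_expn a n : INR (a ^ n)%N = INR a ^ n.
Proof. by elim: n => [|n IH]; rewrite ?expnS ?mult_INR ?IH. Qed.

Section Converse.
Variables (m : nat) (Y1 X1 S : finType) (pz : 'Z_m -> R)
  (py1 : 'Z_m -> Y1 -> R) (ps : X1 -> S -> R) (R0 : R).
Hypothesis m1 : (1 < m)%N.
Hypothesis pzd : is_dist pz.
Hypothesis pyc : is_channel py1.
Hypothesis psc : is_channel ps.
Hypothesis R0ub : forall p : X1 -> R, is_dist p -> relay_rate ps p <= R0.
Let w z y := pz z * py1 z y.

Lemma source_weight_ge0 z y : 0 <= w z y.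
Proof. by apply: Rmult_le_pos; [exact: dist_ge0 pzd | exact: dist_ge0 (pyc z)]. Qed.

Lemma source_weight_sum : \sum_y obs_law w y = 1.
Proof.
rewrite /obs_law exchange_big -[RHS](dist_sum pzd); apply: eq_bigr => z _.
by rewrite -big_distrr /= (dist_sum (pyc z)) Rmult_1_r.
Qed.

Definition relay_channel n M (c : code m Y1 X1 S n M) (y : {ffun 'I_n -> Y1}) (s : {ffun 'I_n -> S}) : R :=
  \prod_i ps (rel c (prefix y i)) (s i).

Lemma relay_channelP n M (c : code m Y1 X1 S n M) : is_channel (relay_channel c).
Proof. by move=> y; exact: (prod_dist (fun i => psc _)). Qed.

Lemma err_probE n M (c : code m Y1 X1 S n M) :
  err_prob pz py1 ps c = / INR M * \sum_(i < M)
    \sum_(zs : {ffun 'I_n -> 'Z_m} * {ffun 'I_n -> S})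
      joint_out (@iid_weight _ _ w n) (relay_channel c) zs *
      (if dec c [ffun j => GRing.add (enc c i j) (zs.1 j)] zs.2 == i then 0 else 1).
Proof.
congr (_ * _); apply: eq_bigr => i _; rewrite /rsum.
rewrite -(pair_bigA _ (fun z s => joint_out (@iid_weight _ _ w n) (relay_channel c) (z, s) *
      (if dec c [ffun j => GRing.add (enc c i j) (z j)] s == i then 0 else 1))) /=.
apply: eq_bigr => z _; rewrite exchange_big /=; apply: eq_bigr => s _.
rewrite /joint_out /rsum big_distrl /=; apply: eq_bigr => y _; congr (_ * _).
by rewrite /rprod /iid_weight /relay_channel -big_split.
Qed.

Lemma converse_code n M (c : code m Y1 X1 S n M) C : (0 < M)%N -> (0 < n)%N ->
  (forall (U : finType) (q : Y1 -> U -> R), is_channel q -> info w q <= R0 ->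
     log2 (INR m) - equiv w q <= C) ->
  log2 (INR M) * (1 - err_prob pz py1 ps c) <= 1 + INR n * C.
Proof.
move=> M0 n0 hC.
have w0 := source_weight_ge0; have w1 := source_weight_sum.
have wn0 := @iid_weight_ge0 _ _ w w0 n.
have wn1 := sum_obs_law_iid n w1.
have qc := relay_channelP c.
have Pd := joint_out_dist wn0 wn1 qc.
have ti (i : 'I_M) : injective (fun z : {ffun 'I_n -> 'Z_m} => [ffun j => GRing.add (enc c i j) (z j)]).
  by move=> z z' /ffunP e; apply/ffunP => j; have := e j; rewrite !ffunE => /GRing.addrI.
have := @one_shot_converse M _ _ _ _ (dec c) M0 Pd ti.
rewrite -err_probE card_ffun (card_Zm m1) card_ord INR_expn log2_pow; last first.
  by apply: lt_0_INR; apply/ltP; exact: ltnW.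
rewrite -/(equiv _ _) => h.
(* The whole vector Y1^n is one symbol of the product weight, and every relay input is a function of
   it. *)
have ii := info_memoryless_le wn0 wn1 psc R0ub (fun i y => rel c (prefix y i)).
have [U [q1 [c1 [i1 e1]]]] := single_letter w0 w1 qc.
have n0R : 0 < INR n by apply: lt_0_INR; apply/ltP.
have i2 : info w q1 <= R0.
  apply: (Rmult_le_reg_l (INR n)) => //; apply: Rle_trans i1 ii.
have := hC _ _ c1 i2; nra.
Qed.

Lemma converse C Rt :
  (forall (U : finType) (q : Y1 -> U -> R), is_channel q -> info w q <= R0 ->
     log2 (INR m) - equiv w q <= C) ->
  achievable pz py1 ps Rt -> Rt <= C.
Proof.
move=> hC [M [c [hM he]]].
have Mp n : 0 < INR (M n) by apply: Rlt_le_trans (hM n); exact: exp_pos.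
have lM n : INR n * Rt <= log2 (INR (M n)).
  have -> : INR n * Rt = log2 (Rpower 2 (INR n * Rt)).
    by rewrite /log2 /Rpower ln_exp; field; have := ln2_gt0; lra.
  by apply: log2_le => //; exact: exp_pos.
have [N0 hN0] := he 1 Rlt_0_1.
(* Starting at [N0] keeps the error probability below 1, so that the lower bound on log M may be
   multiplied by 1 - Pe; the successor keeps the block length positive. *)
have key n : Rt * (1 - err_prob pz py1 ps (c (N0 + n.+1)%N)) - / INR n.+1 <= C.
  set k := (N0 + n.+1)%N.
  have k0 : (0 < k)%N by rewrite /k addnS.
  have M0 : (0 < M k)%N by apply/ltP; apply: INR_lt; exact: Mp.
  have := converse_code (c k) M0 k0 hC.
  have e1 : err_prob pz py1 ps (c k) < 1.
    have /hN0 : (k >= N0)%coq_nat by apply/leP; rewrite leq_addr.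
    by rewrite /Rdist Rminus_0_r; move/Rabs_def2 => [].
  have kn : INR n.+1 <= INR k by apply: le_INR; apply/leP; rewrite leq_addl.
  have n0 : 0 < INR n.+1 by apply: lt_0_INR; lia.
  set e := err_prob _ _ _ _ in e1 *.
  move=> h.
  have h2 : INR k * (Rt * (1 - e) - C) <= 1 by have := lM k; nra.
  suff : Rt * (1 - e) - C <= / INR n.+1 by lra.
  apply: Rnot_lt_le => h3.
  have : 1 < INR k * (Rt * (1 - e) - C); last by lra.
  have ip := Rinv_0_lt_compat _ n0.
  apply: Rlt_le_trans (_ : INR n.+1 * (Rt * (1 - e) - C) <= _).
    rewrite -[X in X < _](Rinv_r (INR n.+1)); last lra.
    exact: Rmult_lt_compat_l.
  by apply: Rmult_le_compat_r; lra.
apply: Un_cv_le key _.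
have c1 : Un_cv (fun n => err_prob pz py1 ps (c (N0 + n.+1)%N)) 0.
  apply: (Un_cv_subseq (u := fun n => err_prob pz py1 ps (c n)) (phi := fun n => (N0 + n.+1)%N)) => // n.
  by apply/leP; rewrite addnS ltnW // ltnS leq_addl.
have c2 : Un_cv (fun n => / INR n.+1) 0.
  move=> e he'; have [N [hN1 hN2]] := archimed_cor1 e he'; exists N => n hn.
  rewrite /Rdist Rminus_0_r Rabs_pos_eq; last by left; apply: Rinv_0_lt_compat; apply: lt_0_INR; lia.
  apply: Rle_lt_trans hN1; apply: Rinv_le_contravar; first exact: lt_0_INR.
  by apply: le_INR; lia.
have := CV_minus _ _ _ _ (CV_mult _ _ _ _ (Un_cv_const Rt) (CV_minus _ _ _ _ (Un_cv_const 1) c1)) c2.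
by rewrite !Rminus_0_r Rmult_1_r.
Qed.
End Converse.

(** * Random coding, covering and the equipartition property *)

Definition Rleb (x y : R) : bool := if Rle_dec x y then true else false.

Lemma RlebP x y : reflect (x <= y) (Rleb x y).
Proof. by rewrite /Rleb; case: Rle_dec => h; constructor. Qed.

(** From exp x <= 1 / (1 - x), because (1 + x + 2 x^2)(1 - x) = 1 + x^2 (1 - 2 x) >= 1 for x <=
    1/2. *)
Lemma exp_le_quad x : x <= / 2 -> exp x <= 1 + x + 2 * (x * x).
Proof.
move=> hx.
have h1 : 1 - x <= exp (- x).
  case: (Req_dec x 0) => [->|h]; first by rewrite Ropp_0 exp_0; lra.
  by have := @exp_ineq1 (- x); lra.
have h2 : exp x * exp (- x) = 1 by rewrite -exp_plus Rplus_opp_r exp_0.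
have h3 := exp_pos x.
have h4 : exp x * (1 - x) <= 1 by nra.
have h5 : 1 <= (1 + x + 2 * (x * x)) * (1 - x) by nra.
apply: (Rmult_le_reg_r (1 - x)); lra.
Qed.

Lemma sum_absE (T : finType) (g : T -> R) t : Rabs (g t) <= \sum_t Rabs (g t).
Proof. by apply: (sum_term_le (F := fun t => Rabs (g t))) => s; exact: Rabs_pos. Qed.

Lemma chernoff_tilt (T : finType) (P g : T -> R) : is_dist P -> \sum_t P t * g t < 0 ->
  exists2 s, 0 < s & \sum_t P t * exp (s * g t) < 1.
Proof.
move=> Pd; set mu := \sum_t _ => mu0.
pose B := 1 + \sum_t Rabs (g t).
have B1 : 1 <= B.
  have : 0 <= \sum_t Rabs (g t) by apply: sum_ge0 => t _; exact: Rabs_pos.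
  by rewrite /B; lra.
have gB t : Rabs (g t) <= B by have := sum_absE g t; rewrite /B; lra.
(* The first bound gives s |g| <= 1/2, as the quadratic estimate of exp demands; the second keeps
   the quadratic term 2 (s B)^2 at most half of the gain - s mu. *)
pose s := Rmin (/ (2 * B)) (- mu / (4 * (B * B))).
have s1 : s <= / (2 * B) by exact: Rmin_l.
have s2 : s <= - mu / (4 * (B * B)) by exact: Rmin_r.
have s0 : 0 < s.
  apply: Rmin_glb_lt; first by apply: Rinv_0_lt_compat; lra.
  by apply: Rdiv_lt_0_compat; nra.
have sB : s * (2 * B) <= 1.
  by rewrite -[X in _ <= X](Rinv_l (2 * B)); [apply: Rmult_le_compat_r; lra | lra].
have smu : s * (4 * (B * B)) <= - mu.
  apply: Rle_trans (Rmult_le_compat_r _ _ _ _ s2) _; first by nra.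
  by right; field; lra.
exists s => //.
apply: Rle_lt_trans (_ : \sum_t (P t + s * (P t * g t) + 2 * (s * B) * (s * B) * P t) < _).
  apply: sum_le => t _.
  have [l1 l2] : - B <= g t <= B.
    by have := gB t; have := Rle_abs (g t); have := Rle_abs (- g t); rewrite Rabs_Ropp; lra.
  have hs : s * g t <= / 2 by nra.
  have := exp_le_quad hs => he.
  have x1 : s * g t <= s * B by apply: Rmult_le_compat_l; lra.
  have x2 : s * - B <= s * g t by apply: Rmult_le_compat_l; lra.
  have h2 : s * g t * (s * g t) <= s * B * (s * B).
    suff : 0 <= (s * B - s * g t) * (s * B + s * g t) by lra.
    by apply: Rmult_le_pos; lra.
  have p0 := dist_ge0 t Pd.
  apply: Rle_trans (Rmult_le_compat_l _ _ _ p0 he) _.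
  by have := Rmult_le_compat_l _ _ _ p0 h2; lra.
rewrite !big_split -!big_distrr /= (dist_sum Pd) -/mu; nra.
Qed.

Lemma prod_exp (I : finType) (f : I -> R) : \prod_i exp (f i) = exp (\sum_i f i).
Proof. by rewrite (big_morph exp exp_plus exp_0). Qed.

Lemma pow_vanish x e : 0 <= x < 1 -> 0 < e ->
  exists n0 : nat, forall n, (n0 <= n)%N -> x ^ n <= e.
Proof.
move=> [x0 x1] e0; have [|N hN] := pow_lt_1_zero x _ e e0; first by rewrite Rabs_pos_eq.
exists N => n /leP hn; have := hN n hn; rewrite Rabs_pos_eq; first lra.
exact: pow_le.
Qed.

Lemma Rpower2_ln x : 0 < x -> Rpower 2 (log2 x) = x.
Proof.
move=> hx; rewrite /Rpower /log2 -[RHS](exp_ln x hx); congr exp.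
by field; have := ln2_gt0; lra.
Qed.

Section AEP.
Variables (A B : finType) (P r : A -> B -> R) (c : R).
Hypothesis P0 : forall a b, 0 <= P a b.
Hypothesis P1 : \sum_a \sum_b P a b = 1.
Hypothesis r0 : forall a b, 0 < P a b -> 0 < r a b.
Hypothesis hc : \sum_a \sum_b P a b * log2 (r a b) < c.

(** Chernoff's method: the indicator is at most the exponential of s times the excess, whose
    expectation is the n-th power of a number below 1. *)
Lemma aep e : 0 < e -> exists n0 : nat, forall n, (n0 <= n)%N ->
  \sum_(f : {ffun 'I_n -> A}) \sum_(g : {ffun 'I_n -> B}) (\prod_i P (f i) (g i)) *
    indic (Rleb (Rpower 2 (INR n * c)) (\prod_i r (f i) (g i))) <= e.
Proof.
move=> e0; have L := ln2_gt0.
pose g0 a b := ln (r a b) - c * ln 2.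
have [||s s0 hs] := @chernoff_tilt (A * B)%type (fun t => P t.1 t.2) (fun t => g0 t.1 t.2).
- by split=> [[a b] //|]; rewrite /rsum -(pair_bigA _ P).
- rewrite -(pair_bigA _ (fun a b => P a b * g0 a b)) /=.
  have -> : \sum_a \sum_b P a b * g0 a b =
      (\sum_a \sum_b P a b * log2 (r a b)) * ln 2 - (\sum_a \sum_b P a b) * (c * ln 2).
    rewrite !big_distrl -sumB /=; apply: eq_bigr => a _; rewrite !big_distrl -sumB /=.
    by apply: eq_bigr => b _; rewrite /g0 /log2; field; lra.
  rewrite P1; nra.
rewrite -(pair_bigA _ (fun a b => P a b * exp (s * g0 a b))) /= in hs.
set rho := \sum_a _ in hs.
have rho0 : 0 <= rho.
  apply: sum_ge0 => a _; apply: sum_ge0 => b _; apply: Rmult_le_pos => //.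
  by left; exact: exp_pos.
have [n0 hn0] := pow_vanish (conj rho0 hs) e0.
exists n0 => n /hn0; apply: Rle_trans.
have -> : rho ^ n = \sum_(f : {ffun 'I_n -> A}) \sum_(g : {ffun 'I_n -> B})
    \prod_i (P (f i) (g i) * exp (s * g0 (f i) (g i))).
  rewrite -[in LHS](card_ord n) -prod_const bigA_distr_ffun; apply: eq_bigr => f _.
  by rewrite bigA_distr_ffun.
apply: sum_le => f _; apply: sum_le => g _; rewrite big_split /=.
case: (prod_ge0 (fun i => P0 (f i) (g i))) => [pp|<-]; last by rewrite !Rmult_0_l; lra.
apply: Rmult_le_compat_l; first by left.
case: RlebP => [h|_] /=; last by apply: prod_ge0 => i; left; exact: exp_pos.
have rp i : 0 < r (f i) (g i).
  by apply: r0; exact: (prod_gt0_inv (fun i => P0 (f i) (g i))).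
rewrite prod_exp -exp_0.
have -> : \sum_i s * g0 (f i) (g i) = s * (ln (\prod_i r (f i) (g i)) - INR n * c * ln 2).
  by rewrite -big_distrr /= sumB ln_prod // sum_const card_ord; ring.
have : ln (Rpower 2 (INR n * c)) <= ln (\prod_i r (f i) (g i)).
  case: h => [h|->]; last exact: Rle_refl.
  by left; apply: ln_increasing => //; exact: exp_pos.
rewrite {1}/Rpower ln_exp => h2.
suff : 0 <= s * (ln (\prod_i r (f i) (g i)) - INR n * c * ln 2).
  by case=> [h3| <-]; [left; exact: exp_increasing | lra].
by apply: Rmult_le_pos; [lra | exact/Rge_le/Rge_minus/Rle_ge].
Qed.
End AEP.

Lemma sum_term_le_cond (I : finType) (P : pred I) (F : I -> R) i :
  (forall j, 0 <= F j) -> P i -> F i <= \sum_(j | P j) F j.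
Proof.
move=> F0 Pi; rewrite (bigD1 i) //= -[X in X <= _]Rplus_0_r.
by apply: Rplus_le_compat_l; apply: sum_ge0.
Qed.

Lemma exists_le_mean (T : finType) (p f : T -> R) c : is_dist p -> \sum_t p t * f t <= c ->
  exists t, f t <= c.
Proof.
move=> pd h; apply: NNPP => hn.
have hf t : c < f t by apply: Rnot_le_lt => h'; apply: hn; exists t.
have e : \sum_t p t * (f t - c) = 0.
  apply: Rle_antisym.
    rewrite (eq_bigr (fun t => p t * f t - p t * c)); last by move=> t _; ring.
    by rewrite sumB -big_distrl /= (dist_sum pd); lra.
  by apply: sum_ge0 => t _; apply: Rmult_le_pos; [exact: dist_ge0 pd | have := hf t; lra].
have z t : p t * (f t - c) = 0.
  apply: (sum_eq0 (F := fun t => p t * (f t - c))) => // s.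
  by apply: Rmult_le_pos; [exact: dist_ge0 pd | have := hf s; lra].
have := dist_sum pd; rewrite big1 => [|t _]; first lra.
by case: (Rmult_integral _ _ (z t)) => //; have := hf t; lra.
Qed.

Lemma sum_marginal2 (I A : finType) (W : I -> A -> R) (i0 i1 : I) (g h : A -> R) :
  (forall i, \sum_a W i a = 1) -> i0 != i1 ->
  \sum_(f : {ffun I -> A}) (\prod_i W i (f i)) * (g (f i0) * h (f i1)) =
  (\sum_a W i0 a * g a) * (\sum_a W i1 a * h a).
Proof.
move=> W1 ne; have ne' : (i1 == i0) = false by rewrite eq_sym (negbTE ne).
pose e i a := if i == i0 then g a else if i == i1 then h a else 1.
rewrite (eq_bigr (fun f : {ffun I -> A} => \prod_i (W i (f i) * e i (f i)))) => [|f _].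
  rewrite -(bigA_distr_ffun (fun i a => W i a * e i a)).
  rewrite (bigD1 i0) //= (bigD1 i1) ?ne' //= [X in _ * (_ * X)]big1.
    rewrite Rmult_1_r; congr (_ * _); apply: eq_bigr => a _; rewrite /e ?eqxx //.
    by rewrite ne'.
  move=> i /andP [/negbTE n0 /negbTE n1].
  by rewrite /e n0 n1 -[RHS](W1 i); apply: eq_bigr => a _; rewrite Rmult_1_r.
rewrite [RHS]big_split /=; congr (_ * _).
rewrite (bigD1 i0) //= (bigD1 i1) ?ne' //= big1.
  by rewrite /e ne' !eqxx Rmult_1_r.
by rewrite /e => i /andP [/negbTE -> /negbTE ->].
Qed.

(** The decoder returns some codeword that passes the test [D]. It errs only if the sent word is
    rejected or a competitor is accepted, and a competitor is independent of the output; the union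
    bound gives [INR L * beta]. The message law [mu] is arbitrary because the quantization index
    sent by the relay need not be uniform. *)
Lemma random_coding (L : nat) (X O : finType) (W : X -> O -> R) (p : X -> R)
    (D : X -> O -> bool) (beta : R) (mu : 'I_L -> R) :
  is_channel W -> is_dist p -> is_dist mu -> 0 <= beta ->
  (forall o, \sum_x p x * indic (D x o) <= beta) ->
  exists (cb : 'I_L -> X) (dc : O -> 'I_L),
    \sum_l mu l * \sum_o W (cb l) o * indic (dc o != l) <=
    \sum_x p x * \sum_o W x o * indic (~~ D x o) + INR L * beta.
Proof.
move=> Wc pd md b0 hb.
have [l0 _] : exists l : 'I_L, True.
  apply: NNPP => hn; have := dist_sum md; rewrite big1; first by lra.
  by move=> l _; case: hn; exists l.
pose dc (cb : {ffun 'I_L -> X}) o := if [pick l | D (cb l) o] is Some l then l else l0.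
pose err x := \sum_o W x o * indic (~~ D x o).
have W0 x o : 0 <= W x o by exact: dist_ge0 (Wc x).
suff [cb hcb] : exists cb : {ffun 'I_L -> X},
    \sum_l mu l * \sum_o W (cb l) o * indic (dc cb o != l) <=
    \sum_x p x * err x + INR L * beta by exists cb, (dc cb).
apply: (exists_le_mean (prod_dist (fun _ : 'I_L => pd))).
have dcP cb o l : indic (dc cb o != l) <= indic (~~ D (cb l) o) + \sum_(k | k != l) indic (D (cb k) o).
  have s0 : 0 <= \sum_(k | k != l) indic (D (cb k) o) by apply: sum_ge0 => k _; exact: indic_ge0.
  rewrite /dc; case: pickP => [k Dk|hn]; last first.
    rewrite (hn l) -[X in X <= _]Rplus_0_r.
    by apply: Rplus_le_compat => //; exact: indic_le1.
  case: (altP (k =P l)) => [_|ne]; first by apply: Rplus_le_le_0_compat => //; exact: indic_ge0.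
  have h1 : indic (D (cb k) o) <= \sum_(k | k != l) indic (D (cb k) o).
    by apply: (sum_term_le_cond (F := fun k => indic (D (cb k) o))) => // j; exact: indic_ge0.
  rewrite Dk in h1; rewrite -[X in X <= _]Rplus_0_l.
  by apply: Rplus_le_compat => //; exact: indic_ge0.
have step1 (cb : {ffun 'I_L -> X}) :
  (\prod_i p (cb i)) * (\sum_l mu l * \sum_o W (cb l) o * indic (dc cb o != l)) <=
  \sum_l mu l * ((\prod_i p (cb i)) * err (cb l)
     + \sum_(k | k != l) \sum_o (\prod_i p (cb i)) * (W (cb l) o * indic (D (cb k) o))).
  rewrite big_distrr; apply: sum_le => l _ /=.
  have m0 := dist_ge0 l md.
  have p0 : 0 <= \prod_i p (cb i) by apply: prod_ge0 => i; exact: dist_ge0 pd.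
  rewrite -Rmult_assoc (Rmult_comm _ (mu l)) Rmult_assoc; apply: Rmult_le_compat_l => //.
  rewrite [X in _ <= _ + X](eq_bigr (fun k => (\prod_i p (cb i)) * \sum_o W (cb l) o * indic (D (cb k) o))); last first.
    by move=> k _; rewrite [RHS]big_distrr.
  rewrite -[X in _ <= _ + X]big_distrr /= -Rmult_plus_distr_l; apply: Rmult_le_compat_l => //.
  rewrite [X in _ <= _ + X]exchange_big /err -big_split /=; apply: sum_le => o _.
  rewrite -big_distrr /= -Rmult_plus_distr_l; exact: Rmult_le_compat_l.
apply: Rle_trans (sum_le (fun cb _ => step1 cb)) _.
rewrite exchange_big /=.
have -> : \sum_x p x * err x + INR L * beta = \sum_l mu l * (\sum_x p x * err x + INR L * beta).
  by rewrite -big_distrl /= (dist_sum md) Rmult_1_l.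
apply: sum_le => l _; rewrite -big_distrr /=.
apply: Rmult_le_compat_l; first exact: dist_ge0 md.
rewrite big_split /= (sum_marginal1 l err (fun=> dist_sum pd)).
apply: Rplus_le_compat_l; rewrite exchange_big /=.
apply: Rle_trans (_ : \sum_(k | k != l) beta <= _); last first.
  apply: Rle_trans (sum_sub_le (Q := predT) (fun _ : 'I_L => b0) (fun _ _ => isT)) _.
  by rewrite sum_const card_ord; lra.
apply: sum_le => k ne; rewrite exchange_big /=.
(* Codewords [l] and [k] are independent, so the expectation splits into the output law times the
   acceptance probability of a fresh codeword. *)
rewrite (eq_bigr (fun o => (\sum_a p a * W a o) * (\sum_a p a * indic (D a o)))); last first.
  by move=> o _; rewrite (sum_marginal2 (fun a => W a o) (fun a => indic (D a o)) (fun=> dist_sum pd)) // eq_sym.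
apply: Rle_trans (_ : \sum_o (\sum_a p a * W a o) * beta <= _).
  apply: sum_le => o _; apply: Rmult_le_compat_l => //.
  by apply: sum_ge0 => a _; apply: Rmult_le_pos => //; exact: dist_ge0 pd.
rewrite -big_distrl exchange_big /=.
rewrite (eq_bigr p) => [|a _]; first by rewrite (dist_sum pd); lra.
by rewrite -big_distrr /= (dist_sum (Wc a)) Rmult_1_r.
Qed.

(** A rational substitute for (1 - g)^L <= exp (- L g), sharp enough for covering. *)
Lemma pow_one_minus_le g (L : nat) : 0 <= g <= 1 -> (1 - g) ^ L * (1 + INR L * g) <= 1.
Proof.
move=> [g0 g1]; elim: L => [|L IH]; first by rewrite /= Rmult_0_l; lra.
rewrite S_INR -tech_pow_Rmult.
have p0 : 0 <= (1 - g) ^ L by apply: pow_le; lra.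
have := pos_INR L => L0.
apply: Rle_trans IH.
have -> : (1 - g) * (1 - g) ^ L * (1 + (INR L + 1) * g) = (1 - g) ^ L * ((1 - g) * (1 + (INR L + 1) * g)) by ring.
apply: Rmult_le_compat_l => //; nra.
Qed.

(* The encoder looks for a codeword [u] that is both likely given [y] and cheap on average,
   so that no joint typicality with a third variable (Markov lemma) is required. *)
Lemma covering (Y U : finType) (PY : Y -> R) (q a : Y -> U -> R) (L : nat) (tau gam : R) :
  is_dist PY -> is_channel q -> (forall y u, 0 <= a y u <= 1) ->
  (0 < L)%N -> 0 < tau -> 0 < gam ->
  exists (cb : 'I_L -> U) (f : Y -> 'I_L),
    \sum_y PY y * a y (cb (f y)) <=
    tau + (\sum_y \sum_u PY y * q y u * a y u) / tau
    + \sum_y \sum_u PY y * q y u * indic (~~ Rleb (q y u) (gam * \sum_y' PY y' * q y' u))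
    + gam / INR L.
Proof.
move=> pd qc a01 L0 t0 g0.
have q0 y u : 0 <= q y u by exact: dist_ge0 (qc y).
have p0 y : 0 <= PY y by exact: dist_ge0 pd.
pose PU u := \sum_y PY y * q y u.
have PUd : is_dist PU.
  split=> [u|]; first by apply: sum_ge0 => y _; exact: Rmult_le_pos.
  rewrite /rsum exchange_big -[RHS](dist_sum pd); apply: eq_bigr => y _.
  by rewrite -big_distrr /= (dist_sum (qc y)) Rmult_1_r.
pose G y u := Rleb (a y u) tau && Rleb (q y u) (gam * PU u).
pose f (cb : {ffun 'I_L -> U}) y := if [pick l | G y (cb l)] is Some l then l else Ordinal L0.
(* Markov's inequality in pointwise form: [a y u / tau] dominates the indicator that the cost
   exceeds [tau]. *)
pose bad y u := a y u / tau + indic (~~ Rleb (q y u) (gam * PU u)).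
suff [cb hcb] : exists cb : {ffun 'I_L -> U}, \sum_y PY y * a y (cb (f cb y)) <=
    tau + \sum_y PY y * (\sum_u q y u * bad y u) + gam / INR L.
  exists cb, (f cb); apply: Rle_trans hcb _; right.
  congr (_ + _); rewrite [RHS]Rplus_assoc; congr (_ + _).
  rewrite /Rdiv big_distrl -big_split /=; apply: eq_bigr => y _.
  rewrite big_distrl big_distrr -big_split /=; apply: eq_bigr => u _.
  by rewrite /bad /PU; field; lra.
apply: (exists_le_mean (prod_dist (fun _ : 'I_L => PUd))).
pose none (cb : {ffun 'I_L -> U}) y := [forall l, ~~ G y (cb l)].
have hf (cb : {ffun 'I_L -> U}) y : a y (cb (f cb y)) <= tau + indic (none cb y).
  rewrite /f; case: pickP => [l /andP [/RlebP h _]|hn].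
    by have := indic_ge0 (none cb y); lra.
  have -> : none cb y by apply/forallP => l; rewrite hn.
  by rewrite /=; have := a01 y (cb (Ordinal L0)); lra.
apply: Rle_trans (_ : \sum_(cb : {ffun 'I_L -> U}) \sum_y PY y *
    ((\prod_i PU (cb i)) * (tau + indic (none cb y))) <= _).
  apply: sum_le => cb _; rewrite big_distrr; apply: sum_le => y _ /=.
  have w0 : 0 <= \prod_i PU (cb i) by apply: prod_ge0 => i; exact: dist_ge0 PUd.
  rewrite -Rmult_assoc (Rmult_comm _ (PY y)) Rmult_assoc.
  by apply: Rmult_le_compat_l => //; apply: Rmult_le_compat_l.
rewrite exchange_big /=.
have -> : tau + \sum_y PY y * (\sum_u q y u * bad y u) + gam / INR L =
    \sum_y PY y * (tau + \sum_u q y u * bad y u + gam / INR L).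
  rewrite [RHS](eq_bigr (fun y => PY y * (tau + gam / INR L) + PY y * \sum_u q y u * bad y u)); last first.
    by move=> y _; ring.
  by rewrite [RHS]big_split -[X in _ = X + _]big_distrl /= (dist_sum pd); ring.
apply: sum_le => y _; rewrite -big_distrr /=; apply: Rmult_le_compat_l => //.
rewrite (eq_bigr (fun cb : {ffun 'I_L -> U} => tau * (\prod_i PU (cb i)) +
  \prod_i (PU (cb i) * indic (~~ G y (cb i))))); last first.
  by move=> cb _; rewrite [in RHS]big_split /= prod_indic -/(none cb y); ring.
have s1 := dist_sum (prod_dist (fun _ : 'I_L => PUd)).
rewrite big_split -big_distrr /= s1 -(bigA_distr_ffun (fun (_ : 'I_L) u => PU u * indic (~~ G y u))).
rewrite prod_const card_ord.
pose g := \sum_u PU u * indic (G y u).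
have gE : \sum_u PU u * indic (~~ G y u) = 1 - g.
  rewrite -(dist_sum PUd) /g -sumB; apply: eq_bigr => u _.
  by case: (G y u) => /=; ring.
pose h := \sum_u q y u * indic (G y u).
(* The density bound in [G] compares the probability [h] under the test channel with the probability
   [g] under the law from which codewords are drawn. *)
have hg : h <= gam * g.
  rewrite /h /g big_distrr; apply: sum_le => u _ /=; rewrite /G.
  case: RlebP => _ /=; last by lra.
  by case: RlebP => /= h1; lra.
have PU0 u : 0 <= PU u by exact: dist_ge0 PUd.
have gi : 0 <= g <= 1.
  split; first by apply: sum_ge0 => u _; apply: Rmult_le_pos => //; exact: indic_ge0.
  rewrite -(dist_sum PUd); apply: sum_le => u _.
  by have := indic_le1 (G y u); have := PU0 u; nra.
have hi : 0 <= h <= 1.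
  split; first by apply: sum_ge0 => u _; apply: Rmult_le_pos => //; exact: indic_ge0.
  rewrite -(dist_sum (qc y)); apply: sum_le => u _.
  by have := indic_le1 (G y u); have := q0 y u; nra.
have hb : 1 - h <= \sum_u q y u * bad y u.
  rewrite -(dist_sum (qc y)) /h -sumB; apply: sum_le => u _.
  have -> : q y u - q y u * indic (G y u) = q y u * indic (~~ G y u) by case: (G y u) => /=; ring.
  apply: Rmult_le_compat_l => //; rewrite /bad /G.
  have at0 : 0 <= a y u / tau.
    by apply: Rmult_le_pos; [have := a01 y u; lra | left; exact: Rinv_0_lt_compat].
  case: RlebP => ha /=; first lra.
  have : 1 <= a y u / tau.
    rewrite -(Rinv_r tau); last lra.
    by apply: Rmult_le_compat_r; [left; exact: Rinv_0_lt_compat | lra].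
  by have := indic_ge0 (~~ Rleb (q y u) (gam * PU u)); lra.
rewrite gE Rmult_1_r.
have := pow_one_minus_le L gi.
have p1 : 0 <= (1 - g) ^ L by apply: pow_le; lra.
set x := (1 - g) ^ L in p1 * => hx.
suff : x <= 1 - h + gam / INR L by lra.
have LR : 0 < INR L by apply: lt_0_INR; apply/ltP.
set d := gam / INR L.
have d0 : 0 < d by exact: Rdiv_lt_0_compat.
have gd : gam = d * INR L by rewrite /d; field; lra.
(* All codewords fail with probability at most d / (d + h), where d = gam / L. This is at most 1 - h
   + d because (1 - h + d)(d + h) = d + h (1 - h) + d^2. *)
have h2 : x * (d + h) <= d.
  have : x * (d + d * (INR L * g)) <= d by have := Rmult_le_compat_l _ _ _ (Rlt_le _ _ d0) hx; lra.
  have : x * h <= x * (gam * g) by exact: Rmult_le_compat_l.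
  rewrite gd; nra.
apply: (Rmult_le_reg_r (d + h)); first lra.
nra.
Qed.

(** * Block scheme for the relay *)

(** The rate is the mean of the information density; pairs of weight zero contribute nothing,
    whatever value [log2] takes there. *)
Lemma rate_density (A B : finType) (p : A -> R) (W : A -> B -> R) :
  is_dist p -> is_channel W ->
  \sum_a \sum_b p a * W a b * log2 (W a b / \sum_a' p a' * W a' b) = relay_rate W p.
Proof.
move=> pd Wc; rewrite relay_rateE //.
have p0 a : 0 <= p a by exact: dist_ge0 pd.
have W0 a b : 0 <= W a b by exact: dist_ge0 (Wc a).
set PB := fun b => \sum_a p a * W a b.
have PB0 b : 0 <= PB b by apply: sum_ge0 => a _; exact: Rmult_le_pos.
rewrite entropyE //.
have -> : \sum_b PB b * log2 (PB b) = \sum_a \sum_b p a * W a b * log2 (PB b).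
  by rewrite exchange_big; apply: eq_bigr => b _; rewrite -big_distrl.
rewrite /Rminus -!sumN -big_split /=; apply: eq_bigr => a _.
rewrite entropyE // Ropp_mult_distr_r Ropp_involutive big_distrr /= -sumN -big_split /=.
apply: eq_bigr => b _.
case: (Rmult_le_pos _ _ (p0 a) (W0 a b)) => [h|h]; last first.
  by rewrite -Rmult_assoc -h; ring.
have hW : 0 < W a b.
  by case: (W0 a b) => // e; move: h; rewrite -e; lra.
have hP : 0 < PB b.
  apply: Rlt_le_trans h _; apply: (sum_term_le (F := fun a => p a * W a b)) => a'.
  exact: Rmult_le_pos.
by rewrite -/(PB b) log2_div //; ring.
Qed.

Lemma prod_le1 (I : finType) (F : I -> R) :
  (forall i, 0 <= F i <= 1) -> \prod_i F i <= 1.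
Proof.
move=> h; suff [] : 0 <= \prod_i F i <= 1 by [].
by elim/big_ind: _ => //; [lra | move=> x y ? ?; nra].
Qed.

Lemma INR_card_mul_le (T : finType) (A : {set T}) (f : T -> R) c :
  (forall t, 0 <= f t) -> (forall t, t \in A -> c <= f t) ->
  INR #|A| * c <= \sum_t f t.
Proof.
move=> f0 fc.
have -> : INR #|A| = \sum_(t | t \in A) 1.
  by rewrite -sum1_card (big_morph INR plus_INR (erefl _)).
rewrite big_distrl /=; apply: Rle_trans (_ : \sum_(t | t \in A) f t <= _).
  by apply: sum_le => t /fc; lra.
exact: sum_sub_le.
Qed.

Lemma prod_div (I : finType) (F G : I -> R) :
  \prod_i (F i / G i) = (\prod_i F i) / \prod_i G i.
Proof. by rewrite /Rdiv big_split /= prod_inv. Qed.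

Lemma Rpower2_pow x n : Rpower 2 (INR n * x) = Rpower 2 x ^ n.
Proof. by rewrite Rmult_comm -Rpower_mult Rpower_pow //; exact: exp_pos. Qed.

Lemma Rpower2_gt0 x : 0 < Rpower 2 x. Proof. exact: exp_pos. Qed.

Lemma Rpower2D x y : Rpower 2 (x + y) = Rpower 2 x * Rpower 2 y.
Proof. exact: Rpower_plus. Qed.

Lemma Rpower2_vanish d e : 0 < d -> 0 < e ->
  exists n0 : nat, forall n, (n0 <= n)%N -> Rpower 2 (- (INR n * d)) <= e.
Proof.
move=> d0 e0; have [|n0 hn0] := @pow_vanish (Rpower 2 (- d)) e _ e0.
  split; first by left; exact: Rpower2_gt0.
  by rewrite -(Rpower_O 2); [apply: Rpower_lt; lra | lra].
exists n0 => n /hn0; by rewrite Ropp_mult_distr_r Rpower2_pow.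
Qed.

Lemma nat_ceil x : 0 <= x -> exists L : nat, x <= INR L <= x + 1.
Proof.
move=> x0; have [h1 h2] := archimed x.
have [|L eL] := IZN (up x); first by apply: le_IZR; rewrite /=; lra.
by exists L; rewrite INR_IZR_INZ -eL; lra.
Qed.

Section Density.
Variables (A B : finType) (p : A -> R) (W : A -> B -> R).
Hypothesis pd : is_dist p.
Hypothesis Wc : is_channel W.
Let P a b := p a * W a b.
Let out b := \sum_a P a b.

Let p0 a : 0 <= p a. Proof. exact: dist_ge0 pd. Qed.
Let W0 a b : 0 <= W a b. Proof. exact: dist_ge0 (Wc a). Qed.
Let P0 a b : 0 <= P a b. Proof. exact: Rmult_le_pos. Qed.
Let P1 : \sum_a \sum_b P a b = 1.
Proof.
rewrite -[RHS](dist_sum pd); apply: eq_bigr => a _.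
by rewrite -big_distrr /= (dist_sum (Wc a)) Rmult_1_r.
Qed.
Let Wp a b : 0 < P a b -> 0 < W a b.
Proof. by case: (W0 a b) => // e; rewrite /P -e; lra. Qed.
Let outp a b : 0 < P a b -> 0 < out b.
Proof. by move=> h; apply: Rlt_le_trans h _; apply: (sum_term_le (F := fun a => P a b)). Qed.

Let prod_out n (g : {ffun 'I_n -> B}) :
  \sum_(f : {ffun 'I_n -> A}) (\prod_i p (f i)) * (\prod_i W (f i) (g i)) = \prod_i out (g i).
Proof. by rewrite bigA_distr_ffun; apply: eq_bigr => f _; rewrite -big_split. Qed.

(** Equipartition for the information density, with the threshold multiplied out so that the event
    makes sense even where the output law vanishes. *)
Lemma density_upper c e : relay_rate W p < c -> 0 < e ->
  exists n0 : nat, forall n, (n0 <= n)%N ->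
  \sum_(f : {ffun 'I_n -> A}) \sum_(g : {ffun 'I_n -> B})
    (\prod_i p (f i)) * (\prod_i W (f i) (g i)) *
    indic (~~ Rleb (\prod_i W (f i) (g i)) (Rpower 2 (INR n * c) *
      \sum_(f' : {ffun 'I_n -> A}) (\prod_i p (f' i)) * (\prod_i W (f' i) (g i)))) <= e.
Proof.
rewrite -rate_density // => hc e0.
have rp a b : 0 < P a b -> 0 < W a b / out b.
  by move=> h; apply: Rdiv_lt_0_compat; [exact: Wp | exact: outp h].
have [n0 hn0] := aep P0 P1 rp hc e0.
exists n0 => n /hn0; apply: Rle_trans; apply: sum_le => f _; apply: sum_le => g _.
rewrite -big_split prod_out /=.
case: (prod_ge0 (fun i => P0 (f i) (g i))) => [pp|<-]; last by rewrite !Rmult_0_l; exact: Rle_refl.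
apply: Rmult_le_compat_l; first by left.
case: RlebP => [_|h] /=; first exact: indic_ge0.
case: RlebP => [_|hn] /=; first exact: Rle_refl.
exfalso; apply: hn; rewrite prod_div.
have op : 0 < \prod_i out (g i).
  by apply: prod_gt0 => i; apply: (outp (a := f i)); exact: (prod_gt0_inv (fun i => P0 (f i) (g i))).
apply: (Rmult_le_reg_r _ _ _ op).
rewrite /Rdiv Rmult_assoc Rinv_l; last exact: Rgt_not_eq.
by rewrite Rmult_1_r; left; exact: Rnot_le_lt.
Qed.

Lemma density_lower c e : c < relay_rate W p -> 0 < e ->
  exists n0 : nat, forall n, (n0 <= n)%N ->
  \sum_(f : {ffun 'I_n -> A}) \sum_(g : {ffun 'I_n -> B})
    (\prod_i p (f i)) * (\prod_i W (f i) (g i)) *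
    indic (Rleb (\prod_i W (f i) (g i)) (Rpower 2 (INR n * c) *
      \sum_(f' : {ffun 'I_n -> A}) (\prod_i p (f' i)) * (\prod_i W (f' i) (g i)))) <= e.
Proof.
rewrite -rate_density // => hc e0.
(* The lower tail of the density is the upper tail of its reciprocal. *)
have rp a b : 0 < P a b -> 0 < out b / W a b.
  by move=> h; apply: Rdiv_lt_0_compat; [exact: outp h | exact: Wp].
have hc' : \sum_a \sum_b P a b * log2 (out b / W a b) < - c.
  have -> : \sum_a \sum_b P a b * log2 (out b / W a b) =
      - \sum_a \sum_b P a b * log2 (W a b / out b).
    rewrite -sumN; apply: eq_bigr => a _; rewrite -sumN; apply: eq_bigr => b _.
    case: (P0 a b) => [h|<-]; last by ring.
    by rewrite !log2_div; [ring | exact: Wp | exact: outp h | exact: outp h | exact: Wp].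
  exact: Ropp_lt_contravar.
have [n0 hn0] := aep P0 P1 rp hc' e0.
exists n0 => n /hn0; apply: Rle_trans; apply: sum_le => f _; apply: sum_le => g _.
rewrite -big_split prod_out /=.
case: (prod_ge0 (fun i => P0 (f i) (g i))) => [pp|<-]; last by rewrite !Rmult_0_l; exact: Rle_refl.
apply: Rmult_le_compat_l; first by left.
case: RlebP => [h|_] /=; last exact: indic_ge0.
case: RlebP => [_|hn] /=; first exact: Rle_refl.
exfalso; apply: hn; rewrite prod_div.
have op : 0 < \prod_i W (f i) (g i).
  by apply: prod_gt0 => i; apply: Wp; exact: (prod_gt0_inv (fun i => P0 (f i) (g i))).
apply: (Rmult_le_reg_r _ _ _ op).
rewrite /Rdiv Rmult_assoc Rinv_l; last exact: Rgt_not_eq.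
rewrite Rmult_1_r.
have k0 := Rpower2_gt0 (INR n * - c).
apply: Rle_trans (Rmult_le_compat_l _ _ _ (Rlt_le _ _ k0) h) _.
rewrite -Rmult_assoc -Rpower2D; right.
have -> : INR n * - c + INR n * c = 0 by ring.
by rewrite Rpower_O; [exact: Rmult_1_l | lra].
Qed.
End Density.

(* A length-[n] relay codebook [e] together with the list of noise sequences the destination
   keeps after seeing the relay output. *)
Definition list_scheme (Z Y X1 S : finType) (w : Z -> Y -> R) (ps : X1 -> S -> R)
    (n : nat) (rho eps : R) : Prop :=
  exists (e : {ffun 'I_n -> Y} -> {ffun 'I_n -> X1})
         (A : {ffun 'I_n -> S} -> {set {ffun 'I_n -> Z}}),
    (forall s, INR #|A s| <= Rpower 2 (INR n * rho)) /\
    \sum_z \sum_y iid_weight w z y *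
      (\sum_(s : {ffun 'I_n -> S}) (\prod_i ps (e y i) (s i)) * indic (z \notin A s)) <= eps.

Section Block.
Variables (Z Y : finType) (w : Z -> Y -> R).
Hypothesis w0 : forall z y, 0 <= w z y.
Hypothesis w1 : \sum_y obs_law w y = 1.

Section TypicalList.
Variables (U : finType) (q : Y -> U -> R) (rho : R).
Hypothesis qc : is_channel q.
Hypothesis hrho : equiv w q < rho.

(** The list of u consists of the z with P(z | u) >= 2^(- n rho). These conditional probabilities
    sum to at most 1, so the size bound holds for every u, typical or not; this matters because the
    destination may decode a wrong index. *)
Lemma typical_list eps : 0 < eps -> exists n0 : nat, forall n, (n0 <= n)%N ->
  exists T : {ffun 'I_n -> Z} -> {ffun 'I_n -> U} -> bool,
    (forall u, INR #|[set z | T z u]| <= Rpower 2 (INR n * rho)) /\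
    \sum_(z : {ffun 'I_n -> Z}) \sum_(y : {ffun 'I_n -> Y}) \sum_(u : {ffun 'I_n -> U})
      iid_weight w z y * (\prod_i q (y i) (u i)) * indic (~~ T z u) <= eps.
Proof.
move=> e0.
pose PZU z u := \sum_y w z y * q y u.
have q0 y u : 0 <= q y u by exact: dist_ge0 (qc y).
have P0 z u : 0 <= PZU z u by apply: sum_ge0 => y _; exact: Rmult_le_pos.
pose PU u := \sum_z PZU z u.
have PU0 u : 0 <= PU u by exact: sum_ge0.
pose k z u := PZU z u / PU u.
have iv x : 0 <= x -> 0 <= / x by move=> [h|<-]; [left; exact: Rinv_0_lt_compat | rewrite Rinv_0; lra].
have k0 z u : 0 <= k z u by apply: Rmult_le_pos => //; exact: iv.
have PUp z u : 0 < PZU z u -> 0 < PU u.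
  by move=> h; apply: Rlt_le_trans h _; apply: (sum_term_le (F := fun z => PZU z u)).
have kp z u : 0 < PZU z u -> 0 < k z u.
  by move=> h; apply: Rdiv_lt_0_compat => //; exact: PUp h.
have P1 : \sum_z \sum_u PZU z u = 1.
  rewrite -[RHS]w1 /obs_law [RHS]exchange_big /=; apply: eq_bigr => z _.
  rewrite /PZU exchange_big /=; apply: eq_bigr => y _.
  by rewrite -big_distrr /= (dist_sum (qc y)) Rmult_1_r.
have mean : \sum_z \sum_u PZU z u * log2 (/ k z u) = equiv w q.
  have jE z u : joint_out w q (z, u) = PZU z u by [].
  rewrite /equiv /cond_entropy !entropyE; last 2 first.
  - by move=> u; apply: sum_ge0 => z _; exact: P0.
  - by move=> [z u]; exact: P0.
  rewrite -(pair_bigA _ (fun z u => PZU z u * log2 (PZU z u))) /=.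
  have -> : \sum_u marg2 (joint_out w q) u * log2 (marg2 (joint_out w q) u) =
      \sum_z \sum_u PZU z u * log2 (PU u).
    by rewrite exchange_big; apply: eq_bigr => u _; rewrite -big_distrl.
  rewrite /Rminus Ropp_involutive -sumN -big_split /=; apply: eq_bigr => z _.
  rewrite -sumN -big_split /=; apply: eq_bigr => u _.
  case: (P0 z u) => [h|<-]; last by ring.
  rewrite log2V; last exact: kp.
  rewrite log2_div //; [ring | exact: PUp h].
have := hrho; rewrite -mean => hm.
have rp z u : 0 < PZU z u -> 0 < / k z u by move=> /kp; exact: Rinv_0_lt_compat.
have [n0 hn0] := aep P0 P1 rp hm e0.
exists n0 => n /hn0 {hn0} h.
pose T (z : {ffun 'I_n -> Z}) (u : {ffun 'I_n -> U}) :=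
  Rleb (/ Rpower 2 (INR n * rho)) (\prod_i k (z i) (u i)).
have K0 := Rpower2_gt0 (INR n * rho).
exists T; split=> [u|].
  have s1 : \sum_(z : {ffun 'I_n -> Z}) \prod_i k (z i) (u i) <= 1.
    rewrite -(bigA_distr_ffun (fun i z => k z (u i))).
    apply: prod_le1 => i; split; first exact: sum_ge0.
    rewrite /k /Rdiv -big_distrl /= -/(PU (u i)).
    by case: (PU0 (u i)) => [hp|<-]; [rewrite Rinv_r; lra | lra].
  have s2 : INR #|[set z | T z u]| * / Rpower 2 (INR n * rho) <= 1.
    apply: Rle_trans s1; apply: INR_card_mul_le => [z|z]; first exact: prod_ge0.
    by rewrite inE => /RlebP.
  have := Rmult_le_compat_r _ _ _ (Rlt_le _ _ K0) s2.
  by rewrite Rmult_assoc Rinv_l; lra.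
apply: Rle_trans h; apply: sum_le => z _; rewrite exchange_big /=; apply: sum_le => u _.
rewrite -big_distrl /=.
have -> : \sum_(y : {ffun 'I_n -> Y}) iid_weight w z y * (\prod_i q (y i) (u i)) = \prod_i PZU (z i) (u i).
  by rewrite bigA_distr_ffun; apply: eq_bigr => y _; rewrite -big_split.
have pp := prod_ge0 (fun i => P0 (z i) (u i)).
case: pp => [pp|<-]; last by rewrite !Rmult_0_l; exact: Rle_refl.
apply: Rmult_le_compat_l; first by left.
have kk : 0 < \prod_i k (z i) (u i).
  by apply: prod_gt0 => i; apply: kp; exact: (prod_gt0_inv (fun i => P0 (z i) (u i))).
rewrite /T prod_inv; case: RlebP => [_|hT] /=; first exact: indic_ge0.
case: RlebP => [_|hR] /=; first exact: Rle_refl.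
exfalso; apply: hR; rewrite -[X in X <= _]Rinv_inv; apply: Rinv_le_contravar => //.
by left; exact: Rnot_le_lt.
Qed.
End TypicalList.

Lemma list_scheme_relay (X1 S U : finType) (ps : X1 -> S -> R) (p : X1 -> R)
    (q : Y -> U -> R) (rho eps : R) :
  is_channel ps -> is_dist p -> is_channel q -> info w q < relay_rate ps p ->
  equiv w q < rho -> 0 < eps ->
  exists n0 : nat, forall n, (n0 <= n)%N -> list_scheme w ps n rho eps.
Proof.
move=> psc pd qc hI hrho e0.
(* A quarter of the gap spaces three exponents: I + d for the density threshold of the quantizer, I
   + 2 d for its codebook size, and I + 3 d, still below the channel rate, for the acceptance
   threshold of the relay code. *)
pose d := (relay_rate ps p - info w q) / 4.
have d0 : 0 < d by rewrite /d; lra.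
have I0 := info_ge0 w0 w1 qc.
have obd : is_dist (obs_law w) by split=> // y; exact: obs_law_ge0.
have iE : relay_rate q (obs_law w) < info w q + d by rewrite -info_relay_rate; lra.
have jE : info w q + 3 * d < relay_rate ps p by rewrite /d; lra.
(* The final sum has four terms of size eps / 8 and three of size eps / 16; the square bounds a mean
   cost that covering divides by tau = eps / 8. *)
have e8 : 0 < eps / 8 by lra.
have e64 : 0 < eps / 8 * (eps / 8) by nra.
have e16 : 0 < eps / 16 by lra.
have [n1 h1] := typical_list qc hrho e64.
have [n2 h2] := density_upper obd qc iE e8.
have [n3 h3] := density_lower pd psc jE e8.
have [n4 h4] := Rpower2_vanish d0 e16.
exists (maxn (maxn n1 n2) (maxn n3 n4)) => n.
rewrite !geq_max => /andP [/andP [/h1 [T [Tc Te]] /h2 {h2} hU] /andP [/h3 {h3} hL /h4 {h4} hV]].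
pose gam := Rpower 2 (INR n * (info w q + d)).
pose gam2 := Rpower 2 (INR n * (info w q + 2 * d)).
pose gam3 := Rpower 2 (INR n * (info w q + 3 * d)).
have g0 : 0 < gam by exact: Rpower2_gt0.
have g20 : 0 < gam2 by exact: Rpower2_gt0.
have g30 : 0 < gam3 by exact: Rpower2_gt0.
set v := Rpower 2 (- (INR n * d)) in hV.
have v0 : 0 < v by exact: Rpower2_gt0.
have E1 : gam = gam2 * v by rewrite /gam /gam2 /v -Rpower2D; congr Rpower; ring.
have E2 : gam2 = gam3 * v by rewrite /gam3 /gam2 /v -Rpower2D; congr Rpower; ring.
have g21 : 1 <= gam2.
  rewrite /gam2 -(Rpower_O 2); last lra.
  apply: Rle_Rpower; first lra.
  by apply: Rmult_le_pos; [exact: pos_INR | lra].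
have [L [L1 L2]] := nat_ceil (Rlt_le _ _ g20).
have LR : 0 < INR L by lra.
have L0 : (0 < L)%N by apply/ltP; apply: INR_lt.
pose Zn := {ffun 'I_n -> Z}; pose Yn := {ffun 'I_n -> Y}.
pose Un := {ffun 'I_n -> U}.
pose PY (y : Yn) := \prod_i obs_law w (y i).
pose qn (y : Yn) (u : Un) := \prod_i q (y i) (u i).
have PYd : is_dist PY by exact: (prod_dist (fun=> obd)).
have qnc : is_channel qn by move=> y; exact: (prod_dist (fun i => qc (y i))).
have wn0 := @iid_weight_ge0 _ _ w w0 n.
have PYE y : PY y = \sum_z iid_weight w z y by rewrite -[LHS](obs_law_iid w y).
have PY0 y : 0 <= PY y by exact: dist_ge0 PYd.
pose cost (y : Yn) (u : Un) := \sum_z iid_weight w z y * indic (~~ T z u).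
have cost0 y u : 0 <= cost y u.
  by apply: sum_ge0 => z _; apply: Rmult_le_pos => //; exact: indic_ge0.
have costP y u : cost y u <= PY y.
  rewrite PYE; apply: sum_le => z _; rewrite -[X in _ <= X]Rmult_1_r.
  by apply: Rmult_le_compat_l => //; exact: indic_le1.
(* The conditional probability, given y, that the list of [u] misses the noise; it is 0 where [PY y]
   vanishes, as / 0 = 0. *)
pose a (y : Yn) (u : Un) := cost y u / PY y.
have aE y u : PY y * a y u = cost y u.
  case: (PY0 y) => [h|h]; first by rewrite /a; field; lra.
  by rewrite -h Rmult_0_l; have := cost0 y u; have := costP y u; lra.
have a01 y u : 0 <= a y u <= 1.
  case: (PY0 y) => [h|h]; last by rewrite /a -h /Rdiv Rinv_0 Rmult_0_r; lra.
  have := aE y u; have := cost0 y u; have := costP y u; split.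
    by apply: Rmult_le_pos => //; left; exact: Rinv_0_lt_compat.
  by apply: (Rmult_le_reg_l (PY y)); lra.
have [cb [f hcov]] := @covering Yn Un PY qn a L (eps / 8) gam PYd qnc a01 L0 e8 g0.
have c1 : \sum_y \sum_u PY y * qn y u * a y u <= eps / 8 * (eps / 8).
  apply: Rle_trans Te; right.
  rewrite [RHS]exchange_big /=; apply: eq_bigr => y _; rewrite [RHS]exchange_big /=.
  apply: eq_bigr => u _; rewrite (Rmult_comm (PY y)) Rmult_assoc aE big_distrr /=.
  by apply: eq_bigr => z _; rewrite -Rmult_assoc (Rmult_comm (qn y u)).
have c2 : gam / INR L <= v.
  apply: (Rmult_le_reg_r (INR L)) => //; rewrite /Rdiv Rmult_assoc Rinv_l; nra.
have c3 : (\sum_y \sum_u PY y * qn y u * a y u) / (eps / 8) <= eps / 8.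
  apply: (Rmult_le_reg_r (eps / 8)) => //; rewrite /Rdiv Rmult_assoc Rinv_l; lra.
pose X1n := {ffun 'I_n -> X1}; pose Sn := {ffun 'I_n -> S}.
pose pn (x : X1n) := \prod_i p (x i).
pose Wn (x : X1n) (s : Sn) := \prod_i ps (x i) (s i).
have pnd : is_dist pn by exact: (prod_dist (fun=> pd)).
have Wnc : is_channel Wn by move=> x; exact: (prod_dist (fun i => psc (x i))).
have pn0 x : 0 <= pn x by exact: dist_ge0 pnd.
have Wn0 x s : 0 <= Wn x s by exact: dist_ge0 (Wnc x).
pose out s := \sum_x pn x * Wn x s.
have out0 s : 0 <= out s by apply: sum_ge0 => x _; exact: Rmult_le_pos.
pose D x s := ~~ Rleb (Wn x s) (gam3 * out s).
(* Change of measure: for an accepted x, P(x) is at most P(x) W(x, s) / (gam3 P(s)), and these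
   bounds sum to at most 1 / gam3. *)
have hD s : \sum_x pn x * indic (D x s) <= / gam3.
  have h x : pn x * indic (D x s) <= pn x * Wn x s * (/ gam3 * / out s).
    rewrite /D; case: RlebP => [_|hn] /=.
      rewrite Rmult_0_r; apply: Rmult_le_pos; first exact: Rmult_le_pos.
      apply: Rmult_le_pos; first by left; exact: Rinv_0_lt_compat.
      by case: (out0 s) => [hp|<-]; [left; exact: Rinv_0_lt_compat | rewrite Rinv_0; lra].
    have {}hn := Rnot_le_lt _ _ hn.
    case: (out0 s) => [hp|hp]; last first.
      have z0 : pn x * Wn x s = 0.
        by apply: (sum_eq0 (F := fun x => pn x * Wn x s)) => // x'; exact: Rmult_le_pos.
      have -> : pn x = 0; last by lra.
      by case: (Rmult_integral _ _ z0) => // e; rewrite e -hp Rmult_0_r in hn; lra.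
    rewrite Rmult_assoc; apply: Rmult_le_compat_l => //.
    apply: (Rmult_le_reg_r (gam3 * out s)); first exact: Rmult_lt_0_compat.
    have -> : Wn x s * (/ gam3 * / out s) * (gam3 * out s) = Wn x s by field; lra.
    lra.
  apply: Rle_trans (sum_le (fun x _ => h x)) _.
  rewrite -big_distrl /= -/(out s).
  case: (out0 s) => [hp|<-]; first by right; field; lra.
  by rewrite Rmult_0_l; left; exact: Rinv_0_lt_compat.
have mud := law_dist PYd f.
have [cb1 [dc hrc]] := random_coding Wnc pnd mud (Rlt_le _ _ (Rinv_0_lt_compat _ g30)) hD.
have c4 : \sum_x pn x * \sum_s Wn x s * indic (~~ D x s) <= eps / 8.
  apply: Rle_trans hL; right; apply: eq_bigr => x _; rewrite big_distrr /=.
  by apply: eq_bigr => s _; rewrite /D negbK Rmult_assoc.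
(* L <= gam2 + 1 <= 2 gam2 by [g21], and gam2 / gam3 = v. *)
have c5 : INR L * / gam3 <= 2 * v.
  apply: (Rmult_le_reg_r gam3) => //; rewrite Rmult_assoc Rinv_l; lra.
pose e y := cb1 (f y).
exists e, (fun s => [set z | T z (cb (dc s))]); split=> [s|]; first exact: Tc.
apply: Rle_trans (_ : \sum_y PY y * a y (cb (f y)) +
   \sum_l law PY f l * (\sum_s Wn (cb1 l) s * indic (dc s != l)) <= _); last first.
  have u0 : \sum_y \sum_u PY y * qn y u * indic (~~ Rleb (qn y u) (gam * \sum_y' PY y' * qn y' u)) <= eps / 8.
    exact: hU.
  have A (x a1 a2 a3 y b1 b2 : R) : x <= eps / 8 + a1 + a2 + a3 -> y <= b1 + b2 ->
    a1 <= eps / 8 -> a2 <= eps / 8 -> a3 <= v -> b1 <= eps / 8 -> b2 <= 2 * v ->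
    x + y <= eps by lra.
  exact: A hcov hrc c3 u0 c2 c4 c5.
rewrite (law_expect _ _ (fun l => \sum_s Wn (cb1 l) s * indic (dc s != l))) -big_split exchange_big /=.
apply: sum_le => y _; rewrite aE PYE /cost big_distrl -big_split /=.
apply: sum_le => z _; rewrite -Rmult_plus_distr_l; apply: Rmult_le_compat_l => //.
have -> : indic (~~ T z (cb (f y))) = \sum_s Wn (e y) s * indic (~~ T z (cb (f y))).
  by rewrite -big_distrl /= (dist_sum (Wnc (e y))) Rmult_1_l.
rewrite -big_split /=; apply: sum_le => s _; rewrite -Rmult_plus_distr_l.
apply: Rmult_le_compat_l; first exact: Wn0.
(* With the right index the list is that of the chosen codeword; otherwise the decoding error alone
   accounts for the event. *)
rewrite inE; case: eqP => [->|_] /=; first by rewrite Rplus_0_r; exact: Rle_refl.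
apply: Rle_trans (indic_le1 _) _; rewrite -[X in X <= _]Rplus_0_l.
by apply: Rplus_le_compat_r; exact: indic_ge0.
Qed.

(** The relay sends a constant and the list comes from a one-letter auxiliary alphabet. This covers
    R0 = 0, where no test channel has information strictly below R0. *)
Lemma list_scheme_no_relay (X1 S : finType) (ps : X1 -> S -> R) (x0 : X1) (rho eps : R) :
  is_channel ps -> entropy (fun z => \sum_y w z y) < rho -> 0 < eps ->
  exists n0 : nat, forall n, (n0 <= n)%N -> list_scheme w ps n rho eps.
Proof.
move=> psc; rewrite -(equiv_const w1) => hrho e0.
have [n0 hn0] := typical_list (const_channelP (Y := Y)) hrho e0.
exists n0 => n /hn0 [T [Tc Te]].
pose u0 : {ffun 'I_n -> unit} := [ffun=> tt].
exists (fun=> [ffun=> x0]), (fun=> [set z | T z u0]); split=> [s|]; first exact: Tc.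
apply: Rle_trans Te; right; apply: eq_bigr => z _; apply: eq_bigr => y _.
rewrite -big_distrl /= inE.
have -> : \sum_(s : {ffun 'I_n -> S}) \prod_i ps ([ffun=> x0] i) (s i) = 1.
  exact: (dist_sum (prod_dist (fun i : 'I_n => psc ([ffun=> x0] i)))).
rewrite (big_pred1 u0) => [|u]; last by apply/esym/eqP/ffunP => i; case: (u i) (u0 i) => -[].
by rewrite big1 // /const_channel Rmult_1_r Rmult_1_l.
Qed.
End Block.

(** * Block-Markov chaining *)

Section Chaining.
Variables (Z Y X1 S : finType) (w : Z -> Y -> R) (ps : X1 -> S -> R).
Hypothesis w0 : forall z y, 0 <= w z y.
Hypothesis psc : is_channel ps.
Variables (k n N : nat).
Hypothesis n0 : (0 < n)%N.
Hypothesis hN : (k.+1 * n <= N)%N.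

Lemma block_index_lt (b : nat) (j : 'I_n) : (b <= k)%N -> (b * n + j < N)%N.
Proof.
move=> hb; apply: leq_trans hN; rewrite mulSn addnC.
by apply: leq_trans (_ : j + k * n < _)%N; rewrite ?ltn_add2r // ltnS leq_add2l leq_mul2r hb orbT.
Qed.

(** Block b is observed at the positions [src b], and its index is sent one block later, at [dst b]:
    k useful blocks within k + 1. *)
Definition src (b : 'I_k) (j : 'I_n) : 'I_N := Ordinal (block_index_lt j (ltnW (ltn_ord b))).
Definition dst (b : 'I_k) (j : 'I_n) : 'I_N := Ordinal (block_index_lt j (ltn_ord b)).

Lemma src_inj b : injective (src b).
Proof. by move=> j j' /(congr1 val) /= /addnI e; apply/val_inj. Qed.
Lemma dst_inj b : injective (dst b).
Proof. by move=> j j' /(congr1 val) /= /addnI e; apply/val_inj. Qed.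

Variables (x0 : X1) (y0 : Y).
Variable e : {ffun 'I_n -> Y} -> {ffun 'I_n -> X1}.

(** Reading a prefix at a natural number keeps bounds out of the types. [chain_relay] never meets
    the default [y0], since b n + t < (b + 1) n <= i. *)
Definition lookup (i : nat) (p : {ffun 'I_i -> Y}) (t : nat) : Y :=
  if insub t is Some u then p u else y0.

Definition chain_relay (i : 'I_N) (p : {ffun 'I_i -> Y}) : X1 :=
  if (i %/ n)%N is b.+1 then
    e [ffun t : 'I_n => lookup p (b * n + t)] (Ordinal (ltn_pmod i n0))
  else x0.

Lemma chain_relay_dst (y : {ffun 'I_N -> Y}) b j :
  chain_relay (prefix y (dst b j)) = e [ffun t => y (src b t)] j.
Proof.
rewrite /chain_relay /=.
have -> : ((b.+1 * n + j) %/ n)%N = b.+1 by rewrite divnMDl // divn_small // addn0.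
have -> : Ordinal (ltn_pmod (b.+1 * n + j) n0) = j.
  by apply/val_inj; rewrite /= modnMDl modn_small.
congr (e _ j); apply/ffunP => t; rewrite !ffunE /lookup.
have h : (b * n + t < b.+1 * n + j)%N by rewrite mulSn (addnC n) -addnA ltn_add2l ltn_addr.
rewrite insubT /= ffunE; congr (y _); exact: val_inj.
Qed.

Variable A : {ffun 'I_n -> S} -> {set {ffun 'I_n -> Z}}.

Definition chain_list (s : {ffun 'I_N -> S}) : {set {ffun 'I_N -> Z}} :=
  [set z : {ffun 'I_N -> Z} | [forall b : 'I_k, [ffun j => z (src b j)] \in A [ffun j => s (dst b j)]]].

Lemma chain_list_card (K : R) : (forall s, INR #|A s| <= K) ->
  forall s, INR #|chain_list s| <= K ^ k * INR #|Z| ^ (N - k * n).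
Proof.
move=> hK s.
have kN : (k * n <= N)%N by apply: leq_trans hN; rewrite leq_mul2r leqnSn orbT.
have rl (t : 'I_(N - k * n)) : (k * n + t < N)%N by rewrite -ltn_subRL.
(* A sequence is cut into its k blocks and a remainder of N - k n letters, on which the list imposes
   nothing; the remainder produces the power of [#|Z|]. *)
pose phi (z : {ffun 'I_N -> Z}) : {ffun 'I_k -> {ffun 'I_n -> Z}} * {ffun 'I_(N - k * n) -> Z} :=
  ([ffun b => [ffun j => z (src b j)]], [ffun t => z (Ordinal (rl t))]).
have phi_inj : injective phi.
  move=> z z' [/ffunP e1 /ffunP e2]; apply/ffunP => i.
  case: (ltnP i (k * n)) => hi.
    have hb : (i %/ n < k)%N by rewrite ltn_divLR.
    have := e1 (Ordinal hb); rewrite !ffunE => /ffunP /(_ (Ordinal (ltn_pmod i n0))); rewrite !ffunE.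
    have -> // : src (Ordinal hb) (Ordinal (ltn_pmod i n0)) = i.
    by apply/val_inj; rewrite /= -divn_eq.
  have ht : (i - k * n < N - k * n)%N by rewrite ltn_sub2r // (leq_ltn_trans hi).
  have := e2 (Ordinal ht); rewrite !ffunE.
  have -> // : Ordinal (rl (Ordinal ht)) = i by apply/val_inj; rewrite /= subnKC.
pose FS := [set F : {ffun 'I_k -> {ffun 'I_n -> Z}} | [forall b, F b \in A [ffun j => s (dst b j)]]].
have cFS : INR #|FS| <= K ^ k.
  have -> : INR #|FS| = \prod_b \sum_(f : {ffun 'I_n -> Z}) indic (f \in A [ffun j => s (dst b j)]).
    rewrite bigA_distr_ffun -sum1_card (big_morph INR plus_INR (erefl _)) /= big_mkcond /=.
    by apply: eq_bigr => F _; rewrite prod_indic inE.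
  rewrite -[X in K ^ X](card_ord k) -prod_const.
  suff [] : 0 <= \prod_b \sum_(f : {ffun 'I_n -> Z}) indic (f \in A [ffun j => s (dst b j)]) <= \prod_(b < k) K by [].
  elim/big_ind2: _ => [|x1 x2 y1 y2 [? ?] [? ?]|b _]; first lra.
    by split; [exact: Rmult_le_pos | exact: Rmult_le_compat].
  have -> : \sum_(f : {ffun 'I_n -> Z}) indic (f \in A [ffun j => s (dst b j)]) = INR #|A [ffun j => s (dst b j)]|.
    by rewrite -sum1_card (big_morph INR plus_INR (erefl _)) /= [RHS]big_mkcond.
  by split; [exact: pos_INR | exact: hK].
have h : (#|chain_list s| <= #|FS| * #|Z| ^ (N - k * n))%N.
  rewrite -(card_imset _ phi_inj).
  have -> : (#|FS| * #|Z| ^ (N - k * n))%N = #|setX FS [set: {ffun 'I_(N - k * n) -> Z}]|.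
    by rewrite cardsX cardsT card_ffun card_ord.
  apply: subset_leq_card; apply/subsetP => _ /imsetP [z hz ->].
  rewrite !inE andbT; apply/forallP => b; rewrite ffunE.
  by move: hz; rewrite inE => /forallP.
apply: Rle_trans (le_INR _ _ (elimT leP h)) _; rewrite mult_INR INR_expn.
by apply: Rmult_le_compat_r => //; apply: pow_le; exact: pos_INR.
Qed.

Variable eps : R.
Hypothesis hA : \sum_z \sum_y iid_weight w z y *
  (\sum_(s : {ffun 'I_n -> S}) (\prod_i ps (e y i) (s i)) * indic (z \notin A s)) <= eps.

(** The surroundings of the block are summed out three times: relay outputs given y, then y given z,
    then z. The factorization of [w] supplies the normalized laws for these rounds. *)
Lemma block_error (b : 'I_k) (pz : Z -> R) (py : Z -> Y -> R) :
  (forall z, \sum_y py z y = 1) -> \sum_z pz z = 1 -> (forall z y, w z y = pz z * py z y) ->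
  \sum_(z : {ffun 'I_N -> Z}) \sum_(y : {ffun 'I_N -> Y}) iid_weight w z y *
    (\sum_(s : {ffun 'I_N -> S}) (\prod_i ps (chain_relay (prefix y i)) (s i)) *
       indic ([ffun j => z (src b j)] \notin A [ffun j => s (dst b j)])) <= eps.
Proof.
move=> py1 pz1 wE; apply: Rle_trans hA; right.
pose G (z : {ffun 'I_n -> Z}) (y : {ffun 'I_n -> Y}) :=
  \sum_(s : {ffun 'I_n -> S}) (\prod_i ps (e y i) (s i)) * indic (z \notin A s).
have iw M (z : {ffun 'I_M -> Z}) (y : {ffun 'I_M -> Y}) :
    iid_weight w z y = (\prod_i pz (z i)) * \prod_i py (z i) (y i).
  by rewrite -big_split; apply: eq_bigr => i _; rewrite wE.
pose H (z : {ffun 'I_n -> Z}) := \sum_(y : {ffun 'I_n -> Y}) (\prod_i py (z i) (y i)) * G z y.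
have E1 (z : {ffun 'I_N -> Z}) (y : {ffun 'I_N -> Y}) :
    \sum_(s : {ffun 'I_N -> S}) (\prod_i ps (chain_relay (prefix y i)) (s i)) *
       indic ([ffun j => z (src b j)] \notin A [ffun j => s (dst b j)]) =
    G [ffun j => z (src b j)] [ffun j => y (src b j)].
  rewrite (sum_marginal (fun t => indic ([ffun j => z (src b j)] \notin A t)) (@dst_inj b)
    (W := fun i => ps (chain_relay (prefix y i)))).
    by apply: eq_bigr => s _; congr (_ * _); apply: eq_bigr => j _; rewrite chain_relay_dst.
  by move=> i; exact: dist_sum (psc _).
have E2 (z : {ffun 'I_N -> Z}) :
    \sum_(y : {ffun 'I_N -> Y}) (\prod_i py (z i) (y i)) * G [ffun j => z (src b j)] [ffun j => y (src b j)] =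
    H [ffun j => z (src b j)].
  rewrite (sum_marginal (fun t => G [ffun j => z (src b j)] t) (@src_inj b) (W := fun i => py (z i))) //.
  by apply: eq_bigr => y _; congr (_ * _); apply: eq_bigr => j _; rewrite ffunE.
transitivity (\sum_(z : {ffun 'I_N -> Z}) (\prod_i pz (z i)) * H [ffun j => z (src b j)]).
  apply: eq_bigr => z _; rewrite -E2 big_distrr /=; apply: eq_bigr => y _.
  by rewrite E1 iw Rmult_assoc.
rewrite (sum_marginal H (@src_inj b) (W := fun=> pz)) //.
apply: eq_bigr => z _; rewrite /H big_distrr /=; apply: eq_bigr => y _.
by rewrite iw Rmult_assoc.
Qed.
End Chaining.

(** * Source code *)

(** Codewords are uniform on the group of noise sequences, and the test accepts x when y - x lies in
    the list. Since y - x is then uniform as well, a fresh codeword passes with probability the list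
    size over the group order, whatever the noise law. *)
Lemma source_coding (m N M : nat) (S : finType) (PZS : {ffun 'I_N -> 'Z_m} * S -> R)
    (A : S -> {set {ffun 'I_N -> 'Z_m}}) (K : R) :
  (0 < M)%N -> is_dist PZS -> 0 <= K -> (forall s, INR #|A s| <= K) ->
  exists (en : 'I_M -> {ffun 'I_N -> 'Z_m}) (dc : {ffun 'I_N -> 'Z_m} -> S -> 'I_M),
    / INR M * \sum_(i < M) \sum_zs PZS zs *
      (if dc [ffun j => GRing.add (en i j) (zs.1 j)] zs.2 == i then 0 else 1) <=
    \sum_zs PZS zs * indic (zs.1 \notin A zs.2) + INR M * (K / INR #|{ffun 'I_N -> 'Z_m}|).
Proof.
move=> M0 Pd K0 hK.
pose X := {ffun 'I_N -> 'Z_m}.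
pose add (x z : X) : X := [ffun j => GRing.add (x j) (z j)].
pose sub (y x : X) : X := [ffun j => GRing.add (y j) (GRing.opp (x j))].
have addK x z : sub (add x z) x = z.
  by apply/ffunP => j; rewrite !ffunE GRing.addrC GRing.addKr.
have subK y x : add x (sub y x) = y.
  by apply/ffunP => j; rewrite !ffunE GRing.addrC GRing.subrK.
have subi y : injective (sub y).
  move=> x x' /ffunP e; apply/ffunP => j; have := e j.
  by rewrite !ffunE => /GRing.addrI /GRing.oppr_inj.
have G0 : 0 < INR #|{: X}|.
  by apply: lt_0_INR; apply/ltP; apply/card_gt0P; exists [ffun=> GRing.zero].
have M0R : 0 < INR M by apply: lt_0_INR; apply/ltP.
pose u (x : X) := / INR #|{: X}|.
have ud : is_dist u.
  split=> [x|]; first by left; exact: Rinv_0_lt_compat.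
  by rewrite /rsum /u sum_const Rinv_r //; exact: Rgt_not_eq.
pose mu (i : 'I_M) := / INR M.
have mud : is_dist mu.
  split=> [x|]; first by left; exact: Rinv_0_lt_compat.
  by rewrite /rsum /mu sum_const card_ord Rinv_r //; exact: Rgt_not_eq.
pose W (x : X) (o : X * S) := PZS (sub o.1 x, o.2).
have reix x (F : X * S -> R) : \sum_o F (sub o.1 x, o.2) = \sum_zs F zs.
  rewrite [RHS](reindex (fun o : X * S => (sub o.1 x, o.2))) //=.
  exists (fun zs : X * S => (add x zs.1, zs.2)) => -[a b] _ /=; by rewrite ?subK ?addK.
have Wc : is_channel W.
  move=> x; split=> [o|]; first exact: dist_ge0 Pd.
  by rewrite /rsum /W reix (dist_sum Pd).
pose D (x : X) (o : X * S) := sub o.1 x \in A o.2.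
have b0 : 0 <= K / INR #|{: X}|.
  by apply: Rmult_le_pos => //; left; exact: Rinv_0_lt_compat.
have hb o : \sum_x u x * indic (D x o) <= K / INR #|{: X}|.
  rewrite /u -big_distrr /= Rmult_comm; apply: Rmult_le_compat_r.
    by left; exact: Rinv_0_lt_compat.
  apply: Rle_trans (hK o.2).
  rewrite -sum1_card (big_morph INR plus_INR (erefl _)) /=.
  by right; rewrite [RHS]big_mkcond [RHS](reindex_inj (subi o.1)).
have [cb [dc h]] := random_coding Wc ud mud b0 hb.
exists cb, (fun y s => dc (y, s)).
apply: Rle_trans (_ : \sum_l mu l * \sum_o W (cb l) o * indic (dc o != l) <= _).
  right; rewrite big_distrr; apply: eq_bigr => i _ /=; congr (_ * _).
  rewrite -(reix (cb i)); apply: eq_bigr => -[y s] _ /=.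
  rewrite -/(add (cb i) (sub y (cb i))) subK /W /=.
  by case: (dc (y, s) == i).
apply: Rle_trans h _; apply: Rplus_le_compat_r; right.
pose C := \sum_zs PZS zs * indic (zs.1 \notin A zs.2).
transitivity (\sum_x u x * C); last by rewrite -big_distrl /= (dist_sum ud) Rmult_1_l.
by apply: eq_bigr => x _; rewrite (reix x (fun zs => PZS zs * indic (zs.1 \notin A zs.2))).
Qed.

Lemma nat_ceil_fun (f : nat -> R) : (forall n, 0 <= f n) ->
  exists M : nat -> nat, forall n, f n <= INR (M n) <= f n + 1.
Proof.
move=> f0; pose M n := sval (constructive_indefinite_description _ (nat_ceil (f0 n))).
by exists M => n; rewrite /M; case: constructive_indefinite_description.
Qed.

Section Achievability.
Variables (m : nat) (Y1 X1 S : finType) (pz : 'Z_m -> R)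
  (py1 : 'Z_m -> Y1 -> R) (ps : X1 -> S -> R).
Hypothesis m1 : (1 < m)%N.
Hypothesis pzd : is_dist pz.
Hypothesis pyc : is_channel py1.
Hypothesis psc : is_channel ps.
Variables (x0 : X1) (y0 : Y1).
Let w z y := pz z * py1 z y.

Lemma chained_code (k n N M : nat) (rho eps : R) :
  (0 < n)%N -> (k.+1 * n <= N)%N -> (0 < M)%N -> list_scheme w ps n rho eps ->
  exists c : code m Y1 X1 S N M, err_prob pz py1 ps c <=
    INR k * eps + INR M * Rpower 2 (- (INR n * (INR k * (log2 (INR m) - rho)))).
Proof.
move=> n0 hN M0 [e [A [hK hA]]].
have w0 z y : 0 <= w z y by exact: source_weight_ge0.
have w1 : \sum_y obs_law w y = 1 by exact: source_weight_sum.
pose r (i : 'I_N) (p : {ffun 'I_i -> Y1}) : X1 := chain_relay n0 x0 y0 e p.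
pose qs (y : {ffun 'I_N -> Y1}) (s : {ffun 'I_N -> S}) := \prod_i ps (r i (prefix y i)) (s i).
have qc : is_channel qs by move=> y; exact: (prod_dist (fun i => psc _)).
pose PZS := joint_out (@iid_weight _ _ w N) qs.
have wn0 := @iid_weight_ge0 _ _ w w0 N.
have wn1 := sum_obs_law_iid N w1.
have Pd : is_dist PZS by exact: joint_out_dist.
pose K := Rpower 2 (INR n * rho) ^ k * INR #|'Z_m| ^ (N - k * n).
have mR : 0 < INR m by apply: lt_0_INR; apply/ltP; exact: ltnW.
have K0 : 0 <= K.
  by apply: Rmult_le_pos; apply: pow_le; [left; exact: Rpower2_gt0 | exact: pos_INR].
have cK := chain_list_card n0 hN hK.
have [en [dc h]] := source_coding M0 Pd K0 cK.
exists (Code en r dc); rewrite err_probE; apply: Rle_trans h _; apply: Rplus_le_compat.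
  apply: Rle_trans (_ : \sum_(b < k) eps <= _); last by rewrite sum_const card_ord; lra.
  pose F (b : 'I_k) := \sum_(z : {ffun 'I_N -> 'Z_m}) \sum_(y : {ffun 'I_N -> Y1}) iid_weight w z y *
    (\sum_(s : {ffun 'I_N -> S}) qs y s *
       indic ([ffun j => z (src hN b j)] \notin A [ffun j => s (dst hN b j)])).
  apply: Rle_trans (_ : \sum_b F b <= _); last first.
    apply: sum_le => b _; apply: (@block_error _ _ _ _ w ps psc k n N n0 hN x0 y0 e A eps hA b pz py1) => //.
    - by move=> z; exact: dist_sum (pyc z).
    - exact: dist_sum.
  rewrite -(pair_bigA _ (fun z s => PZS (z, s) * indic (z \notin chain_list hN A s))) /=.
  rewrite [V in _ <= V]exchange_big /=; apply: sum_le => z _.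
  rewrite [V in _ <= V]exchange_big /=.
  have -> : \sum_s PZS (z, s) * indic (z \notin chain_list hN A s) =
    \sum_y iid_weight w z y * (\sum_s qs y s * indic (z \notin chain_list hN A s)).
    rewrite (eq_bigr (fun s => \sum_y iid_weight w z y * (qs y s * indic (z \notin chain_list hN A s)))).
      by rewrite exchange_big; apply: eq_bigr => y _; rewrite big_distrr.
    by move=> s _; rewrite /PZS /joint_out /rsum big_distrl; apply: eq_bigr => y _ /=; rewrite Rmult_assoc.
  apply: sum_le => y _; rewrite -big_distrr /=; apply: Rmult_le_compat_l; first exact: wn0.
  rewrite exchange_big /=; apply: sum_le => s _; rewrite -big_distrr /=.
  apply: Rmult_le_compat_l; first exact: dist_ge0 (qc y).
  (* A sequence outside the chained list is missed in some block: the union bound over k blocks. *)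
  rewrite inE; case: (boolP [forall b : 'I_k, _]) => [_|/forallPn [b hb]] /=.
    by apply: sum_ge0 => b _; exact: indic_ge0.
  apply: Rle_trans (_ : indic ([ffun j => z (src hN b j)] \notin A [ffun j => s (dst hN b j)]) <= _).
    by rewrite hb; exact: Rle_refl.
  apply: (sum_term_le (F := fun b => indic ([ffun j => z (src hN b j)] \notin A [ffun j => s (dst hN b j)]))) => b'.
  exact: indic_ge0.
apply: Rmult_le_compat_l; first exact: pos_INR.
rewrite /K card_ffun (card_Zm m1) card_ord INR_expn; right.
have kN : (k * n <= N)%N by apply: (leq_trans _ hN); rewrite leq_mul2r leqnSn orbT.
(* The free letters contribute m^(N - k n) to both the list size and the group order, and cancel. *)
rewrite -[X in _ / INR m ^ X](subnKC kN) pow_add.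
have -> : Rpower 2 (INR n * rho) ^ k * INR m ^ (N - k * n) / (INR m ^ (k * n) * INR m ^ (N - k * n)) =
    Rpower 2 (INR n * rho) ^ k / INR m ^ (k * n).
  by field; split; apply: pow_nonzero; lra.
rewrite -[X in _ / X ^ _](Rpower2_ln mR) -!Rpower2_pow /Rdiv -Rpower_Ropp -Rpower2D.
by congr Rpower; rewrite mult_INR; ring.
Qed.
End Achievability.

(** * Achievability and capacity *)

(** Achievability asks for one sequence of codes, while the coding argument yields codes for each
    error level. At length n the code is chosen to meet the smallest threshold 1 / (j + 1), j <= n,
    that some code of that length meets. *)
Lemma diagonal_choice (C : nat -> Type) (err : forall n, C n -> R) (c0 : forall n, C n) :
  (forall n c, 0 <= err n c) ->
  (forall d, 0 < d -> exists N0 : nat, forall N, (N0 <= N)%N -> exists c : C N, err N c <= d) ->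
  exists c : forall n, C n, Un_cv (fun n => err n (c n)) 0.
Proof.
move=> e0 he.
have ip j : 0 < / INR j.+1 by apply: Rinv_0_lt_compat; apply: lt_0_INR; lia.
have mono i j : (i <= j)%N -> / INR j.+1 <= / INR i.+1.
  by move=> /leP ij; apply: Rinv_le_contravar; [apply: lt_0_INR; lia | apply: le_INR; lia].
have best N J : exists c : C N, forall j, (j <= J)%N ->
    (exists c' : C N, err N c' <= / INR j.+1) -> err N c <= / INR j.+1.
  elim: J => [|J [c hc]].
    case: (classic (exists c' : C N, err N c' <= / INR 1)) => [[c hc]|hn].
      by exists c => j; rewrite leqn0 => /eqP -> _.
    by exists (c0 N) => j; rewrite leqn0 => /eqP -> /hn.
  case: (classic (exists c' : C N, err N c' <= / INR J.+2)) => [[c' hc']|hn].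
    by exists c' => j hj _; apply: Rle_trans hc' _; exact: mono.
  exists c => j; rewrite leq_eqVlt => /orP [/eqP -> /hn //|hj]; exact: hc.
exists (fun N => sval (constructive_indefinite_description _ (best N N))) => d d0.
have [j [hj1 hj2]] := archimed_cor1 d d0.
have [N0 hN0] := he _ (ip j).
exists (maxn N0 j) => N /leP; rewrite geq_max => /andP [hN hjN].
rewrite /Rdist Rminus_0_r Rabs_pos_eq; last exact: e0.
case: constructive_indefinite_description => c hc.
apply: Rle_lt_trans (hc j hjN (hN0 N hN)) _; apply: Rle_lt_trans hj1.
by apply: Rinv_le_contravar; [exact: lt_0_INR | rewrite S_INR; lra].
Qed.

Section Direct.
Variables (m : nat) (Y1 X1 S : finType) (pz : 'Z_m -> R)
  (py1 : 'Z_m -> Y1 -> R) (ps : X1 -> S -> R).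
Hypothesis m1 : (1 < m)%N.
Hypothesis pzd : is_dist pz.
Hypothesis pyc : is_channel py1.
Hypothesis psc : is_channel ps.
Variables (x0 : X1) (y0 : Y1).
Let w z y := pz z * py1 z y.
Let w0 z y : 0 <= w z y. Proof. exact: source_weight_ge0. Qed.
Let w1 : \sum_y obs_law w y = 1. Proof. exact: source_weight_sum. Qed.

Lemma err_prob_ge0 n M (c : code m Y1 X1 S n M) : 0 <= err_prob pz py1 ps c.
Proof.
case: M c => [|M] c; first by rewrite /err_prob /= Rinv_0; lra.
apply: Rmult_le_pos; first by left; apply: Rinv_0_lt_compat; apply: lt_0_INR; lia.
do 4 (apply: sum_ge0 => ? _).
apply: Rmult_le_pos; last by case: ifP => _; lra.
by apply: prod_ge0 => i; apply: Rmult_le_pos; [exact: w0 | exact: dist_ge0 (psc _)].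
Qed.

Lemma list_scheme_codes (rho Rt : R) (M : nat -> nat) :
  (forall eps, 0 < eps -> exists n0 : nat, forall n, (n0 <= n)%N -> list_scheme w ps n rho eps) ->
  0 <= Rt < log2 (INR m) - rho ->
  (forall n, Rpower 2 (INR n * Rt) <= INR (M n) <= Rpower 2 (INR n * Rt) + 1) ->
  forall d, 0 < d -> exists N0 : nat, forall N, (N0 <= N)%N ->
    exists c : code m Y1 X1 S N (M N), err_prob pz py1 ps c <= d.
Proof.
move=> hls [R0 hR] hM d d0.
set th := log2 (INR m) - rho in hR.
(* The number of blocks is taken so large that k (th - Rt) > Rt, that is k th > (k + 1) Rt: the rate
   survives the loss of one block. *)
have q0 : 0 <= Rt / (th - Rt) + 1.
  suff : 0 <= Rt / (th - Rt) by lra.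
  by apply: Rmult_le_pos => //; left; apply: Rinv_0_lt_compat; lra.
have [k [hk _]] := nat_ceil q0.
pose eta := INR k * th - INR k.+1 * Rt.
have eta0 : 0 < eta.
  have : Rt < INR k * (th - Rt).
    apply: Rlt_le_trans (Rmult_le_compat_r _ _ _ _ hk); last lra.
    by rewrite Rmult_plus_distr_r /Rdiv Rmult_assoc Rinv_l; lra.
  by rewrite /eta S_INR; lra.
have k1 : 0 < INR k.+1 by apply: lt_0_INR; lia.
(* The factor 2 absorbs the rounding of [M], the exponent (k + 1) Rt the rounding of N up to (k +
   1)(n + 1). *)
pose a := 2 * Rpower 2 (INR k.+1 * Rt).
have a0 : 0 < a by have := Rpower2_gt0 (INR k.+1 * Rt); rewrite /a; lra.
have ep : 0 < d / 2 / INR k.+1 by apply: Rdiv_lt_0_compat; lra.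
have dp : 0 < d / 2 / a by apply: Rdiv_lt_0_compat; lra.
have [n1 h1] := hls _ ep.
have [n2 h2] := Rpower2_vanish eta0 dp.
exists (k.+1 * (maxn n1 n2).+1)%N => N hN.
pose n := (N %/ k.+1)%N.
have hn : ((maxn n1 n2).+1 <= n)%N by rewrite /n leq_divRL // mulnC.
have n0 : (0 < n)%N by apply: leq_trans hn.
have hnN : (k.+1 * n <= N)%N by rewrite mulnC /n leq_divM.
have Nn : (N <= k.+1 * n.+1)%N by rewrite mulnC ltnW // -ltn_divLR.
have [hM1 hM2] := hM N.
have M0 : (0 < M N)%N.
  by apply/ltP; apply: INR_lt; apply: Rlt_le_trans hM1; exact: Rpower2_gt0.
have l1 : (n1 <= n)%N by apply: leq_trans (ltnW hn); rewrite leq_maxl.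
have l2 : (n2 <= n)%N by apply: leq_trans (ltnW hn); rewrite leq_maxr.
have [c hc] := chained_code m1 pzd pyc psc x0 y0 n0 hnN M0 (h1 n l1).
exists c; apply: Rle_trans hc _.
have b1 : INR k * (d / 2 / INR k.+1) <= d / 2.
  have -> : INR k * (d / 2 / INR k.+1) = d / 2 * (INR k / INR k.+1) by field; lra.
  rewrite -[X in _ <= X]Rmult_1_r; apply: Rmult_le_compat_l; first lra.
  apply: (Rmult_le_reg_r (INR k.+1)) => //.
  by rewrite /Rdiv Rmult_assoc Rinv_l ?S_INR; rewrite ?S_INR in k1; lra.
suff b2 : INR (M N) * Rpower 2 (- (INR n * (INR k * th))) <= d / 2.
  by rewrite -/th; lra.
have b3 : INR (M N) <= a * Rpower 2 (INR n * (INR k.+1 * Rt)).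
  have -> : a * Rpower 2 (INR n * (INR k.+1 * Rt)) = 2 * Rpower 2 (INR (k.+1 * n.+1) * Rt).
    by rewrite /a Rmult_assoc -Rpower2D mult_INR (S_INR n); congr (2 * Rpower 2 _); ring.
  have b4 : Rpower 2 (INR N * Rt) <= Rpower 2 (INR (k.+1 * n.+1) * Rt).
    apply: Rle_Rpower; first lra.
    by apply: Rmult_le_compat_r => //; apply: le_INR; apply/leP.
  have b5 : 1 <= Rpower 2 (INR (k.+1 * n.+1) * Rt).
    rewrite -{1}(Rpower_O 2); last lra.
    by apply: Rle_Rpower; [lra | apply: Rmult_le_pos => //; exact: pos_INR].
  lra.
apply: Rle_trans (Rmult_le_compat_r _ _ _ (Rlt_le _ _ (Rpower2_gt0 _)) b3) _.
rewrite Rmult_assoc -Rpower2D.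
have -> : INR n * (INR k.+1 * Rt) + - (INR n * (INR k * th)) = - (INR n * eta) by rewrite /eta; ring.
apply: Rle_trans (Rmult_le_compat_l _ _ _ (Rlt_le _ _ a0) (h2 n l2)) _.
by right; field; lra.
Qed.

Lemma list_scheme_achievable (rho Rt : R) :
  (forall eps, 0 < eps -> exists n0 : nat, forall n, (n0 <= n)%N -> list_scheme w ps n rho eps) ->
  0 <= Rt < log2 (INR m) - rho -> achievable pz py1 ps Rt.
Proof.
move=> hls hR.
have [M hM] := nat_ceil_fun (fun n => Rlt_le _ _ (Rpower2_gt0 (INR n * Rt))).
have M0 n : (0 < M n)%N.
  by apply/ltP; apply: INR_lt; apply: Rlt_le_trans (proj1 (hM n)); exact: Rpower2_gt0.
have [c hc] := @diagonal_choice (fun n => code m Y1 X1 S n (M n)) (fun n c => err_prob pz py1 ps c)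
  (fun n => Code (fun=> [ffun=> GRing.zero]) (fun _ _ => x0) (fun _ _ => Ordinal (M0 n)))
  (fun n c => err_prob_ge0 c) (list_scheme_codes hls hR hM).
by exists M, c; split=> // n; case: (hM n).
Qed.

Lemma achievable_neg (Rt : R) : Rt < 0 -> achievable pz py1 ps Rt.
Proof.
move=> hR; exists (fun=> 1%N).
exists (fun n => Code (fun=> [ffun=> GRing.zero]) (fun _ _ => x0) (fun _ _ => ord0)); split=> [n|].
  rewrite /= -(Rpower_O 2); last lra.
  by apply: Rle_Rpower; [lra | have := pos_INR n; nra].
apply: Un_cv_ext (Un_cv_const 0) => n; rewrite /err_prob /rsum big1 ?Rmult_0_r // => i _.
do 3 (rewrite big1 // => ? _); rewrite [i]ord1 /= Rmult_0_r //.
Qed.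

Lemma achievability (U : finType) (q : Y1 -> U -> R) (R0 Rt : R) :
  is_lub (fun r => exists p : X1 -> R, is_dist p /\ r = relay_rate ps p) R0 ->
  is_channel q -> info w q <= R0 -> Rt < log2 (INR m) - equiv w q ->
  achievable pz py1 ps Rt.
Proof.
move=> [_ lubR] qc hI hR.
case: (Rlt_le_dec Rt 0) => [/achievable_neg //|Rt0].
have strict (V : finType) (v : Y1 -> V -> R) : is_channel v -> info w v < R0 ->
    Rt < log2 (INR m) - equiv w v -> achievable pz py1 ps Rt.
  move=> vc vI vR.
  have [p [pd hp]] : exists p, is_dist p /\ info w v < relay_rate ps p.
    apply: NNPP => hn; have : R0 <= info w v; last by lra.
    apply: lubR => r [p [pd ->]]; apply: Rnot_lt_le => h; apply: hn; by exists p.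
  (* The list exponent is the midpoint of [equiv w v] and log2 m - Rt. *)
  apply: (@list_scheme_achievable ((log2 (INR m) - Rt + equiv w v) / 2)); last by lra.
  by move=> eps e0; apply: (list_scheme_relay w0 w1 psc pd vc hp) => //; lra.
case: hI => [hI|hI]; first exact: strict hI hR.
have I0 := info_ge0 w0 w1 qc.
(* With I = R0 = 0 mixing cannot help, but then H(Z | U) >= H(Z) and a silent relay does as well. *)
case: (Req_dec (info w q) 0) => [z|nz].
  have hH := info0_equiv w0 w1 qc z.
  apply: (@list_scheme_achievable ((log2 (INR m) - Rt + equiv w q) / 2)); last by lra.
  by move=> eps e0; apply: (list_scheme_no_relay w0 w1 x0 psc) => //; lra.
pose H := equiv w (@const_channel Y1).
pose g := log2 (INR m) - Rt - equiv w q.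
(* The weight of the constant channel: positive, so that (1 - l) I < I = R0, and small enough that
   the equivocation rises by less than the spare rate [g]. The summand 1 keeps the denominator
   positive. *)
pose l := Rmin 1 (g / (2 * (1 + Rabs (H - equiv w q)))).
have hp := Rabs_pos (H - equiv w q).
have ha := Rle_abs (H - equiv w q).
have g0 : 0 < g by rewrite /g; lra.
have l0 : 0 < l by apply: Rmin_glb_lt; [lra | apply: Rdiv_lt_0_compat; lra].
have l1 : l <= 1 by exact: Rmin_l.
have l2 : l * (2 * (1 + Rabs (H - equiv w q))) <= g.
  have := Rmin_r 1 (g / (2 * (1 + Rabs (H - equiv w q)))); rewrite -/l => h.
  apply: Rle_trans (Rmult_le_compat_r _ _ _ _ h) _; first by lra.
  by right; field; lra.
have l3 : 0 <= 1 - l <= 1 by lra.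
have [v [vc [vi ve]]] := channel_mix w0 l3 qc (const_channelP (Y := Y1)).
apply: (strict _ v) => //.
  by rewrite vi (info_const w1); nra.
rewrite ve -/H; suff : l * (H - equiv w q) < g by rewrite /g; lra.
nra.
Qed.
End Direct.

Theorem theorem2 (m : nat) (Y1 X1 S : finType) (pz : 'Z_m -> R)
  (py1 : 'Z_m -> Y1 -> R) (ps : X1 -> S -> R) (R0 : R) :
  (1 < m)%N -> (0 < #|X1|)%N ->
  is_dist pz -> is_channel py1 -> is_channel ps ->
  is_lub (fun r => exists p : X1 -> R, is_dist p /\ r = relay_rate ps p) R0 ->
  exists C : R,
    is_lub (achievable pz py1 ps) C /\
    (exists (k : nat) (q : Y1 -> 'I_k -> R),
        (k <= #|Y1| + 2)%N /\ is_channel q /\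
        aux_info pz py1 q <= R0 /\ aux_value pz py1 q = C) /\
    (forall (k : nat) (q : Y1 -> 'I_k -> R),
        is_channel q -> aux_info pz py1 q <= R0 -> aux_value pz py1 q <= C).
Proof.
move=> m1 /card_gt0P [x0 _] pzd pyc psc lubR.
pose w z y := pz z * py1 z y.
have w0 z y : 0 <= w z y by exact: source_weight_ge0.
have w1 : \sum_y obs_law w y = 1 by exact: source_weight_sum.
have [y0 _] : exists y : Y1, True.
  apply: NNPP => hn; have := w1; rewrite big1; first by lra.
  by move=> y _; case: hn; exists y.
have R0ub p : is_dist p -> relay_rate ps p <= R0.
  by move=> pd; case: lubR => ub _; apply: ub; exists p.
(* Nonnegativity of R0 makes the constant channel feasible, so the minimization runs over a nonempty
   set. *)
have R00 : 0 <= R0.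
  pose p x := indic (x == x0).
  have pd : is_dist p.
    split=> [x|]; first exact: indic_ge0.
    rewrite /rsum -[RHS](sum_indic_eq (fun=> 1) x0); apply: eq_bigr => x _.
    by rewrite Rmult_1_l.
  apply: Rle_trans (R0ub p pd); apply: mutual_info_ge0; split=> [xs|].
    by apply: Rmult_le_pos; [exact: dist_ge0 pd | exact: dist_ge0 (psc _)].
  rewrite /rsum -(pair_bigA _ (fun x s => p x * ps x s)) /= -[RHS](dist_sum pd).
  by apply: eq_bigr => x _; rewrite -big_distrr /= (dist_sum (psc x)) Rmult_1_r.
have [|qs [qsc [qsi qsmin]]] := @equiv_min_attained _ _ w w0 'I_(#|Y1| + 2) R0.
  have [q [qc [qi _]]] := channel_cardinality_bound w0 (const_channelP (Y := Y1)).
  by exists q; split=> //; rewrite qi (info_const w1).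
(* All finite alphabets must be covered, because the converse builds its test channel on an alphabet
   that grows with the block length. *)
have opt (U : finType) (q : Y1 -> U -> R) : is_channel q -> info w q <= R0 ->
    log2 (INR m) - equiv w q <= log2 (INR m) - equiv w qs.
  move=> qc hq; have [q' [qc' [qi qe]]] := channel_cardinality_bound w0 qc.
  by have := qsmin q' qc'; rewrite qi qe => /(_ hq); lra.
exists (log2 (INR m) - equiv w qs); split; last split.
- split=> [Rt|b hb]; first exact: (converse m1 pzd pyc psc R0ub opt).
  apply: Rnot_lt_le => h.
  have : (b + (log2 (INR m) - equiv w qs)) / 2 <= b; last by lra.
  by apply: hb; apply: (achievability m1 pzd pyc psc x0 y0 lubR qsc qsi); rewrite -/w; lra.
- by exists (#|Y1| + 2)%N, qs.
- by move=> k q; exact: opt.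
Qed.
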